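(* Let $L_n$ be the maximal size of a $D$-forest contained in the random Pólya tree $T_n$ of size $n$ (with respect to the decomposition given by a uniformly random automorphism). Then, for every $s$ with $0<s<1$, $$\left(1-(\log n)^{-s}\right)\left(\frac{-2\log n}{\log\rho}\right)\le L_n\le\left(1+(\log n)^{-s}\right)\left(\frac{-2\log n}{\log\rho}\right)$$ holds with probability $1-o(1)$ as $n\to\infty$.
   Context: A Pólya tree is a rooted unlabelled non-plane tree; its size is its number of nodes. Let $t_n$ be the number of Pólya trees of size $n$, $T(z)=\sum_{n\ge1}t_nz^n$ (so $T(z)=z\exp(\sum_{i\ge1}T(z^i)/i)$), and let $\rho\approx 0.3383219$ be the radius of convergence of $T(z)$; $0<\rho<1$. Random decomposition: choose a Pólya tree $T_n$ uniformly at random among all Pólya trees of size $n$, and then choose an automorphism $\sigma$ of the rooted tree $T_n$ (a permutation of its nodes) uniformly at random from $\operatorname{Aut}(T_n)$. The fixed nodes of $\sigma$ form a subtree $C_n$ of $T_n$ containing the root (the $C$-tree). For a node $v$ of $C_n$, the $D$-forest $F_n(v)$ attached to $v$ is the (possibly empty) forest consisting of the full subtrees of $T_n$ rooted at those children of $v$ that are not fixed by $\sigma$. Its size $|F_n(v)|$ is its number of nodes. Then $L_n=\max_{v\in C_n}|F_n(v)|$. *)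

(* Defs.v *)
From HB Require Import structures.
From mathcomp Require Import all_boot all_order all_fingroup all_algebra.
From mathcomp Require Import all_classical all_reals all_analysis.
Import Order.TTheory GRing.Theory Num.Theory.
Import numFieldNormedType.Exports.

Set Implicit Arguments.
Unset Strict Implicit.
Unset Printing Implicit Defensive.

Local Open Scope ring_scope.

Section Trees.
Variable n : nat.
Implicit Types (f g : {ffun 'I_n -> 'I_n}) (s : {perm 'I_n}).

(* A rooted non-plane tree with node set 'I_n is encoded by its parent map,
   with the convention that the root is its own parent.  The map describes a
   tree exactly when iterating it from any node leads to the root; the root is
   then the only fixed point.  In particular there is no tree for n = 0. *)
Definition rooted_trees : {set {ffun 'I_n -> 'I_n}} :=
  [set f : {ffun 'I_n -> 'I_n} | [exists r, (f r == r) && [forall v, fconnect f v r]]].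

Definition child f (v c : 'I_n) : bool := (c != v) && (f c == v).

(* fconnect f w c says that c is w itself or an ancestor of w. *)
Definition subtree f (c : 'I_n) : {set 'I_n} := [set w | fconnect f w c].

(* Since the root is the only fixed point of a parent map, a bijection commutes
   with the parent maps iff it maps root to root and edges to edges. *)
Definition tree_iso f g : bool :=
  [exists s : {perm 'I_n}, [forall v, s (f v) == g (s v)]].

Definition tree_aut f : {set {perm 'I_n}} :=
  [set s : {perm 'I_n} | [forall v, s (f v) == f (s v)]].

Lemma tree_iso_equiv : {in rooted_trees & &, equivalence_rel tree_iso}.
Proof.
have iso_refl f : tree_iso f f.
  by apply/existsP; exists 1%g; apply/forallP => v; rewrite !perm1.
have iso_sym f g : tree_iso f g -> tree_iso g f.
  case/existsP => s /forallP sP; apply/existsP; exists (s^-1)%g.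
  apply/forallP => v; apply/eqP; apply: (@perm_inj _ s).
  by rewrite (eqP (sP _)) !permKV.
have iso_trans f g h : tree_iso f g -> tree_iso g h -> tree_iso f h.
  case/existsP => s /forallP sP /existsP[u /forallP uP].
  apply/existsP; exists (s * u)%g; apply/forallP => v.
  by rewrite !permM (eqP (sP v)) (eqP (uP _)).
move=> f g h _ _ _; split=> // fg; apply/idP/idP; first exact/iso_trans/iso_sym.
exact: iso_trans.
Qed.

(* Unlabelled trees are isomorphism classes; each class is represented by one
   labelled tree, which gives access to its nodes and automorphisms.  The law of
   the quantities below does not depend on the chosen representatives. *)
Definition polya_trees : {set {ffun 'I_n -> 'I_n}} :=
  transversal (equivalence_partition tree_iso rooted_trees) rooted_trees.

Lemma polya_treesP :
  is_transversal polya_trees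
    (equivalence_partition tree_iso rooted_trees) rooted_trees.
Proof. exact/transversalP/equivalence_partitionP/tree_iso_equiv. Qed.

Definition C_tree s : {set 'I_n} := [set v | s v == v].

Definition D_forest f s (v : 'I_n) : {set 'I_n} :=
  \bigcup_(c | child f v c && (s c != c)) subtree f c.

Definition max_D_forest f s : nat := \max_(v in C_tree s) #|D_forest f s v|.

(* Probability of the event E for the random pair (T_n, sigma). *)
Definition decomp_prob (R : realType)
    (E : {ffun 'I_n -> 'I_n} -> {perm 'I_n} -> bool) : R :=
  \sum_(f in polya_trees) #|polya_trees|%:R^-1 *
    (\sum_(s in tree_aut f | E f s) #|tree_aut f|%:R^-1).

End Trees.

Definition polya_count (n : nat) : nat := #|polya_trees n|.

(* For real coefficients it suffices to test convergence at real points. *)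
Definition convergence_radius (R : realType) (a : nat -> R) : \bar R :=
  ereal_sup [set (`|x|)%:E | x in [set x : R | cvgn (pseries a x)]].

Definition polya_radius (R : realType) : R :=
  fine (convergence_radius (fun n => (polya_count n)%:R : R)).

(* Main.v *)
(* A tree with an automorphism is its C-tree, a rooted labelled tree on [m] nodes by
   Cayley's formula, with a D-forest attached to every node. With [t_n] the number of
   Polya trees, [D] the generating function of D-forests, [Q(z) = z D(z)] and
   [tau_m = m^(m-1)/m!], this gives [t_n = [z^n] sum_m tau_m Q(z)^m]; restricting the
   sizes of the D-forests to a set restricts [D] to the corresponding coefficients.

   Since [tau_m] is [e^m] up to polynomial factors, the radius [rho] is the point where
   [e Q(rho) = 1]. A D-forest consists of cycles of at least two isomorphic trees, so [D]
   converges up to [sqrt rho], and its coefficients of even index [k] are of order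
   [rho^(-k/2)] up to polynomial factors because of pairs of equal trees.

   At [rho] the sum over [m] describes a renewal process with exponentially decaying
   steps, whence [t_n rho^n >= c m^(m-1)/(m! e^m)] at [m = n]. Marking a D-forest of size
   [> M] costs a factor [O(n rho^(M/2))], because C-trees of size less than [n / D] have
   exponentially small weight; this is the upper bound for the maximum. For the lower
   bound, deleting the coefficient of index [k] from [D] moves the solution of [e Q = 1]
   beyond [rho] by at least a constant times [rho^(k/2) / k^2], so avoiding the size [k]
   has probability at most [n^O(1) exp(- c n rho^(k/2) / k^2)]. *)

Require Import Defs.
From HB Require Import structures.
From mathcomp Require Import all_boot all_order all_fingroup all_algebra.
From mathcomp Require Import ring lra zify.
From mathcomp Require Import reals.
Import Order.TTheory GRing.Theory Num.Theory.

Set Implicit Arguments.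
Unset Strict Implicit.
Unset Printing Implicit Defensive.

Local Open Scope ring_scope.

(** * Set partitions and the exponential formula *)

(** Generating functions stay truncated throughout: an infinite sum enters only through bounds on
    polynomials at nonnegative real points that are uniform in the degree. Positivity of
    coefficients replaces analyticity, and convexity replaces derivatives. Stirling's formula is
    avoided by keeping [stirling R n] in the numerator and in the denominator of a probability;
    elementary monotonicity of [stirling R m] and of [m * stirling R m] then suffices. No exact
    enumeration of D-forests is needed: convergence beyond [rho] requires an upper bound only, and
    the lower tail a lower bound at even sizes only. At [k = (1 + (ln n)^(-s))] times the centre,
    [n * rho^(k/2)] equals [exp(-(ln n)^(1-s))], so the upper tail can afford the single factor [n]
    but no further power of [n]. At the lower end it equals [exp((ln n)^(1-s))], which for [s < 1]
    beats every power of [ln n]; this pays for [k^2] and for a multiple of [ln n] in the exponent,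
    so there powers of [n] may be lost freely. *)

Lemma card_eq_can (I J : finType) (A : {pred I}) (B : {pred J})
    (f : I -> J) (g : J -> I) :
  {in A, forall x, f x \in B} -> {in B, forall y, g y \in A} ->
  {in A, cancel f g} -> {in B, cancel g f} -> #|A| = #|B|.
Proof.
move=> fAB gBA fK gK; apply/eqP; rewrite eqn_leq; apply/andP; split.
  rewrite -(card_in_image (can_in_inj fK)); apply/subset_leq_card/subsetP.
  by move=> _ /imageP[x Ax ->]; apply: fAB.
rewrite -(card_in_image (can_in_inj gK)); apply/subset_leq_card/subsetP.
by move=> _ /imageP[x Ax ->]; apply: gBA.
Qed.

(** A relation replaces the injection because the partner of [x] will be produced by an existence
    lemma only; one partner is picked for each [x], with [None] outside [A]. *)
Lemma leq_card_rel (I J : finType) (A : {pred I}) (B : {pred J})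
    (Z : I -> J -> Prop) :
  (forall x, x \in A -> exists2 y, y \in B & Z x y) ->
  (forall x x' y, x \in A -> x' \in A -> Z x y -> Z x' y -> x = x') ->
  (#|A| <= #|B|)%N.
Proof.
move=> exZ injZ.
have [f fP] : exists f : I -> option J,
    forall x, x \in A -> exists2 y, f x = Some y & y \in B /\ Z x y.
  apply: (@fin_all_exists I (fun=> option J) (fun x oy =>
    x \in A -> exists2 y, oy = Some y & y \in B /\ Z x y)) => x.
  case: (boolP (x \in A)) => [/exZ[y By Zxy] | nAx]; last by exists None.
  by exists (Some y) => _; exists y.
have finj : {in A &, injective f}.
  move=> x x' Ax Ax'; have [y -> [By Zy]] := fP x Ax.
  have [y' -> [_ Zy']] := fP x' Ax' => -[eqy]; subst y'.
  exact: injZ Zy Zy'.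
have Sinj : injective (@Some J) by move=> ? ? [].
rewrite -(card_in_image finj) -(card_image Sinj).
apply/subset_leq_card/subsetP => _ /imageP[x Ax ->].
by have [y -> [By _]] := fP x Ax; apply/imageP; exists y.
Qed.

(* [p x] is the pair (parent of [x], image of [x] under the automorphism); a structure
   on a subset of [T] maps every [x] outside of the subset to [(x, x)]. *)
Definition pairf (T : finType) := {ffun T -> T * T}.

Definition supported (T : finType) (A : {set T}) (p : pairf T) :=
  [forall x, (x \notin A) ==> (p x == (x, x))].

Definition restr (T : finType) (B : {set T}) (p : pairf T) : pairf T :=
  [ffun x => if x \in B then p x else (x, x)].

Lemma supportedP (T : finType) (A : {set T}) (p : pairf T) :
  reflect (forall x, x \notin A -> p x = (x, x)) (supported A p).
Proof.
apply: (iffP forallP) => [pA x xA | pA x]; first by have /implyP/(_ xA)/eqP := pA x.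
by apply/implyP => /pA ->.
Qed.

(** A structure that splits along [P] is an independent choice for every block. All structures live
    on the whole of [T] and are the identity off their block, so the pieces are glued through
    [pblock] without a change of type. *)
Lemma card_blockwise (T : finType) (Phi : {set T} -> pred (pairf T))
    (A : {set T}) (P : {set {set T}}) :
  partition P A -> (forall B p, Phi B p -> supported B p) ->
  #|[set p | supported A p && [forall B in P, Phi B (restr B p)]]| =
  (\prod_(B in P) #|[set p | Phi B p]|)%N.
Proof.
move=> partP suppPhi.
pose id0 : pairf T := [ffun x => (x, x)].
have -> : (\prod_(B in P) #|[set p | Phi B p]|)%N =
    #|pfamily id0 P (fun B => [pred p | Phi B p])|.
  rewrite card_pfamily foldrE big_map big_enum.
  by apply: eq_bigr => B _; apply: eq_card => p; rewrite !inE.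
have tiP := partition_trivIset partP.
have covP := cover_partition partP.
apply: (card_eq_can
  (f := fun p : pairf T => [ffun B => if B \in P then restr B p else id0])
  (g := fun F : {ffun {set T} -> pairf T} => [ffun x => F (pblock P x) x])).
- move=> p; rewrite inE => /andP[_ /forall_inP PhiP].
  apply/pfamilyP; split.
    by apply/supportP => B BP; rewrite ffunE (negbTE BP).
  by move=> B BP; rewrite ffunE BP inE; apply: PhiP.
- move=> F /pfamilyP[/supportP F0 FP]; rewrite inE; apply/andP; split.
    apply/supportedP => x xA; rewrite ffunE F0 ?ffunE //.
    apply: contra xA => xP; rewrite -covP -mem_pblock.
    (* [pblock] returns [set0] off the cover, and a partition does not contain [set0]. *)
    have : pblock P x != set0 by apply: contraTneq xP => ->; rewrite (partition0 partP).
    case/set0Pn => y; rewrite /pblock; case: pickP => [B /andP[]|]; last by rewrite inE.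
    by [].
  apply/forall_inP => B BP; have := FP B BP; rewrite inE => PhiB.
  suff -> : restr B [ffun x => F (pblock P x) x] = F B by [].
  apply/ffunP => x; rewrite !ffunE; case: ifP => xB.
    by rewrite (def_pblock tiP BP xB).
  by rewrite (supportedP _ _ (suppPhi _ _ PhiB)) ?xB.
- move=> p; rewrite inE => /andP[/supportedP pA _].
  apply/ffunP => x; rewrite !ffunE; case: ifP => xP; last first.
    rewrite ffunE pA //; apply: contraFN xP => xA.
    by apply: pblock_mem; rewrite covP.
  rewrite ffunE ifT // mem_pblock covP.
  case: (boolP (x \in A)) => // xA.
  suff : pblock P x = set0 by move=> P0; rewrite P0 (partition0 partP) in xP.
  rewrite /pblock; case: pickP => // B /andP[BP xB].
  by rewrite -covP in xA; case/bigcupP: xA; exists B.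
- move=> F /pfamilyP[/supportP F0 FP]; apply/ffunP => B; rewrite ffunE.
  case: ifP => BP; last by rewrite F0 // BP.
  apply/ffunP => x; rewrite !ffunE; case: ifP => xB.
    by rewrite (def_pblock tiP BP xB).
  have := FP B BP; rewrite inE => PhiB.
  by rewrite (supportedP _ _ (suppPhi _ _ PhiB)) ?xB.
Qed.

(** The constant coefficient is dropped because the blocks of a partition are nonempty. *)
Definition egf (R : numFieldType) (N : nat) (phi : nat -> R) : {poly R} :=
  \poly_(l < N.+1) (if l == 0%N then 0 else phi l / l`!%:R).

(** The partial exponential Bell polynomial in the values of [phi]. *)
Definition block_sum (R : numFieldType) (T : finType) (phi : nat -> R)
    (b : nat) (A : {set T}) : R :=
  \sum_(P : {set {set T}} | partition P A && (#|P| == b)) \prod_(B in P) phi #|B|.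

(** The factor [b.+1] marks one block; removing the marked block [B] leaves a partition of the
    rest. *)
Lemma block_sum_rec (R : numFieldType) (T : finType) (phi : nat -> R)
    (b : nat) (A : {set T}) :
  b.+1%:R * block_sum phi b.+1 A =
  \sum_(B : {set T} | (B \subset A) && (B != set0)) phi #|B| * block_sum phi b (A :\: B).
Proof.
rewrite /block_sum mulr_sumr.
transitivity (\sum_(P : {set {set T}} | partition P A && (#|P| == b.+1))
    \sum_(B in P) \prod_(C in P) phi #|C|).
  apply: eq_bigr => P /andP[_ /eqP cP].
  by rewrite sumr_const cP mulr_natl.
rewrite (exchange_big_dep (fun B : {set T} => (B \subset A) && (B != set0))) /=; last first.
  move=> P B /andP[partP _] BP.
  by rewrite (partitionS partP BP) (partition_neq0 partP BP).
apply: eq_bigr => B /andP[BA B0]; rewrite mulr_sumr.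
rewrite (reindex_onto (fun P => B |: P) (fun P => P :\ B)) /=; last first.
  by move=> P /andP[_ BP]; rewrite setD1K.
apply: congr_big => // P; last first.
  move=> /andP[/andP[/andP[partP cP] _] /eqP PE].
  have BP : B \notin P by rewrite -PE !inE eqxx.
  by rewrite big_setU1.
apply/idP/idP.
  case/andP => /andP[/andP[partP /eqP cP] _] /eqP PE.
  have BP : B \notin P by rewrite -PE !inE eqxx.
  have := partitionD1 partP (setU11 B P); rewrite PE => ->.
  by move: cP; rewrite cardsU1 BP add1n => -[->] /=.
case/andP => partP /eqP cP.
have BP : B \notin P.
  apply/negP => /(partitionS partP)/subsetP sB.
  by case/set0Pn: B0 => x xB; have := sB x xB; rewrite !inE xB.
have := partitionU1 partP B0.
have -> : [disjoint B & A :\: B].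
  by rewrite -setI_eq0; apply/eqP/setP => x; rewrite !inE; case: (x \in B).
have -> : B :|: A :\: B = A by rewrite setDE setUIr setUCr setIT; apply/setUidPr.
move=> -> //=; rewrite cardsU1 BP add1n cP eqxx setU11 /=.
apply/eqP/setP => C; rewrite !inE; case: eqVneq => //= ->.
by rewrite (negbTE BP).
Qed.

Lemma sum_subsets_card (R : numFieldType) (T : finType) (A : {set T}) (F : nat -> R) :
  \sum_(B : {set T} | B \subset A) F #|B| = \sum_(l < #|A|.+1) F l *+ 'C(#|A|, l).
Proof.
rewrite (partition_big (fun B : {set T} => inord #|B| : 'I_#|A|.+1) predT) //=.
apply: eq_bigr => l _.
rewrite (eq_bigl (fun B : {set T} => (B \subset A) && (#|B| == l))); last first.
  move=> B; apply: andb_id2l => BA; rewrite -val_eqE /= inordK //.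
  by rewrite ltnS subset_leq_card.
rewrite (eq_bigr (fun=> F l)); last by move=> B /andP[_ /eqP ->].
rewrite sumr_const -cards_draws; congr (_ *+ _).
by apply: eq_card => B; rewrite !inE.
Qed.

(** The exponential formula for a fixed number of blocks: the recursion over a marked block is the
    convolution defining [egf N phi ^+ b.+1]. The degree [N] is free so that all sets [A :\: B] of
    the induction share one polynomial. *)
Lemma block_sumE (R : numFieldType) (T : finType) (phi : nat -> R)
    (b N : nat) (A : {set T}) : (#|A| <= N)%N ->
  block_sum phi b A = #|A|`!%:R / b`!%:R * (egf N phi ^+ b)`_#|A|.
Proof.
have fact_neq0 k : (k`!%:R : R) != 0 by rewrite pnatr_eq0 -lt0n fact_gt0.
elim: b A => [|b IH] A AN.
  rewrite expr0 coef1 /block_sum fact0 divr1.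
  case: (eqVneq A set0) => [->|A0].
    rewrite cards0 eqxx mulr1 (big_pred1 set0) ?big_set0 // => P.
    by rewrite partition_set0 /= -cards_eq0 andbb.
  rewrite cards_eq0 (negbTE A0) mulr0 big1 // => P /andP[partP /eqP/cards0_eq P0].
  by move: A0; rewrite -(cover_partition partP) P0 /cover big_set0 eqxx.
have bn0 : (b.+1%:R : R) != 0 by rewrite pnatr_eq0.
apply: (mulfI bn0); rewrite block_sum_rec.
pose n := #|A|.
(* The value 0 at [l = 0] absorbs the condition that the marked block is nonempty. *)
pose F l : R := if l == 0%N then 0 else
   phi l * ((n - l)`!%:R / b`!%:R * (egf N phi ^+ b)`_(n - l)).
transitivity (\sum_(B : {set T} | B \subset A) F #|B|).
  rewrite big_mkcondr /=; apply: eq_bigr => B BA.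
  rewrite /F cards_eq0; case: eqVneq => //= B0.
  have cAB : #|A :\: B| = (n - #|B|)%N.
    by rewrite cardsD (setIidPr BA).
  by rewrite IH cAB // (leq_trans (leq_subr _ _)).
rewrite sum_subsets_card exprS coefM !mulr_sumr; apply: eq_bigr => -[l /= ln] _.
rewrite ltnS -/n in ln.
rewrite coef_poly (leq_ltn_trans ln) // /F; case: eqVneq => [_|l0].
  by rewrite mul0rn mul0r !mulr0.
rewrite -mulr_natr factS natrM.
have := congr1 (fun x : nat => x%:R : R) (bin_fact ln); rewrite /n /= !natrM => <-.
field.
by rewrite !fact_neq0 nat1r bn0.
Qed.

(** * Cayley's formula *)

Lemma fconnect_iterP (T : finType) (f : T -> T) (x y : T) :
  reflect (exists k, iter k f x = y) (fconnect f x y).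
Proof.
apply: (iffP idP) => [/iter_findex <- | [k <-]]; first by exists (findex f x y).
exact: fconnect_iter.
Qed.

Lemma fconnect_fixed (T : finType) (f : T -> T) (x y : T) :
  f x = x -> fconnect f x y -> y = x.
Proof. by move=> fx /fconnect_iterP[k <-]; apply: iter_fix. Qed.

(** Parent maps of forests with root set [A] and other nodes [U]. Being the identity off [U] makes
    the nodes of [A] fixed points when the two sets are disjoint. *)
Definition forests (T : finType) (U A : {set T}) : {set {ffun T -> T}} :=
  [set g : {ffun T -> T} |
    [forall x, if x \in U then [exists a in A, fconnect g x a] else g x == x]].

Lemma forestsP (T : finType) (U A : {set T}) (g : {ffun T -> T}) :
  reflect ((forall x, x \in U -> exists2 a, a \in A & fconnect g x a) /\
           (forall x, x \notin U -> g x = x)) (g \in forests U A).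
Proof.
rewrite inE; apply: (iffP forallP) => [gP | [gU gI] x].
  split=> x xU; have := gP x; first by rewrite xU => /exists_inP.
  by rewrite (negbTE xU) => /eqP.
by case: ifP => [/gU ? | /negbT/gI ->] //; apply/exists_inP.
Qed.

(** [J] consists of the children of the roots. Deleting the roots leaves a forest rooted at [J], and
    every node of [J] had a free choice of its parent in [A]. *)
Lemma card_forests_layer (T : finType) (U A J : {set T}) :
  [disjoint U & A] -> J \subset U ->
  #|[set g in forests U A | [set x in U | g x \in A] == J]| =
  (#|A| ^ #|J| * #|forests (U :\: J) J|)%N.
Proof.
move=> dUA sJU.
(* The singletons off [J] turn a choice of parents on [J] into a map on all of [T]. *)
pose Fam x := if x \in J then A else [set x].
have -> : (#|A| ^ #|J|)%N = #|[set e : {ffun T -> T} in family (fun x => mem (Fam x))]|.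
  rewrite cardsE card_family foldrE big_map big_enum /=.
  rewrite (bigID (mem J)) /= [X in (_ * X)%N]big1 ?muln1; last first.
    by move=> x xJ; rewrite /Fam (negbTE xJ) cards1.
  rewrite -prod_nat_const; apply: eq_bigr => x xJ.
  by rewrite /Fam xJ.
have famP (e : {ffun T -> T}) : reflect (forall x, e x \in Fam x)
    (e \in [set e : {ffun T -> T} in family (fun x => mem (Fam x))]).
  by rewrite in_set; apply: (iffP familyP) => eP x; exact: eP.
rewrite -cardsX.
apply: (card_eq_can
  (f := fun g : {ffun T -> T} => ([ffun x => if x \in J then g x else x],
                                  [ffun x => if x \in J then x else g x]))
  (g := fun eg : {ffun T -> T} * {ffun T -> T} =>
          [ffun x => if x \in J then eg.1 x else eg.2 x])).
- move=> g; rewrite inE => /andP[/forestsP[gU gI] /eqP JE].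
  rewrite in_setX /=; apply/andP; split.
    apply/famP => x; rewrite /Fam !ffunE; case: ifP; rewrite ?inE // -JE inE.
    by case/andP.
  apply/(forestsP (U :\: J)); split=> x; rewrite !inE; last first.
    rewrite negb_and negbK ffunE => /orP[-> // | /gI ->]; by case: ifP.
  case/andP => xJ xU; have [a aA /fconnect_iterP[k]] := gU x xU.
  elim: k x xJ xU => [|k IH] x xJ xU.
    by move=> /= xa; have := disjointFr dUA xU; rewrite xa aA.
  rewrite iterSr => gka.
  have gxA : g x \notin A by move: xJ; rewrite -JE inE xU.
  have [gxU | gxU] := boolP (g x \in U); last first.
    by move: gxA; rewrite -(iter_fix k (gI _ gxU)) gka aA.
  have [gxJ | gxJ] := boolP (g x \in J).
    exists (g x) => //; apply/fconnect_iterP; exists 1%N.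
    by rewrite /= ffunE (negbTE xJ).
  have [y yJ cy] := IH _ gxJ gxU gka; exists y => //.
  by apply: connect_trans cy; apply: connect1; rewrite /= ffunE (negbTE xJ).
- move=> [e g]; rewrite in_setX /= => /andP[/famP eP /(forestsP (U :\: J))[gU gI]].
  have eA x : x \in J -> e x \in A by move=> xJ; have := eP x; rewrite /Fam xJ.
  rewrite inE; apply/andP; split.
    apply/(forestsP U); split=> x xU; last first.
      have xJ : x \notin J by apply: contra xU => /(subsetP sJU).
      by rewrite ffunE (negbTE xJ) gI // !inE (negbTE xU) andbF.
    have [xJ | xJ] := boolP (x \in J).
      exists (e x); rewrite ?eA //; apply: connect1; by rewrite /= ffunE xJ.
    have [|y yJ /fconnect_iterP[k]] := gU x; first by rewrite !inE xJ ?xU ?(subsetP sJU).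
    elim: k x xJ {xU} => [|k IH] x xJ; first by move=> /= xy; rewrite xy yJ in xJ.
    rewrite iterSr => gky; have [gxJ | gxJ] := boolP (g x \in J).
      exists (e (g x)); rewrite ?eA //; apply/fconnect_iterP; exists 2%N.
      by rewrite /= !ffunE (negbTE xJ) gxJ.
    have [a aA ca] := IH _ gxJ gky; exists a => //.
    by apply: connect_trans ca; apply: connect1; rewrite /= ffunE (negbTE xJ).
  apply/eqP/setP => x; rewrite !inE ffunE.
  case: (boolP (x \in J)) => xJ; first by rewrite (subsetP sJU) // eA.
  apply/negbTE/negP => /andP[xU gxA].
  have [|y yJ] := gU x; first by rewrite !inE xJ ?xU ?(subsetP sJU).
  rewrite fconnect_eqVf => /orP[/eqP xy | cy]; first by rewrite xy yJ in xJ.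
  have gxU := disjointFl dUA gxA.
  have := fconnect_fixed (gI (g x) _) cy; rewrite !inE gxU andbF => /(_ isT) yE.
  by have := subsetP sJU _ yJ; rewrite yE gxU.
- by move=> g _ /=; apply/ffunP => x; rewrite !ffunE; case: (x \in J).
- move=> [e g]; rewrite in_setX /= => /andP[/famP eP /(forestsP (U :\: J))[gU gI]].
  congr pair; apply/ffunP => x; rewrite !ffunE; case: (boolP (x \in J)) => xJ //.
    by have := eP x; rewrite /Fam (negbTE xJ) inE => /eqP.
  by rewrite gI // !inE xJ.
Qed.

(** The sum over the size [j] of the first layer; [j * 'C(u, j) = u * 'C(u - 1, j - 1)] reduces it
    to the binomial theorem. *)
Lemma sum_bin_mul (a v : nat) :
  (\sum_(j < v.+2) 'C(v.+1, j) * (a ^ j * (j * v.+1 ^ (v.+1 - j))) =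
   v.+1 * (a * (a + v.+1) ^ v))%N.
Proof.
rewrite big_ord_recl /= !mul0n !muln0 add0n addnC expnDn !big_distrr /=.
apply: eq_bigr => i _.
rewrite /bump /= add1n subSS expnS.
have /= := mul_bin_diag v.+1 i.
move: ('C(_, _)) ('C(_, _)) (_ ^ _)%N (_ ^ _)%N => C1 C2 x y E.
transitivity (i.+1 * C1 * (a * x * y))%N; first by lia.
by rewrite -E; move: (C2); lia.
Qed.

(* By induction on [U]: the layer [J] consists of the nodes of [U] whose parent lies
   in [A]. *)
Lemma card_forests (T : finType) (U A : {set T}) : [disjoint U & A] ->
  (#|forests U A| * (#|A| + #|U|) = #|A| * (#|A| + #|U|) ^ #|U|)%N.
Proof.
move: {2}#|U|.+1 (ltnSn #|U|) => n; elim: n U A => // n IH U A Un dUA.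
have [->|U0] := eqVneq U set0.
  rewrite cards0 addn0 expn0 muln1.
  suff -> : forests set0 A = [set [ffun x => x]] by rewrite cards1 mul1n.
  apply/setP => g; rewrite in_set1; apply/forestsP/eqP => [[_ gI] | ->].
    by apply/ffunP => x; rewrite ffunE gI // inE.
  by split=> x; rewrite ?inE // ffunE.
have [v uE] : exists v, #|U| = v.+1.
  by move: U0; rewrite -cards_eq0; case: #|U| => // v _; exists v.
(* The factor [v.+1 = #|J| + #|U :\: J|] is the one that the induction hypothesis for [U :\: J] and
   [J] carries on its left side. *)
suff E : (v.+1 * #|forests U A| = v.+1 * (#|A| * (#|A| + v.+1) ^ v))%N.
  have /eqP := E; rewrite eqn_pmul2l // => /eqP ->.
  by rewrite uE expnSr mulnA.
rewrite -sum_bin_mul.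
have -> : #|forests U A| = (\sum_(J : {set T} | J \subset U)
    #|A| ^ #|J| * #|forests (U :\: J) J|)%N.
  rewrite -sum1_card (partition_big (fun g : {ffun T -> T} => [set x in U | g x \in A])
    (fun J : {set T} => J \subset U)) /=; last first.
    by move=> g _; apply/subsetP => x; rewrite inE => /andP[].
  apply: eq_bigr => J sJU; rewrite -card_forests_layer // -sum1_card.
  by apply: eq_bigl => g; rewrite !inE.
rewrite big_distrr /=.
transitivity (\sum_(J : {set T} | J \subset U)
    (#|A| ^ #|J| * (#|J| * v.+1 ^ (v.+1 - #|J|))))%N.
  apply: eq_bigr => J sJU; rewrite mulnCA; congr (_ * _)%N.
  have [J0|J0] := eqVneq J set0.
    rewrite J0 cards0 mul0n setD0; apply/eqP; rewrite muln_eq0 /= cards_eq0.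
    apply/eqP/setP => g; rewrite in_set0; apply/negP => /forestsP[gU _].
    case/set0Pn: U0 => x xU; have [y] := gU x xU; by rewrite inE.
  have cU : #|U :\: J| = (v.+1 - #|J|)%N by rewrite cardsD (setIidPr sJU) uE.
  have ju : (#|J| <= v.+1)%N by rewrite -uE subset_leq_card.
  have := IH (U :\: J) J; rewrite cU subnKC // mulnC; apply.
    rewrite -ltnS; apply: leq_trans Un; rewrite uE ltnS ltn_subrL /=.
    by rewrite lt0n cards_eq0 J0.
  by rewrite -setI_eq0; apply/eqP/setP => x; rewrite !inE; case: (x \in J); rewrite ?andbF.
rewrite (partition_big (fun B : {set T} => inord #|B| : 'I_v.+2) predT) //=.
apply: eq_bigr => l _.
rewrite (eq_bigl (fun B : {set T} => (B \subset U) && (#|B| == l))); last first.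
  move=> B; apply: andb_id2l => BU; rewrite -val_eqE /= inordK //.
  by rewrite ltnS -uE subset_leq_card.
rewrite (eq_bigr (fun=> #|A| ^ l * (l * v.+1 ^ (v.+1 - l)))%N); last first.
  by move=> B /andP[_ /eqP ->].
rewrite sum_nat_const -[X in 'C(X, _)]uE -cards_draws; congr (_ * _)%N.
by apply: eq_card => B; rewrite !inE.
Qed.

Definition trees_on (T : finType) (C : {set T}) : {set {ffun T -> T}} :=
  [set g : {ffun T -> T} | [forall x, (x \notin C) ==> (g x == x)] &&
    [exists r in C, (g r == r) && [forall x in C, fconnect g x r]]].

Lemma trees_onP (T : finType) (C : {set T}) (g : {ffun T -> T}) :
  reflect ((forall x, x \notin C -> g x = x) /\
           exists r, [/\ r \in C, g r = r & forall x, x \in C -> fconnect g x r])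
    (g \in trees_on C).
Proof.
rewrite inE; apply: (iffP andP).
  case=> /forallP gI /exists_inP[r rC /andP[/eqP gr /forall_inP cr]].
  by split; [move=> x xC; apply/eqP; apply: (implyP (gI x)) | exists r].
case=> gI [r [rC gr cr]]; split.
  by apply/forallP => x; apply/implyP => /gI ->.
by apply/exists_inP; exists r; rewrite // gr eqxx; apply/forall_inP.
Qed.

(** Every root [r] contributes the forests with the single root [r]. The equation is multiplied by
    [#|C|] to avoid the exponent [#|C| - 2]. *)
Lemma card_trees_on (T : finType) (C : {set T}) :
  C != set0 -> #|trees_on C| = (#|C| ^ #|C|.-1)%N.
Proof.
move=> C0; have cC : (0 < #|C|)%N by rewrite lt0n cards_eq0.
have forC r g : r \in C -> (g \in forests (C :\ r) [set r]) =
    [&& g \in trees_on C, g r == r & [forall x in C, fconnect g x r]].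
  move=> rC; apply/forestsP/and3P.
    case=> gU gI; have gr : g r = r by apply: gI; rewrite !inE eqxx.
    have cr : forall x, x \in C -> fconnect g x r.
      move=> x xC; have [->//|xr] := eqVneq x r.
      by have [|a] := gU x; rewrite !inE ?xr // => /eqP ->.
    split; last exact/forall_inP; last by rewrite gr.
    apply/trees_onP; split; last by exists r.
    by move=> x xC; apply: gI; rewrite !inE (negbTE xC) andbF.
  case=> /trees_onP[gI _] /eqP gr /forall_inP cr; split=> x; rewrite !inE.
    by case/andP => _ /cr; exists r; rewrite ?inE.
  by rewrite negb_and negbK => /orP[/eqP -> | /gI].
suff : #|trees_on C| = (\sum_(r in C) #|forests (C :\ r) [set r]|)%N.
  move=> ->; apply/eqP; rewrite -(eqn_pmul2r cC); apply/eqP.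
  have -> : (#|C| ^ #|C|.-1 * #|C| = \sum_(r in C) #|C| ^ #|C|.-1)%N.
    by rewrite sum_nat_const mulnC.
  rewrite big_distrl; apply: eq_bigr => r rC /=.
  have := @card_forests T (C :\ r) [set r].
  rewrite cards1 mul1n add1n.
  have -> : #|C :\ r|.+1 = #|C| by rewrite (cardsD1 r C) rC.
  have -> : #|C :\ r| = #|C|.-1 by rewrite (cardsD1 r C) rC.
  apply; rewrite -setI_eq0; apply/eqP/setP => x; rewrite !inE.
  by case: (x == r); rewrite ?andbF.
rewrite -sum1_card (eq_bigr (fun r => \sum_(g in forests (C :\ r) [set r]) 1)%N);
  last by move=> r _; rewrite sum1_card.
rewrite (exchange_big_dep (mem (trees_on C))) /=; last first.
  by move=> r g rC; rewrite forC // => /andP[].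
apply: eq_bigr => g gT; have [_ [r [rC gr cr]]] := trees_onP _ _ gT.
rewrite (big_pred1 r) // => r' /=; apply/andP/eqP => [[r'C]|->].
  rewrite forC // => /and3P[_ /eqP gr' /forall_inP cr'].
  exact/esym/(fconnect_fixed gr')/cr.
by split=> //; rewrite forC // gT gr eqxx; apply/forall_inP.
Qed.

(** * Decomposition into C-tree and D-forests *)

Definition parent (T : finType) (p : pairf T) (x : T) : T := (p x).1.

Definition auto (T : finType) (p : pairf T) (x : T) : T := (p x).2.

Definition equivariant (T : finType) (p : pairf T) : bool :=
  injectiveb (auto p) && [forall x, auto p (parent p x) == parent p (auto p x)].

Lemma equivariantP (T : finType) (p : pairf T) :
  reflect (injective (auto p) /\ forall x, auto p (parent p x) = parent p (auto p x))
    (equivariant p).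
Proof.
apply: (iffP andP) => -[]; last first.
  by move=> /injectiveP inj com; split=> //; apply/forallP => x; rewrite com.
by move=> /injectiveP inj /forallP com; split=> // x; apply/eqP.
Qed.

(* A tree on [B] with an automorphism fixing only the root: a node of the C-tree
   together with its D-forest. *)
Definition dtree (T : finType) (B : {set T}) (p : pairf T) : bool :=
  [&& supported B p, equivariant p &
    [exists r in B, (parent p r == r) &&
      [forall x in B, fconnect (parent p) x r && ((auto p x == x) == (x == r))]]].

Lemma dtreeP (T : finType) (B : {set T}) (p : pairf T) :
  reflect [/\ supported B p, equivariant p & exists r, [/\ r \in B, parent p r = r,
      forall x, x \in B -> fconnect (parent p) x r &
      forall x, x \in B -> (auto p x = x <-> x = r)]]
    (dtree B p).
Proof.
apply: (iffP and3P) => -[sp ep].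
  case/exists_inP => r rB /andP[/eqP pr /forall_inP rP]; split=> //.
  exists r; split=> // x xB; have /andP[cr /eqP sx] := rP x xB => //.
  by split=> [/eqP | /eqP]; [rewrite sx => /eqP | rewrite -sx => /eqP].
case=> r [rB pr cr sr]; split=> //; apply/exists_inP; exists r; rewrite // pr eqxx.
apply/forall_inP => x xB; rewrite cr //=; apply/eqP; apply/eqP/eqP => /sr; exact.
Qed.

Lemma fixed_reach_uniq (T : finType) (f : T -> T) (x r r' : T) :
  f r = r -> f r' = r' -> fconnect f x r -> fconnect f x r' -> r = r'.
Proof.
move=> fr fr' /fconnect_iterP[k kr] /fconnect_iterP[l lr].
by rewrite -(iter_fix l fr) -(iter_fix k fr') -kr -lr -!iterD addnC.
Qed.

Lemma fconnect_restr (T : finType) (B : {set T}) (p : pairf T) (x r : T) :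
  x \in B -> fconnect (parent (restr B p)) x r -> r \in B -> fconnect (parent p) x r.
Proof.
move=> xB /fconnect_iterP[k]; elim: k x xB => [|k IH] x xB; first by move=> /= ->.
rewrite iterSr => kr rB; have pE : parent (restr B p) x = parent p x.
  by rewrite /parent ffunE xB.
rewrite pE in kr; apply: connect_trans (connect1 _) _; first exact/eqP/erefl.
have [pB|pB] := boolP (parent p x \in B); first exact: IH.
suff <- : parent p x = r by [].
by rewrite -kr iter_fix // /parent ffunE (negbTE pB).
Qed.

Lemma restr_fconnect (T : finType) (B : {set T}) (p : pairf T) (x r : T) :
  {in B, forall y, parent p y \in B} ->
  x \in B -> fconnect (parent p) x r -> fconnect (parent (restr B p)) x r.
Proof.
move=> pB xB /fconnect_iterP[k]; elim: k x xB => [|k IH] x xB; first by move=> /= ->.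
rewrite iterSr => kr; have pE : parent (restr B p) x = parent p x.
  by rewrite /parent ffunE xB.
apply: connect_trans (connect1 _) (IH _ _ kr); [exact/eqP | exact: pB].
Qed.

Definition roots (T : finType) (p : pairf T) : {set T} := [set v | parent p v == v].

Definition block (T : finType) (p : pairf T) (v : T) : {set T} :=
  [set x | fconnect (parent p) x v].

(* What remains of a tree with automorphism when the edges of the C-tree are removed. *)
Definition cforest (T : finType) (S : pred nat) (p : pairf T) : bool :=
  [&& equivariant p, [forall x, (auto p x == x) == (parent p x == x)],
    [forall x, [exists r in roots p, x \in block p r]] &
    [forall v in roots p, S #|block p v|.-1]].

Lemma cforestP (T : finType) (S : pred nat) (p : pairf T) :
  reflect [/\ equivariant p, forall x, (auto p x == x) = (parent p x == x),
    forall x, exists2 r, parent p r = r & fconnect (parent p) x r &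
    forall v, parent p v = v -> S #|block p v|.-1] (cforest S p).
Proof.
apply: (iffP and4P) => -[ep].
  move=> /forallP fp /forallP rp /forall_inP Sp; split=> //.
  - by move=> x; exact: (eqP (fp x)).
  - by move=> x; have /exists_inP[r] := rp x; rewrite 2!inE => /eqP rr cr; exists r.
  - by move=> v pv; apply: Sp; rewrite inE pv.
move=> fp rp Sp; split=> //; first by apply/forallP => x; apply/eqP.
  apply/forallP => x; have [r pr cr] := rp x; apply/exists_inP; exists r; by rewrite inE ?pr.
by apply/forall_inP => v; rewrite inE => /eqP /Sp.
Qed.

(** [#|B|.-1] is the size of the D-forest, as the block also contains its C-node. *)
Definition dtreeS (T : finType) (S : pred nat) (B : {set T}) (p : pairf T) : bool :=
  dtree B p && S #|B|.-1.

Lemma restr_equivariant (T : finType) (B : {set T}) (p : pairf T) :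
  equivariant p -> {in B, forall y, parent p y \in B} ->
  (forall y, (auto p y \in B) = (y \in B)) -> equivariant (restr B p).
Proof.
move=> /equivariantP[inj com] pB sB; apply/equivariantP; split.
  move=> x y; rewrite /auto !ffunE; case: ifP => xB; case: ifP => yB //=.
  - by move/inj.
  - by move=> E; have := sB x; rewrite /auto E yB xB.
  - by move=> E; have := sB y; rewrite /auto -E xB yB.
move=> x; rewrite /auto /parent !ffunE; case: (boolP (x \in B)) => xB /=.
  by rewrite (pB _ xB) -/(auto p x) sB xB; apply: com.
by rewrite (negbTE xB).
Qed.

Lemma equivariant_restr (T : finType) (P : {set {set T}}) (p : pairf T) :
  partition P [set: T] ->
  (forall B, B \in P -> equivariant (restr B p)) ->
  (forall B x, B \in P -> x \in B -> parent p x \in B /\ auto p x \in B) ->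
  equivariant p.
Proof.
move=> partP eqvP pB; have covP := cover_partition partP.
have inP x : exists2 B, B \in P & x \in B.
  have : x \in cover P by rewrite covP inE.
  by case/bigcupP => B; exists B.
apply/equivariantP; split.
  move=> x y E; have [B BP xB] := inP x; have [C CP yC] := inP y.
  have [_ aB] := pB _ _ BP xB; have [_ aC] := pB _ _ CP yC.
  have BC : B = C.
    have tiP := partition_trivIset partP; rewrite E in aB.
    by rewrite -(def_pblock tiP BP aB) -(def_pblock tiP CP aC).
  subst C; have /equivariantP[inj _] := eqvP _ BP; apply: inj.
  by rewrite /auto !ffunE xB yC.
move=> x; have [B BP xB] := inP x; have [p1 a1] := pB _ _ BP xB.
have /equivariantP[_ /(_ x)] := eqvP _ BP.
by rewrite /auto /parent !ffunE xB -/(parent p x) -/(auto p x) p1 a1.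
Qed.

Lemma dtree_stable (T : finType) (B : {set T}) (p : pairf T) :
  dtree B p -> forall x, x \in B -> parent p x \in B /\ auto p x \in B.
Proof.
case/dtreeP => /supportedP sp /equivariantP[inj _] [r [rB pr cr _]] x xB; split.
  have := cr x xB; rewrite fconnect_eqVf => /orP[/eqP ->|]; first by rewrite pr.
  have [//|pB] := boolP (parent p x \in B).
  have pp : parent p (parent p x) = parent p x by rewrite {1}/parent sp.
  by move/(fconnect_fixed pp) => rE; rewrite rE (negbTE pB) in rB.
have [//|aB] := boolP (auto p x \in B).
have : auto p (auto p x) = auto p x by rewrite {1}/auto sp.
by move/inj => aE; rewrite aE xB in aB.
Qed.

(** The partition can be recovered from [p], as the sets of nodes leading to each root. Exactly one
    partition thus goes with each [p], which turns a count of [p] into a sum over partitions of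
    products over blocks. *)
Lemma cforest_blocks (T : finType) (S : pred nat) (p : pairf T) (P : {set {set T}}) :
  (partition P [set: T] && [forall B in P, dtreeS S B (restr B p)]) =
  (cforest S p && (P == [set block p v | v in roots p])).
Proof.
apply/andP/andP => [[partP /forall_inP dP] | [cp /eqP ->]].
  have covP := cover_partition partP; have tiP := partition_trivIset partP.
  have inP x : exists2 B, B \in P & x \in B.
    have : x \in cover P by rewrite covP inE.
    by case/bigcupP => B; exists B.
  have stab B x : B \in P -> x \in B -> parent p x \in B /\ auto p x \in B.
    move=> BP xB; have /andP[dB _] := dP B BP.
    by have := dtree_stable dB xB; rewrite /parent /auto ffunE xB.
  have rootB B : B \in P -> exists r, [/\ r \in B, parent p r = r,
      forall x, x \in B -> fconnect (parent p) x r &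
      forall x, x \in B -> (auto p x = x <-> x = r)].
    move=> BP; have /andP[/dtreeP[_ _ [r [rB pr cr sr]]] _] := dP B BP.
    exists r; split=> //; first by move: pr; rewrite /parent ffunE rB.
      by move=> x xB; apply: fconnect_restr (cr _ xB) rB.
    by move=> x xB; rewrite -(sr x xB) /auto ffunE xB.
  have blkE B r : B \in P -> r \in B -> parent p r = r -> B = block p r.
    move=> BP rB pr; have [r' [r'B pr' cr' _]] := rootB B BP.
    have rr : r = r' by have := fconnect_fixed pr (cr' r rB).
    rewrite -rr in cr' => {r' r'B pr' rr}.
    apply/setP => x; rewrite inE; apply/idP/idP => [/cr' //|cx].
    have [C CP xC] := inP x; have [c [cC pc cc _]] := rootB C CP.
    have rc := fixed_reach_uniq pr pc cx (cc _ xC); rewrite -rc in cC.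
    have -> // : B = C.
    by rewrite -(def_pblock tiP BP rB) -(def_pblock tiP CP cC).
  have PE : P = [set block p v | v in roots p].
    apply/setP => B; apply/idP/imsetP => [BP|[v]].
      have [r [rB pr _ _]] := rootB B BP; exists r; first by rewrite inE pr.
      exact: blkE.
    rewrite inE => /eqP pv ->; have {B} [B BP vB] := inP v.
    by rewrite -(blkE B v).
  split; last exact/eqP.
  apply/cforestP; split.
  - apply: equivariant_restr partP _ stab => B BP.
    by have /andP[/and3P[]] := dP B BP.
  - move=> x; have [B BP xB] := inP x; have [r [rB pr cr sr]] := rootB B BP.
    apply/eqP/eqP => [/(sr _ xB) -> // | px].
    by apply/sr => //; have := fconnect_fixed px (cr x xB).
  - move=> x; have [B BP xB] := inP x; have [r [rB pr cr _]] := rootB B BP.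
    by exists r => //; apply: cr.
  - move=> v pv; have [B BP vB] := inP v; have /andP[_] := dP B BP.
    by rewrite -(blkE B v).
have /cforestP[ep fp rp Sp] := cp; have /equivariantP[inj com] := ep.
have prt x v : parent p v = v -> (parent p x \in block p v) = (x \in block p v).
  move=> pv; rewrite !inE; apply/idP/idP => [|cx].
    by apply: connect_trans; apply: connect1 => /=.
  have [r pr cr] := rp (parent p x).
  suff -> : v = r by [].
  apply: fixed_reach_uniq pv pr cx _; apply: connect_trans cr.
  by apply: connect1 => /=.
(* The automorphism fixes the root [v] and commutes with parents, so it maps the path from [x] to
   [v] to another path ending at [v]. *)
have artA x v : parent p v = v -> x \in block p v -> auto p x \in block p v.
  move=> pv; have /eqP av : auto p v == v by rewrite fp pv.
  rewrite !inE => /fconnect_iterP[k kv]; apply/fconnect_iterP; exists k.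
  by rewrite -[RHS]av -kv; elim: k {kv} => //= k ->; rewrite com.
have art x v : parent p v = v -> (auto p x \in block p v) = (x \in block p v).
  move=> pv; apply/idP/idP; last exact: artA.
  move=> ax; have [r pr cr] := rp x; have : x \in block p r by rewrite inE.
  move/(artA _ _ pr); move: ax; rewrite !inE => cv cr'.
  by rewrite (fixed_reach_uniq pv pr cv cr').
split.
  apply/and3P; split.
  - rewrite eqEsubset subsetT /=; apply/subsetP => x _.
    have [r pr cr] := rp x; apply/bigcupP; exists (block p r); rewrite ?inE //.
    by apply: imset_f; rewrite inE pr.
  - apply/trivIsetP => _ _ /imsetP[v vr ->] /imsetP[u ur ->].
    apply: contraR => /pred0Pn[x /andP[]]; rewrite !inE => xv xu.
    move: vr ur; rewrite !inE => /eqP vr /eqP ur.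
    by rewrite (fixed_reach_uniq vr ur xv xu).
  - apply/imsetP => -[v _ v0]; have := in_set0 v; by rewrite v0 inE connect0.
apply/forall_inP => B /imsetP[v]; rewrite inE => /eqP pv ->.
rewrite /dtreeS Sp // andbT; apply/dtreeP; split.
- by apply/supportedP => x xB; rewrite ffunE (negbTE xB).
- by apply: restr_equivariant => // [y|y]; rewrite ?prt ?art.
- have vB : v \in block p v by rewrite inE.
  exists v; split=> //; first by rewrite /parent ffunE vB.
    move=> x xB; apply: restr_fconnect => //; first by move=> y; rewrite prt.
    by rewrite inE in xB.
  move=> x xB; rewrite /auto ffunE xB -/(auto p x); split=> [/eqP | ->].
    rewrite fp => /eqP px; rewrite inE in xB.
    by have := fconnect_fixed px xB.
  by apply/eqP; rewrite fp pv.
Qed.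

Lemma card_roots_blocks (T : finType) (p : pairf T) :
  #|[set block p v | v in roots p]| = #|roots p|.
Proof.
rewrite card_in_imset // => u v; rewrite !inE => /eqP pu /eqP pv E.
have : u \in block p v by rewrite -E inE.
by rewrite inE => /(fconnect_fixed pu).
Qed.

Lemma card_cforest (T : finType) (S : pred nat) (m : nat) :
  #|[set p : pairf T | cforest S p & #|roots p| == m]| =
  (\sum_(P : {set {set T}} | partition P [set: T] && (#|P| == m))
     \prod_(B in P) #|[set p : pairf T | dtreeS S B p]|)%N.
Proof.
transitivity (\sum_(P : {set {set T}} | partition P [set: T] && (#|P| == m))
  \sum_(p : pairf T | [forall B in P, dtreeS S B (restr B p)]) 1)%N.
  rewrite (exchange_big_dep predT) //= -sum1_card big_mkcond /=.
  apply: eq_bigr => p _; rewrite inE.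
  rewrite (eq_bigl (fun P => [&& cforest S p, #|roots p| == m &
      P == [set block p v | v in roots p]])).
    case: (cforest S p) => /=; last by rewrite big_pred0.
    case: (#|roots p| == m) => /=; last by rewrite big_pred0.
    by rewrite big_pred1_eq.
  move=> P; rewrite andbAC cforest_blocks -andbA; congr (_ && _).
  by case: eqP => [->|]; rewrite ?andbF // card_roots_blocks andbT.
apply: eq_bigr => P /andP[partP _].
rewrite -(card_blockwise (Phi := fun B => dtreeS S B) partP); last first.
  by move=> B p /andP[/and3P[]].
rewrite -sum1_card; apply: eq_bigl => p; rewrite inE andb_idl // => _.
by apply/supportedP => x; rewrite inE.
Qed.

(** * Independence of D-tree counts from the label set *)

Lemma dtree_transfer (T0 T : finType) (i : T0 -> T) (B : {set T})
    (p0 : pairf T0) (p : pairf T) :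
  injective i -> (forall a, i a \in B) -> (forall x, x \in B -> exists a, x = i a) ->
  supported B p -> (forall a, p (i a) = (i (p0 a).1, i (p0 a).2)) ->
  dtree B p = dtree [set: T0] p0.
Proof.
move=> inji iB Bi sp ip; have /supportedP sp' := sp.
have pi a : parent p (i a) = i (parent p0 a) by rewrite /parent ip.
have ai a : auto p (i a) = i (auto p0 a) by rewrite /auto ip.
have citer k a : iter k (parent p) (i a) = i (iter k (parent p0) a).
  by elim: k => //= k ->.
have conn a b : fconnect (parent p) (i a) (i b) = fconnect (parent p0) a b.
  apply/fconnect_iterP/fconnect_iterP => -[k kE]; exists k.
    by apply: inji; rewrite -citer.
  by rewrite citer kE.
apply/dtreeP/dtreeP => -[_ /equivariantP[inj com] [r [rB pr cr sr]]].
  have [b rE] := Bi r rB; subst r; split.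
  - by apply/supportedP => x; rewrite inE.
  - apply/equivariantP; split=> [a a' E | a]; apply: inji.
      by apply: inj; rewrite !ai E.
    by rewrite -ai -pi com ai pi.
  - exists b; split=> // [|a _|a _]; first by apply: inji; rewrite -pi.
      by rewrite -conn cr.
    split=> [E | ->]; first by apply: inji; apply/sr => //; rewrite ai E.
    by apply: inji; rewrite -ai; apply/sr.
split=> //.
- apply/equivariantP; split=> [x y | x].
    have [xB|xB] := boolP (x \in B); have [yB|yB] := boolP (y \in B).
    + have [a ->] := Bi x xB; have [b ->] := Bi y yB.
      by rewrite !ai => /inji/inj ->.
    + have [a ->] := Bi x xB; rewrite ai /auto (sp' y) //= => E.
      by move: yB; rewrite -E iB.
    + have [a ->] := Bi y yB; rewrite ai /auto (sp' x) //= => E.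
      by move: xB; rewrite E iB.
    + by rewrite /auto !sp'.
  have [xB|xB] := boolP (x \in B); last by rewrite /auto /parent !(sp', xB).
  by have [a ->] := Bi x xB; rewrite ai !pi ai com.
- exists (i r); split=> // [|x xB|x xB]; first by rewrite pi pr.
    by have [a ->] := Bi x xB; rewrite conn cr.
  have [a ->] := Bi x xB; rewrite ai; split=> [/inji/sr -> // | /inji E].
  by congr i; apply/sr.
Qed.

Definition dtree_count (l : nat) : nat := #|[set p : pairf 'I_l | dtree [set: 'I_l] p]|.

Lemma card_dtree (T : finType) (B : {set T}) :
  #|[set p : pairf T | dtree B p]| = dtree_count #|B|.
Proof.
(* The empty set carries no root and is treated apart, since [enum_rank_in] needs an element. *)
have [B0|[x0 x0B]] := set_0Vmem B.
  have -> : [set p : pairf T | dtree B p] = set0.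
    apply/setP => p; rewrite !inE; apply/negbTE/negP => /dtreeP[_ _ [r []]].
    by rewrite B0 inE.
  apply/esym/eqP; rewrite cards0 B0 /dtree_count cards_eq0; apply/eqP/setP => p.
  rewrite !inE; apply/negbTE/negP => /dtreeP[_ _ [[r lr] _]].
  by have := lr; rewrite cards0.
pose ev : 'I_#|B| -> T := enum_val.
pose rk : T -> 'I_#|B| := enum_rank_in x0B.
have evB a : ev a \in B by apply: enum_valP.
have evK : cancel ev rk by apply: enum_valK_in.
have rkK : {in B, cancel rk ev} by apply: enum_rankK_in.
have inj := can_inj evK.
have Bev x : x \in B -> exists a, x = ev a by move=> xB; exists (rk x); rewrite rkK.
apply: (card_eq_can
  (f := fun p : pairf T => [ffun a => (rk (parent p (ev a)), rk (auto p (ev a)))] : pairf 'I_#|B|)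
  (g := fun p0 : pairf 'I_#|B| => [ffun x => if x \in B then
          (ev (parent p0 (rk x)), ev (auto p0 (rk x))) else (x, x)] : pairf T)).
- move=> p; rewrite !inE => dp; have st := dtree_stable dp; have /and3P[sp _ _] := dp.
  rewrite -(dtree_transfer inj evB Bev sp) // => a; rewrite ffunE /=.
  have [? ?] := st _ (evB a).
  by rewrite !rkK // /parent /auto; case: (p _).
- move=> p0; rewrite !inE => dp; rewrite (dtree_transfer inj evB Bev (p0 := p0)) //.
    by apply/supportedP => x xB; rewrite ffunE (negbTE xB).
  by move=> a; rewrite ffunE evB evK.
- move=> p; rewrite inE => dp; have st := dtree_stable dp; have /and3P[/supportedP sp _ _] := dp.
  apply/ffunP => x; rewrite !ffunE; case: (boolP (x \in B)) => xB; last by rewrite sp.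
  have [? ?] := st _ xB.
  by rewrite /parent /auto ffunE /= !rkK // /parent /auto; case: (p x).
- move=> p0 _; apply/ffunP => a; rewrite !ffunE /parent /auto ffunE evB /= !evK.
  by case: (p0 a).
Qed.

(** Labelled trees are paired with automorphisms because each isomorphism class then contributes n!
    pairs, whatever its symmetry. A uniform pair is therefore a uniform Polya tree with a uniform
    automorphism. *)
Definition marked_trees (n : nat) (S : pred nat) :
    {set {ffun 'I_n -> 'I_n} * {perm 'I_n}} :=
  [set fs | [&& fs.1 \in rooted_trees n, fs.2 \in tree_aut fs.1 &
    [forall v in C_tree fs.2, S #|D_forest fs.1 fs.2 v|]]].

Lemma rooted_treesP (n : nat) (f : {ffun 'I_n -> 'I_n}) :
  reflect (exists2 r, f r = r & forall v, fconnect f v r) (f \in rooted_trees n).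
Proof.
rewrite inE; apply: (iffP existsP) => [[r /andP[/eqP fr /forallP cr]]|[r fr cr]].
  by exists r.
by exists r; rewrite fr eqxx; apply/forallP.
Qed.

Lemma tree_autP (n : nat) (f : {ffun 'I_n -> 'I_n}) (s : {perm 'I_n}) :
  reflect (forall v, s (f v) = f (s v)) (s \in tree_aut f).
Proof.
rewrite inE; apply: (iffP forallP) => sP v; first exact/eqP.
by rewrite sP.
Qed.

(** Fixed nodes become roots, which cuts the edges of the C-tree and keeps all others. *)
Definition forest_part (n : nat) (f : {ffun 'I_n -> 'I_n}) (s : {perm 'I_n}) : pairf 'I_n :=
  [ffun x => (if s x == x then x else f x, s x)].

Lemma forest_part_reach (n : nat) (f : {ffun 'I_n -> 'I_n}) (s : {perm 'I_n}) (x r : 'I_n) :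
  s r = r -> fconnect f x r ->
  exists2 v, s v = v & fconnect (parent (forest_part f s)) x v.
Proof.
move=> sr /fconnect_iterP[k]; elim: k x => [|k IH] x.
  by move=> /= ->; exists r.
have [sx|sx] := eqVneq (s x) x; first by exists x.
rewrite iterSr => /IH[v sv cv]; exists v => //.
apply: connect_trans cv; apply: connect1.
by rewrite /= /parent ffunE (negbTE sx).
Qed.

(** Ancestors of a fixed node are fixed, so the subtree of a moved child contains no fixed node and
    survives the cutting of the C-tree unchanged. *)
Lemma D_forest_block (n : nat) (f : {ffun 'I_n -> 'I_n}) (s : {perm 'I_n}) (v : 'I_n) :
  s \in tree_aut f -> s v = v -> D_forest f s v = block (forest_part f s) v :\ v.
Proof.
move=> /tree_autP com sv; set p := forest_part f s.
have pE x : parent p x = if s x == x then x else f x by rewrite /parent ffunE.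
have fixf x : s x = x -> s (f x) = f x by move=> sx; rewrite com sx.
apply/setP => w; rewrite !inE; apply/bigcupP/andP.
  case=> c /andP[/andP[cv /eqP fc] sc]; rewrite inE => /fconnect_iterP[k].
  elim: k w => [|k IH] w.
    move=> /= ->; split=> //; apply: connect1.
    by rewrite /= pE (negbTE sc) fc.
  rewrite iterSr => kc; have sw : s w != w.
    apply: contra_neq sc => sw; rewrite -kc.
    have : s (f w) = f w by apply: fixf.
    by elim: k {kc IH} (f w) => // k IH y /fixf sy; rewrite iterSr IH.
  have [_ cw] := IH _ kc; split; first by apply: contra_neq sw => ->.
  apply: connect_trans cw; apply: connect1.
  by rewrite /= pE (negbTE sw).
case=> wv /fconnect_iterP[k]; elim: k w wv => [|k IH] w wv.
  by move=> /= wE; rewrite wE eqxx in wv.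
rewrite iterSr pE; case: (eqVneq (s w) w) => [sw | sw kv].
  by rewrite iter_fix ?pE ?sw ?eqxx // => wE; rewrite wE eqxx in wv.
have [fv|fv] := eqVneq (f w) v.
  by exists w; rewrite ?inE // /child wv fv eqxx sw.
have [c cP] := IH _ fv kv; rewrite inE => cw.
by exists c => //; rewrite inE; apply: connect_trans cw; apply: connect1 => /=.
Qed.

(** The default is never met for an equivariant [p], whose [auto p] is injective. *)
Definition auto_perm (T : finType) (p : pairf T) : {perm T} :=
  odflt 1%g [pick s : {perm T} | [forall x, s x == auto p x]].

Lemma auto_permE (T : finType) (p : pairf T) (x : T) :
  equivariant p -> auto_perm p x = auto p x.
Proof.
case/equivariantP => inj _; rewrite /auto_perm; case: pickP => [s /forallP/(_ x)/eqP //|].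
move/(_ (perm inj))/negbT/forallPn => [y]; by rewrite permE eqxx.
Qed.

Lemma forest_part_cforest (n : nat) (S : pred nat) (f : {ffun 'I_n -> 'I_n})
    (s : {perm 'I_n}) :
  (f, s) \in marked_trees n S ->
  [/\ cforest S (forest_part f s), roots (forest_part f s) = C_tree s &
    [ffun x => if s x == x then f x else x] \in trees_on (roots (forest_part f s))].
Proof.
rewrite inE /= => /and3P[/rooted_treesP[r fr cr] sa /forall_inP Sv].
have com := tree_autP _ _ sa.
have sr : s r = r by apply/esym/(fconnect_fixed _ (cr (s r))); rewrite -com fr.
set p := forest_part f s.
have pE x : parent p x = if s x == x then x else f x by rewrite /parent ffunE.
have aE x : auto p x = s x by rewrite /auto ffunE.
have apE x : (auto p x == x) = (parent p x == x).
  rewrite aE pE; case: (eqVneq (s x) x) => [|sx]; first by rewrite eqxx.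
  apply/esym/negbTE; apply: contra_neq sx => fx.
  by have := fconnect_fixed fx (cr x) => <-.
have rE : roots p = C_tree s by apply/setP => x; rewrite !inE -apE aE.
split=> //.
  apply/cforestP; split=> //.
  - apply/equivariantP; split=> [x y|x]; rewrite !aE; first exact: perm_inj.
    by rewrite !pE (inj_eq perm_inj); case: ifP => // _; rewrite com.
  - move=> x; have [v sv cv] := forest_part_reach sr (cr x).
    by exists v => //; rewrite pE sv eqxx.
  - move=> v /eqP; rewrite -apE aE => /eqP sv.
    have := Sv v; rewrite inE sv eqxx (D_forest_block sa sv) => /(_ isT).
    by rewrite (cardsD1 v (block p v)) inE connect0.
apply/trees_onP; rewrite rE; split=> [x|]; first by rewrite inE ffunE => /negbTE ->.
exists r; split; rewrite ?inE ?ffunE ?sr ?eqxx // => x; rewrite inE => /eqP sx.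
have /fconnect_iterP[k] := cr x; elim: k x sx => [|k IH] x sx; first by move=> /= ->.
rewrite iterSr => kr; apply: connect_trans (IH (f x) _ kr); last by rewrite com sx.
by apply: connect1; rewrite /= ffunE sx eqxx.
Qed.

(** Any tree [g] on the roots can be glued in: the automorphism fixes every root, so it commutes
    with every parent map on them. *)
Lemma forest_part_glue (n : nat) (S : pred nat) (p : pairf 'I_n) (g : {ffun 'I_n -> 'I_n}) :
  cforest S p -> g \in trees_on (roots p) ->
  let f := [ffun x => if auto p x == x then g x else parent p x] in
  forest_part f (auto_perm p) = p /\ (f, auto_perm p) \in marked_trees n S.
Proof.
move=> /cforestP[ep apE rp Sp] /trees_onP[gI [r [rr gr cr]]] f.
have /equivariantP[inj com] := ep; have sE x := auto_permE x ep.
have arE x : (x \in roots p) = (auto p x == x) by rewrite inE apE.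
have fE x : f x = if x \in roots p then g x else parent p x by rewrite ffunE arE.
have FP : forest_part f (auto_perm p) = p.
  apply/ffunP => x; rewrite ffunE sE fE -arE; case: (boolP (x \in roots p)) => [|_].
    by rewrite inE /parent /auto; case: (p x) => a b /= /eqP ->.
  by rewrite /parent /auto; case: (p x).
have g_roots x : x \in roots p -> g x \in roots p.
  move=> xr; have := cr x xr; rewrite fconnect_eqVf => /orP[/eqP ->|]; first by rewrite gr.
  have [//|gx] := boolP (g x \in roots p).
  by move/(fconnect_fixed (gI _ gx)) => rE; rewrite rE (negbTE gx) in rr.
have f_roots x : x \in roots p -> fconnect f x r.
  move=> xr; have /fconnect_iterP[k] := cr x xr; elim: k x xr => [|k IH] x xr.
    by move=> /= ->.
  rewrite iterSr => kr; apply: connect_trans (IH _ (g_roots _ xr) kr).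
  by apply: connect1; rewrite /= fE xr.
have sa : auto_perm p \in tree_aut f.
  apply/tree_autP => v; rewrite !sE !fE [auto p v \in _]arE (inj_eq inj) -arE.
  case: ifP => vr //; have := g_roots _ vr; rewrite !arE => /eqP ->.
  by move: vr; rewrite arE => /eqP ->.
split=> //; rewrite inE /=; apply/and3P; split=> //.
  apply/rooted_treesP; exists r; first by rewrite fE rr.
  move=> v; have [u pu /fconnect_iterP[k]] := rp v; elim: k v => [|k IH] v.
    by move=> /= ->; apply: f_roots; rewrite inE pu.
  have [vr|vr] := boolP (v \in roots p); first by move=> _; apply: f_roots.
  rewrite iterSr => /IH; apply: connect_trans; apply: connect1.
  by rewrite /= fE (negbTE vr).
apply/forall_inP => v; rewrite inE => /eqP sv; rewrite (D_forest_block sa sv) FP.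
have /Sp : parent p v = v by apply/eqP; rewrite -apE -sE sv.
by rewrite (cardsD1 v (block p v)) inE connect0.
Qed.

Lemma card_marked_trees_roots (n : nat) (S : pred nat) : (0 < n)%N ->
  #|marked_trees n S| =
  (\sum_(p : pairf 'I_n | cforest S p) #|roots p| ^ #|roots p|.-1)%N.
Proof.
move=> n0.
transitivity #|[set pg : pairf 'I_n * {ffun 'I_n -> 'I_n} |
    cforest S pg.1 & pg.2 \in trees_on (roots pg.1)]|; last first.
  rewrite -sum1dep_card -(pair_big_dep (cforest S)
    (fun p g => g \in trees_on (roots p)) (fun _ _ => 1%N)) /=.
  apply: eq_bigr => p cp; rewrite sum1_card; apply: card_trees_on.
  have /cforestP[_ _ /(_ (Ordinal n0))[r pr _] _] := cp.
  by apply/set0Pn; exists r; rewrite inE pr.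
apply: (card_eq_can
  (f := fun fs : {ffun 'I_n -> 'I_n} * {perm 'I_n} => (forest_part fs.1 fs.2,
      [ffun x => if fs.2 x == x then fs.1 x else x] : {ffun 'I_n -> 'I_n}))
  (g := fun pg : pairf 'I_n * {ffun 'I_n -> 'I_n} =>
      ([ffun x => if auto pg.1 x == x then pg.2 x else parent pg.1 x] : {ffun 'I_n -> 'I_n},
       auto_perm pg.1))).
- by move=> [f s] /forest_part_cforest[cp _ gT]; rewrite inE /= cp gT.
- move=> [p g]; rewrite inE /= => /andP[cp gT].
  by have [_] := forest_part_glue cp gT.
- move=> [f s] /forest_part_cforest[/cforestP[ep _ _ _] _ _] /=; congr pair.
    apply/ffunP => x; rewrite !ffunE /auto /parent !ffunE /=.
    by case: (s x == x).
  by apply/permP => x; rewrite auto_permE // /auto ffunE.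
- move=> [p g]; rewrite inE /= => /andP[cp gT].
  have [-> _] := forest_part_glue cp gT; congr pair; apply/ffunP => x.
  have /cforestP[ep apE _ _] := cp; have /trees_onP[gI _] := gT.
  rewrite !ffunE auto_permE //; case: (boolP (auto p x == x)) => // ax.
  by rewrite gI // inE -apE.
Qed.

(* [m ^ m.-1] counts the C-trees on [m] nodes, the [m]-th power chooses their D-forests. *)
Lemma marked_trees_egf (R : numFieldType) (n : nat) (S : pred nat) : (0 < n)%N ->
  #|marked_trees n S|%:R / n`!%:R =
  \sum_(m < n.+1) (m ^ m.-1)%:R / m`!%:R *
    (egf n (fun l => if S l.-1 then (dtree_count l)%:R else 0 : R) ^+ m)`_n.
Proof.
move=> n0; rewrite card_marked_trees_roots //.
rewrite (partition_big (fun p : pairf 'I_n => inord #|roots p| : 'I_n.+1) predT) //=.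
rewrite natr_sum mulr_suml; apply: eq_bigr => m _.
have fact_neq0 k : (k`!%:R : R) != 0 by rewrite pnatr_eq0 -lt0n fact_gt0.
rewrite (eq_bigl (fun p : pairf 'I_n => p \in [set p | cforest S p & #|roots p| == m])); last first.
  move=> p; rewrite inE; apply: andb_id2l => _; rewrite -val_eqE /= inordK //.
  by rewrite ltnS -[X in (_ <= X)%N]card_ord max_card.
rewrite (eq_bigr (fun=> m ^ m.-1)%N); last by move=> p; rewrite inE => /andP[_ /eqP ->].
rewrite sum_nat_const natrM card_cforest natr_sum.
rewrite (eq_bigr (fun P : {set {set 'I_n}} => \prod_(B in P)
    (if S #|B|.-1 then (dtree_count #|B|)%:R else 0 : R))); last first.
  move=> P _; rewrite natr_prod; apply: eq_bigr => B _.
  have -> : #|[set p | dtreeS S B p]| = if S #|B|.-1 then dtree_count #|B| else 0%N.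
    rewrite -card_dtree; case: ifP => SB; rewrite /dtreeS SB.
      by apply: eq_card => p; rewrite !inE andbT.
    by apply: eq_card0 => p; rewrite !inE andbF.
  by case: ifP.
have := @block_sumE R 'I_n (fun l => if S l.-1 then (dtree_count l)%:R else 0 : R) m n setT.
rewrite /block_sum cardsT card_ord => -> //.
by field; rewrite !fact_neq0.
Qed.

(** * From labelled to unlabelled trees *)

Definition relabel (n : nat) (t : {perm 'I_n}) (f : {ffun 'I_n -> 'I_n}) :
    {ffun 'I_n -> 'I_n} := [ffun v => t (f (t^-1 v))]%g.

Lemma relabelM (n : nat) (s t : {perm 'I_n}) (f : {ffun 'I_n -> 'I_n}) :
  relabel (s * t)%g f = relabel t (relabel s f).
Proof. by apply/ffunP => v; rewrite !ffunE invMg !permM. Qed.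

Lemma relabel1 (n : nat) (f : {ffun 'I_n -> 'I_n}) : relabel 1%g f = f.
Proof. by apply/ffunP => v; rewrite ffunE invg1 !perm1. Qed.

Lemma relabelE (n : nat) (t : {perm 'I_n}) (f : {ffun 'I_n -> 'I_n}) (v : 'I_n) :
  relabel t f (t v) = t (f v).
Proof. by rewrite ffunE permK. Qed.

Lemma tree_isoP (n : nat) (f g : {ffun 'I_n -> 'I_n}) :
  reflect (exists t, g = relabel t f) (tree_iso f g).
Proof.
apply: (iffP existsP) => -[t].
  move/forallP => tP; exists t; apply/ffunP => v; rewrite ffunE.
  by rewrite (eqP (tP _)) permKV.
by move=> ->; exists t; apply/forallP => v; rewrite relabelE.
Qed.

Lemma tree_aut_relabel (n : nat) (f : {ffun 'I_n -> 'I_n}) (a : {perm 'I_n}) :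
  (a \in tree_aut f) = (relabel a f == f).
Proof.
apply/tree_autP/eqP => [com | fE v]; last by rewrite -relabelE fE.
by apply/ffunP => v; rewrite ffunE com permKV.
Qed.

Lemma fconnect_relabel (n : nat) (t : {perm 'I_n}) (f : {ffun 'I_n -> 'I_n}) (v w : 'I_n) :
  fconnect (relabel t f) (t v) (t w) = fconnect f v w.
Proof.
have it k : iter k (relabel t f) (t v) = t (iter k f v).
  by elim: k => //= k ->; rewrite relabelE.
apply/fconnect_iterP/fconnect_iterP => -[k kE]; exists k.
  by apply: (@perm_inj _ t); rewrite -it.
by rewrite it kE.
Qed.

Lemma rooted_relabel (n : nat) (t : {perm 'I_n}) (f : {ffun 'I_n -> 'I_n}) :
  f \in rooted_trees n -> relabel t f \in rooted_trees n.
Proof.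
case/rooted_treesP => r fr cr; apply/rooted_treesP; exists (t r).
  by rewrite relabelE fr.
by move=> v; rewrite -[v](permKV t) fconnect_relabel.
Qed.

Definition forest_event (n : nat) (S : pred nat)
    (f : {ffun 'I_n -> 'I_n}) (s : {perm 'I_n}) : bool :=
  [forall v in C_tree s, S #|D_forest f s v|].

Lemma D_forest_relabel (n : nat) (t : {perm 'I_n}) (f : {ffun 'I_n -> 'I_n})
    (s : {perm 'I_n}) (v : 'I_n) :
  #|D_forest (relabel t f) (s ^ t)%g (t v)| = #|D_forest f s v|.
Proof.
suff -> : D_forest (relabel t f) (s ^ t)%g (t v) = t @: D_forest f s v.
  by rewrite card_imset //; apply: perm_inj.
have stE x : (s ^ t)%g (t x) = t (s x) by rewrite permJ.
apply/setP => w; rewrite -[w](permKV t) mem_imset; last exact: perm_inj.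
apply/bigcupP/bigcupP => -[c /andP[/andP[cv fc] sc]]; rewrite inE => cw.
  exists (t^-1 c)%g; last first.
    by rewrite inE -(fconnect_relabel t) permKV [t (_ c)]permKV; move: cw; rewrite permKV.
  apply/andP; split; last by apply: contra_neq sc => E; rewrite -[c](permKV t) stE E.
  apply/andP; split; first by apply: contra_neq cv => <-; rewrite permKV.
  by apply/eqP/(@perm_inj _ t); rewrite -relabelE permKV (eqP fc).
exists (t c); last by rewrite inE fconnect_relabel.
by rewrite /child relabelE stE !(inj_eq (@perm_inj _ t)) cv fc sc.
Qed.

Lemma forest_event_relabel (n : nat) (S : pred nat) (t : {perm 'I_n})
    (f : {ffun 'I_n -> 'I_n}) (s : {perm 'I_n}) :
  forest_event S f s -> forest_event S (relabel t f) (s ^ t)%g.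
Proof.
move=> /forall_inP Sv; apply/forall_inP => v.
rewrite -[v](permKV t) inE permJ (inj_eq perm_inj) D_forest_relabel => sv.
by apply: Sv; rewrite inE.
Qed.

(** Orbit-stabilizer: the fibres of the map [s] to [relabel s f] are cosets of the automorphism
    group. *)
Lemma card_tree_class (n : nat) (f : {ffun 'I_n -> 'I_n}) : f \in rooted_trees n ->
  (#|[set g in rooted_trees n | tree_iso f g]| * #|tree_aut f| = n`!)%N.
Proof.
move=> fT; rewrite -card_Sn.
rewrite -[RHS]sum1_card [RHS](partition_big (fun s => relabel s f)
  (mem [set g in rooted_trees n | tree_iso f g])); last first.
  by move=> s _; apply/setIdP; split; [exact: rooted_relabel | apply/tree_isoP; exists s].
rewrite -sum_nat_const; apply: eq_bigr => g /setIdP[_ /tree_isoP[t ->]].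
rewrite (eq_bigl (fun s => s \in [set s | relabel s f == relabel t f])); last first.
  by move=> s; rewrite in_set.
rewrite sum1_card; apply: (card_eq_can (f := fun a => (a * t)%g) (g := fun s => (s * t^-1)%g)).
- by move=> a; rewrite tree_aut_relabel in_set => /eqP aE; rewrite relabelM aE.
- move=> s; rewrite in_set => /eqP sE; rewrite tree_aut_relabel relabelM sE.
  by rewrite -relabelM mulgV relabel1.
- by move=> a _; rewrite mulgK.
- by move=> a _; rewrite mulgKV.
Qed.

Lemma card_polya_class (n : nat) (f : {ffun 'I_n -> 'I_n}) : f \in rooted_trees n ->
  #|[set g in polya_trees n | tree_iso g f]| = 1%N.
Proof.
move=> fT; have /and3P[partP sXD /forall_inP card1] := polya_treesP n.
have cov : f \in cover (equivalence_partition (@tree_iso n) (rooted_trees n)).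
  by rewrite (cover_partition partP).
rewrite -(eqP (card1 _ (pblock_mem cov))); apply: eq_card => g; rewrite !inE.
case: (boolP (g \in polya_trees n)) => //= gX; have gD := subsetP sXD _ gX.
rewrite (pblock_equivalence_partition (@tree_iso_equiv n)) //.
have [gg gfE] := tree_iso_equiv gD fT gD.
have [ff fgE] := tree_iso_equiv fT gD fT.
apply/idP/idP => [gf | fg].
  by have := gfE gf; rewrite gg => <-.
by have := fgE fg; rewrite ff => <-.
Qed.

(** Conjugation by [t] matches the automorphisms of the two labellings, so the choice of
    representatives in [polya_trees] does not matter. *)
Lemma card_tree_event_relabel (n : nat) (S : pred nat) (t : {perm 'I_n})
    (f : {ffun 'I_n -> 'I_n}) :
  #|[set s in tree_aut (relabel t f) | forest_event S (relabel t f) s]| =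
  #|[set s in tree_aut f | forest_event S f s]|.
Proof.
have autJ (u a : {perm 'I_n}) g : a \in tree_aut g -> (a ^ u)%g \in tree_aut (relabel u g).
  rewrite !tree_aut_relabel conjgE => /eqP aE.
  by rewrite -relabelM mulKVg relabelM aE.
apply/esym; apply: (card_eq_can (f := fun s => (s ^ t)%g) (g := fun s => (s ^ (t^-1))%g)).
- move=> s /setIdP[sa Es]; apply/setIdP; split; first exact: autJ.
  exact: forest_event_relabel.
- move=> s /setIdP[sa Es]; have fE : relabel t^-1 (relabel t f) = f.
    by rewrite -relabelM mulgV relabel1.
  apply/setIdP; rewrite -fE; split; first exact: autJ.
  exact: forest_event_relabel.
- by move=> s _; rewrite conjgK.
- by move=> s _; rewrite conjgKV.
Qed.

Lemma card_marked_trees_polya (n : nat) (S : pred nat) :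
  (#|marked_trees n S| = \sum_(f in polya_trees n)
    #|[set g in rooted_trees n | tree_iso f g]| *
    #|[set s in tree_aut f | forest_event S f s]|)%N.
Proof.
transitivity (\sum_(f in rooted_trees n) #|[set s in tree_aut f | forest_event S f s]|)%N.
  rewrite -sum1_card (eq_bigl (fun fs : {ffun 'I_n -> 'I_n} * {perm 'I_n} =>
    (fs.1 \in rooted_trees n) && (fs.2 \in [set s in tree_aut fs.1 | forest_event S fs.1 s])));
    last by move=> [f s]; rewrite [LHS]in_set /=; congr (_ && _); rewrite [RHS]in_set.
  rewrite -(pair_big_dep (mem (rooted_trees n))
    (fun f s => s \in [set s in tree_aut f | forest_event S f s]) (fun _ _ => 1%N)) /=.
  by apply: eq_bigr => f _; rewrite sum1_card.
transitivity (\sum_(f in rooted_trees n) \sum_(g in polya_trees n | tree_iso g f)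
    #|[set s in tree_aut g | forest_event S g s]|)%N.
  apply: eq_bigr => f fT.
  rewrite (eq_bigr (fun=> #|[set s in tree_aut f | forest_event S f s]|)); last first.
    by move=> g /andP[_ /tree_isoP[t ->]]; rewrite card_tree_event_relabel.
  rewrite -[LHS]mul1n -(card_polya_class fT) -sum_nat_const.
  by apply: eq_bigl => g; rewrite in_set.
rewrite (exchange_big_dep (mem (polya_trees n))) /=; last by move=> f g _ /andP[].
apply: eq_bigr => g gT; rewrite -sum_nat_const.
by apply: eq_bigl => f; rewrite in_set gT.
Qed.

Lemma polya_rooted (n : nat) : {subset polya_trees n <= rooted_trees n}.
Proof. by have /and3P[_ /subsetP] := polya_treesP n. Qed.

Lemma card_all_marked (n : nat) : #|marked_trees n predT| = (n`! * polya_count n)%N.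
Proof.
rewrite card_marked_trees_polya mulnC -sum_nat_const; apply: eq_bigr => f /polya_rooted fT.
rewrite -(card_tree_class fT); congr (_ * _)%N; apply: eq_card => s.
by rewrite [LHS]in_set andb_idr // => _; apply/forall_inP.
Qed.

(** By [card_tree_class] the weight of an automorphism, the inverse of [#|tree_aut f|], is the size
    of the class of [f] divided by n!. So the random decomposition is a uniform element of the
    unrestricted marked trees. *)
Lemma decomp_probE (R : realType) (n : nat) (S : pred nat) :
  decomp_prob R (@forest_event n S) =
  (#|marked_trees n S|%:R / n`!%:R) / (polya_count n)%:R.
Proof.
have fn0 : (n`!%:R : R) != 0 by rewrite pnatr_eq0 -lt0n fact_gt0.
rewrite card_marked_trees_polya natr_sum !mulr_suml; apply: eq_bigr => f fP.
have fT := polya_rooted fP.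
have -> (a : R) : \sum_(s in tree_aut f | forest_event S f s) a =
    a *+ #|[set s in tree_aut f | forest_event S f s]|.
  by rewrite -sumr_const; apply: eq_bigl => s; rewrite [RHS]in_set.
have aut0 : (#|tree_aut f|%:R : R) != 0.
  rewrite pnatr_eq0 -lt0n; have := fact_gt0 n.
  by rewrite -(card_tree_class fT) muln_gt0 => /andP[].
have cE : (#|[set g in rooted_trees n | tree_iso f g]|%:R : R) = n`!%:R / #|tree_aut f|%:R.
  by rewrite -(card_tree_class fT) natrM mulfK.
have pn0 : (#|polya_trees n|%:R : R) != 0.
  by rewrite pnatr_eq0 -lt0n; apply/card_gt0P; exists f.
by rewrite natrM cE -mulr_natr /polya_count; field; rewrite fn0 aut0 pn0.
Qed.

Lemma decomp_prob_sandwich (R : realType) (n : nat)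
    (E A B : {ffun 'I_n -> 'I_n} -> {perm 'I_n} -> bool) :
  (forall f s, A f s -> ~~ B f s -> E f s) ->
  decomp_prob R A - decomp_prob R B <= decomp_prob R E.
Proof.
move=> AE; rewrite lerBlDr -big_split; apply: ler_sum => f _ /=.
rewrite -mulrDr ler_wpM2l ?invr_ge0 ?ler0n //.
rewrite !big_mkcondr -big_split; apply: ler_sum => s _ /=.
have c0 : 0 <= #|tree_aut f|%:R^-1 :> R by rewrite invr_ge0 ler0n.
case: (boolP (A f s)) => Af; last by apply: addr_ge0; case: ifP.
case: (boolP (B f s)) => Bf; last by rewrite AE // addr0.
by case: ifP => _; rewrite ?add0r // lerDl.
Qed.

Lemma decomp_prob_le1 (R : realType) (n : nat)
    (E : {ffun 'I_n -> 'I_n} -> {perm 'I_n} -> bool) :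
  decomp_prob R E <= 1.
Proof.
have le_aut f : \sum_(s in tree_aut f | E f s) #|tree_aut f|%:R^-1 <= 1 :> R.
  have [a0|a0] := posnP #|tree_aut f|.
    by rewrite a0 invr0 big1.
  apply: (@le_trans _ _ (\sum_(s in tree_aut f) #|tree_aut f|%:R^-1)); last first.
    by rewrite sumr_const -[leLHS]mulr_natl mulfV // pnatr_eq0 -lt0n.
  rewrite big_mkcondr; apply: ler_sum => s _.
  by case: ifP; rewrite // invr_ge0.
have [p0|p0] := posnP #|polya_trees n|.
  by rewrite /decomp_prob p0 invr0 big1 // => f _; rewrite mul0r.
apply: (@le_trans _ _ (\sum_(f in polya_trees n) #|polya_trees n|%:R^-1)); last first.
  by rewrite sumr_const -[leLHS]mulr_natl mulfV // pnatr_eq0 -lt0n.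
apply: ler_sum => f _.
by rewrite ler_piMr // invr_ge0.
Qed.

(** * Counting D-forests *)

Definition dforest (T : finType) (A : {set T}) (p : pairf T) : bool :=
  [&& supported A p, equivariant p, [forall x in A, auto p x != x] &
    [forall x in A, [exists y in A, (parent p y == y) && fconnect (parent p) x y]]].

Lemma dforestP (T : finType) (A : {set T}) (p : pairf T) :
  reflect [/\ supported A p, equivariant p, forall x, x \in A -> auto p x != x &
      forall x, x \in A -> exists y, [/\ y \in A, parent p y = y & fconnect (parent p) x y]]
    (dforest A p).
Proof.
apply: (iffP and4P) => -[sp ep].
  move=> /forall_inP ap /forall_inP rp; split=> // x xA.
  by have /exists_inP[y yA /andP[/eqP py cy]] := rp x xA; exists y.
move=> ap rp; split=> //; first exact/forall_inP.
apply/forall_inP => x xA; have [y [yA py cy]] := rp x xA.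
by apply/exists_inP; exists y; rewrite // py eqxx.
Qed.

Lemma dforest_parent (T : finType) (A : {set T}) (p : pairf T) (x : T) :
  dforest A p -> x \in A -> parent p x \in A.
Proof.
case/dforestP => /supportedP sp _ _ rp xA; have [y [yA py cy]] := rp x xA.
have [//|pA] := boolP (parent p x \in A).
move: cy; rewrite fconnect_eqVf => /orP[/eqP xy | ].
  by move: pA; rewrite xy py yA.
have pp : parent p (parent p x) = parent p x by rewrite {1}/parent sp.
by move/(fconnect_fixed pp) => yE; move: pA; rewrite -yE yA.
Qed.

Definition cut_root (T : finType) (r : T) (p : pairf T) : pairf T :=
  [ffun x => if x == r then (r, r) else
    (if parent p x == r then x else parent p x, auto p x)].

Definition add_root (T : finType) (r : T) (p : pairf T) : pairf T :=
  [ffun x => if x == r then (r, r) else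
    (if parent p x == x then r else parent p x, auto p x)].

Lemma cut_root_dforest (T : finType) (r : T) (p : pairf T) :
  dtree [set: T] p -> parent p r = r -> dforest [set~ r] (cut_root r p).
Proof.
case/dtreeP => _ /equivariantP[inj com] [r' [_ pr' cr' sr']] pr.
have rE : r = r' by apply: fixed_reach_uniq pr pr' (connect0 _ _) (cr' r (in_setT r)).
rewrite -{r'}rE in pr' cr' sr'; have cr x : fconnect (parent p) x r by apply: cr'; rewrite inE.
have sr x : auto p x = x <-> x = r by apply: sr'; rewrite inE.
have ar : auto p r = r by apply/sr.
have arE x : (auto p x == r) = (x == r) by rewrite -{1}ar (inj_eq inj).
have aE x : auto (cut_root r p) x = auto p x.
  by rewrite /auto ffunE; case: eqVneq => [->|] //=; rewrite -/(auto p r) ar.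
have pE x : parent (cut_root r p) x = if parent p x == r then x else parent p x.
  by rewrite {1}/parent ffunE; case: eqVneq => [->|] //=; rewrite pr eqxx.
apply/dforestP; split.
- by apply/supportedP => x; rewrite !inE negbK => /eqP ->; rewrite ffunE eqxx.
- apply/equivariantP; split=> [x y|x]; rewrite !aE; first exact: inj.
  by rewrite !pE -com arE; case: ifP.
- by move=> x; rewrite !inE aE; apply: contra_neq => /sr.
- move=> x; rewrite !inE; have /fconnect_iterP[k] := cr x.
  elim: k x => [|k IH] x; first by move=> /= ->; rewrite eqxx.
  rewrite iterSr => kr xr; have [px|px] := eqVneq (parent p x) r.
    by exists x; rewrite !inE xr pE px eqxx.
  have [y [yr py cy]] := IH _ kr px; exists y; split=> //.
  by apply: connect_trans cy; apply: connect1; rewrite /= pE (negbTE px).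
Qed.

Lemma add_root_dtree (T : finType) (r : T) (p : pairf T) :
  dforest [set~ r] p -> dtree [set: T] (add_root r p) /\ parent (add_root r p) r = r.
Proof.
move=> fp; have /dforestP[/supportedP sp /equivariantP[inj com] ap rp] := fp.
have rr : p r = (r, r) by apply: sp; rewrite !inE eqxx.
have aE x : auto (add_root r p) x = auto p x.
  by rewrite /auto ffunE; case: eqVneq => [->|] //=; rewrite rr.
have pE x : parent (add_root r p) x = if parent p x == x then r else parent p x.
  by rewrite {1}/parent ffunE; case: eqVneq => [->|] //=; rewrite /parent rr eqxx.
have ar : auto p r = r by rewrite /auto rr.
have pr : parent (add_root r p) r = r by rewrite pE; case: eqVneq => // _; rewrite /parent rr.
have arE x : (auto p x == r) = (x == r) by rewrite -{1}ar (inj_eq inj).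
split=> //; apply/dtreeP; split.
- by apply/supportedP => x; rewrite inE.
- apply/equivariantP; split=> [x y|x]; rewrite !aE; first exact: inj.
  by rewrite !pE -com (inj_eq inj); case: ifP => // _; rewrite ar com.
- exists r; split; rewrite ?inE // => x _; last first.
    rewrite aE; split=> [ax | ->//]; apply/eqP; apply: contraT => xr.
    by have := ap x; rewrite !inE xr ax eqxx => /(_ isT).
  have [->//|xr] := eqVneq x r.
  have [|y [_ py /fconnect_iterP[k]]] := rp x; first by rewrite !inE.
  elim: k x xr => [|k IH] x xr.
    move=> /= xy; apply: connect1; by rewrite /= pE xy py eqxx.
  rewrite iterSr => ky; have [px|px] := eqVneq (parent p x) x.
    by apply: connect1; rewrite /= pE px eqxx.
  have pxr : parent p x != r.
    by have := dforest_parent fp (x := x); rewrite !inE => ->.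
  apply: connect_trans (IH _ pxr ky); apply: connect1.
  by rewrite /= pE (negbTE px).
Qed.

(** [cut_root] makes the children of [r] their own parents. [add_root] undoes this, because off [r]
    only the roots of the forest are their own parents. *)
Lemma dtree_count_dforest (l : nat) :
  dtree_count l = (\sum_(r < l) #|[set p : pairf 'I_l | dforest [set~ r] p]|)%N.
Proof.
rewrite /dtree_count -sum1_card (eq_bigr (fun r : 'I_l =>
  \sum_(p : pairf 'I_l | dtree [set: 'I_l] p && (parent p r == r)) 1)%N); last first.
  move=> r _; rewrite sum1dep_card; apply/esym.
  apply: (card_eq_can (f := cut_root r) (g := add_root r)).
  - by move=> p; rewrite !inE => /andP[dp /eqP pr]; apply: cut_root_dforest.
  - by move=> p; rewrite !inE => /add_root_dtree[-> ->]; rewrite eqxx.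
  - move=> p; rewrite inE => /andP[/dtreeP[_ _ [r' [_ pr' cr' sr']]] /eqP pr].
    have rE : r = r' by apply: fixed_reach_uniq pr pr' (connect0 _ _) (cr' r (in_setT r)).
    rewrite -{r'}rE in pr' cr' sr'.
    apply/ffunP => x; rewrite ffunE /parent /auto; case: eqVneq => [->|xr].
      have : auto p r = r by apply/sr'; rewrite ?inE.
      by move: pr; rewrite /parent /auto; case: (p r) => a b /= -> ->.
    rewrite !ffunE (negbTE xr) /= /parent /auto.
    have px : (p x).1 != x.
      by apply: contra_neq xr => px; rewrite (fconnect_fixed px (cr' x (in_setT x))).
    case: (eqVneq (p x).1 r) => [<-|_]; first by rewrite eqxx; case: (p x).
    by rewrite (negbTE px); case: (p x).
  - move=> p; rewrite inE => fp; have /dforestP[/supportedP sp _ _ _] := fp.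
    apply/ffunP => x; rewrite ffunE /parent /auto; case: eqVneq => [->|xr].
      by rewrite sp // !inE eqxx.
    have pxr : (p x).1 != r.
      by have := dforest_parent fp (x := x); rewrite !inE => ->.
    rewrite !ffunE (negbTE xr) /= /parent /auto.
    case: (eqVneq (p x).1 x) => [px|_]; first by rewrite eqxx -{1}px; case: (p x).
    by rewrite (negbTE pxr); case: (p x).
rewrite (exchange_big_dep (fun p => dtree [set: 'I_l] p)) /=; last by move=> r p _ /andP[].
rewrite [LHS](eq_bigl (fun p => dtree [set: 'I_l] p)); last by move=> p; rewrite inE.
apply: eq_bigr => p dp; rewrite dp /=.
have /dtreeP[_ _ [r [_ pr cr sr]]] := dp.
rewrite (big_pred1 r) // => r' /=; apply/eqP/eqP => [pr' | -> //].
by apply: fixed_reach_uniq pr' pr (connect0 _ _) (cr r' (in_setT r')).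
Qed.

(* A D-forest whose trees are permuted cyclically by the automorphism. *)
Definition dcycle (T : finType) (B : {set T}) (p : pairf T) : bool :=
  dforest B p && [exists r in B, (parent p r == r) &&
    [forall x in B, [exists y, fconnect (auto p) r y && fconnect (parent p) x y]]].

Lemma eq_in_fconnect (T : finType) (B : {set T}) (f g : T -> T) (x y : T) :
  {in B, forall z, f z \in B} -> {in B, f =1 g} -> x \in B ->
  fconnect f x y -> fconnect g x y.
Proof.
move=> fB fg xB /fconnect_iterP[k <-]; apply/fconnect_iterP; exists k.
suff [-> //] : iter k g x = iter k f x /\ iter k f x \in B.
by elim: k => //= k [-> kB]; rewrite fB // fg.
Qed.

(** A block collects the trees whose roots form one orbit of the automorphism. *)
Lemma dforest_partition (T : finType) (A : {set T}) (p : pairf T) :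
  dforest A p ->
  exists2 P : {set {set T}}, partition P A & [forall B in P, dcycle B (restr B p)].
Proof.
move=> fp; have /dforestP[/supportedP sp ep ap rp] := fp; have /equivariantP[inj com] := ep.
have /fin_all_exists[rt rtP] : forall x, exists y, [/\ parent p y = y,
    fconnect (parent p) x y & x \in A -> y \in A].
  move=> x; have [xA|xA] := boolP (x \in A).
    by have [y [yA py cy]] := rp x xA; exists y.
  by exists x; rewrite /parent sp // connect0.
have rtE x r : parent p r = r -> fconnect (parent p) x r -> rt x = r.
  by move=> pr cr; have [pt ct _] := rtP x; apply: fixed_reach_uniq pt pr ct cr.
have rt_parent x : rt (parent p x) = rt x.
  have [pt ct _] := rtP x; apply: rtE => //; have [/eqP px|px] := boolP (rt x == x).
    have ppx : parent p x = x by rewrite -[x in parent p x]px pt px.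
    by rewrite ppx px connect0.
  by move: ct; rewrite fconnect_eqVf eq_sym (negbTE px).
have rt_auto x : rt (auto p x) = auto p (rt x).
  have [pt /fconnect_iterP[k kE] _] := rtP x; apply: rtE; first by rewrite -com pt.
  apply/fconnect_iterP; exists k; rewrite -kE; elim: k {kE} => //= k ->.
  by rewrite com.
pose R x y := fconnect (auto p) (rt x) (rt y).
have eqR : {in A & &, equivalence_rel R}.
  move=> x y z _ _ _; split; rewrite /R ?connect0 // => xy.
  by apply: same_connect => //; exact: fconnect_sym.
have aA x : (auto p x \in A) = (x \in A).
  apply/idP/idP => [axA|xA]; apply: contraT => nA.
    by move: axA; rewrite /auto sp // (negbTE nA).
  have : auto p (auto p x) = auto p x by rewrite {1}/auto sp.
  by move/inj => ax; have := ap x xA; rewrite ax eqxx.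
exists (equivalence_partition R A); first exact: equivalence_partitionP.
apply/forall_inP => B /imsetP[x0 x0A BE].
have inB x : (x \in B) = (x \in A) && R x0 x by rewrite BE inE.
have BA x : x \in B -> x \in A by rewrite inB => /andP[].
have pB : {in B, forall y, parent p y \in B}.
  by move=> y; rewrite !inB /R rt_parent => /andP[/(dforest_parent fp) -> ->].
have aB y : (auto p y \in B) = (y \in B).
  rewrite !inB aA /R rt_auto; congr (_ && _); apply/idP/idP => c.
    apply: connect_trans c _; rewrite fconnect_sym //; exact: fconnect1.
  by apply: connect_trans c _; exact: fconnect1.
have pE : {in B, parent (restr B p) =1 parent p}.
  by move=> y yB; rewrite /parent ffunE yB.
have aE : {in B, auto (restr B p) =1 auto p}.
  by move=> y yB; rewrite /auto ffunE yB.
have rtB y : y \in B -> rt y \in B.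
  rewrite !inB => /andP[yA c]; have [pt _ tA] := rtP y.
  by rewrite tA // /R (rtE (rt y) (rt y)).
have cB y : y \in B -> fconnect (parent (restr B p)) y (rt y).
  move=> yB; have [_ ct _] := rtP y.
  by apply: (eq_in_fconnect pB) ct => // z zB; rewrite pE.
apply/andP; split.
  apply/dforestP; split.
  - by apply/supportedP => y yB; rewrite ffunE (negbTE yB).
  - exact: restr_equivariant.
  - by move=> y yB; rewrite aE // ap // BA.
  - move=> y yB; exists (rt y); rewrite pE rtB //; have [-> _ _] := rtP y; split=> //.
    exact: cB.
have x0B : x0 \in B by rewrite inB x0A /R connect0.
have rB := rtB _ x0B; apply/exists_inP; exists (rt x0) => //; rewrite pE //.
have [-> _ _] := rtP x0; rewrite eqxx /=; apply/forall_inP => y yB.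
apply/existsP; exists (rt y); rewrite cB // andbT.
apply: (@eq_in_fconnect _ B (auto p)) => //; first by move=> z; rewrite aB.
  by move=> z zB; rewrite aE.
by move: yB; rewrite inB => /andP[].
Qed.

(** As only an upper bound is wanted, it suffices that every forest is counted for at least one
    partition into cycles. *)
Lemma card_dforest_le (T : finType) (A : {set T}) :
  (#|[set p : pairf T | dforest A p]| <= \sum_(b < #|A|.+1)
    \sum_(P : {set {set T}} | partition P A && (#|P| == b))
     \prod_(B in P) #|[set p : pairf T | dcycle B p]|)%N.
Proof.
have -> : (\sum_(b < #|A|.+1) \sum_(P : {set {set T}} | partition P A && (#|P| == b))
     \prod_(B in P) #|[set p : pairf T | dcycle B p]| =
   \sum_(P : {set {set T}} | partition P A) \prod_(B in P) #|[set p : pairf T | dcycle B p]|)%N.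
  rewrite [RHS](partition_big (fun P : {set {set T}} => inord #|P| : 'I_#|A|.+1) predT) //=.
  apply: eq_bigr => b _; apply: eq_bigl => P; apply: andb_id2l => partP.
  rewrite -val_eqE /= inordK // ltnS (card_partition partP) -sum1_card.
  apply: leq_sum => B BP; rewrite card_gt0; exact: partition_neq0 partP BP.
rewrite (eq_bigr (fun P : {set {set T}} =>
    \sum_(p : pairf T | supported A p && [forall B in P, dcycle B (restr B p)]) 1)%N); last first.
  move=> P partP; rewrite -(card_blockwise (Phi := @dcycle T) partP) ?sum1dep_card //.
  by move=> B p /andP[/and4P[]].
rewrite -sum1_card (exchange_big_dep predT) //= [leqRHS](bigID (fun p => dforest A p)) /=.
apply: leq_trans (leq_addr _ _).
rewrite [leqLHS](eq_bigl (fun p => dforest A p)); last by move=> p; rewrite inE.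
apply: leq_sum => p fp; have [P partP dP] := dforest_partition fp.
have /and4P[sp _ _ _] := fp.
by rewrite (bigD1 P) /= ?partP ?sp.
Qed.

(* The automorphism of [p] permutes [i] copies of a tree cyclically: [c]
   enumerates the nodes of the first copy, which carries the tree [fs.1]; the
   [i]-th power of the automorphism induces [fs.2] on it, and [b] lists the
   nodes of all copies. *)
Definition cyclic_model (T : finType) (i j : nat) (p : pairf T) (c : 'I_j -> T)
    (fs : {ffun 'I_j -> 'I_j} * {perm 'I_j}) (b : 'I_j * 'I_i -> T) : Prop :=
  [/\ forall a u, b (a, u) = iter u (auto p) (c a),
      forall a, c (fs.2 a) = iter i (auto p) (c a) &
      forall a, c (fs.1 a) = parent p (c a)].

Lemma iter_auto_parent (T : finType) (p : pairf T) (u : nat) (x : T) :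
  equivariant p -> iter u (auto p) (parent p x) = parent p (iter u (auto p) x).
Proof. by case/equivariantP => _ com; elim: u => //= u ->; rewrite com. Qed.

(** Every node is an iterate of the automorphism on a node of the first copy. Its parent is
    transported from the first copy, and its image lies in the next one, so the model determines
    [p]. *)
Lemma cyclic_model_inj (T : finType) (i j : nat) (B : {set T}) (p p' : pairf T)
    (c c' : {ffun 'I_j -> T}) (fs : {ffun 'I_j -> 'I_j} * {perm 'I_j})
    (b : {ffun 'I_j * 'I_i -> T}) :
  (0 < i)%N -> (forall x, x \in B -> exists au, x = b au) ->
  supported B p -> supported B p' -> equivariant p -> equivariant p' ->
  cyclic_model p c fs b -> cyclic_model p' c' fs b -> (p, c) = (p', c').
Proof.
move=> i0 bB /supportedP sp /supportedP sp' ep ep' [m1 m2 m3] [m1' m2' m3'].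
have cE a : c a = c' a.
  by have := m1 a (Ordinal i0); rewrite m1'.
congr pair; last exact/ffunP.
apply/ffunP => x; have [xB|xB] := boolP (x \in B); last by rewrite sp ?sp'.
have [[a u] xE] := bB x xB.
suff : parent p x = parent p' x /\ auto p x = auto p' x.
  by rewrite /parent /auto; case: (p x) (p' x) => y z [y' z'] /= [-> ->].
have xE1 : x = iter u (auto p) (c a) by rewrite xE m1.
have xE2 : x = iter u (auto p') (c' a) by rewrite xE m1'.
split.
  rewrite {1}xE1 xE2 -!iter_auto_parent // -m3 -m3'.
  by rewrite -m1 -m1'.
rewrite {1}xE1 xE2 -!iterS.
have [ui|ui] := ltnP u.+1 i.
  by rewrite -(m1 a (Ordinal ui)) -(m1' a (Ordinal ui)).
(* After the last copy the automorphism returns to the first one, where [fs.2] describes it. *)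
have -> : u.+1 = i by apply/eqP; rewrite eqn_leq ui ltn_ord.
by rewrite -m2 -m2' cE.
Qed.

Lemma cyclic_model_fun (T : finType) (i j : nat) (p : pairf T)
    (c : {ffun 'I_j -> T}) (fs fs' : {ffun 'I_j -> 'I_j} * {perm 'I_j})
    (b b' : {ffun 'I_j * 'I_i -> T}) : injective c ->
  cyclic_model p c fs b -> cyclic_model p c fs' b' -> (fs, b) = (fs', b').
Proof.
case: fs fs' => [f s] [f' s'] inj [m1 m2 m3] [m1' m2' m3'] /=; congr (_, _, _).
- by apply/ffunP => a; apply: inj; rewrite m3 m3'.
- by apply/permP => a; apply: inj; rewrite m2 m2'.
- by apply/ffunP => -[a u]; rewrite m1 m1'.
Qed.

(** [r] is the root of one of the [i] trees; its orbit consists of the roots of all of them. *)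
Definition cycle_gen (T : finType) (B : {set T}) (i : nat) (p : pairf T) (r : T) : bool :=
  [&& r \in B, parent p r == r, fingraph.order (auto p) r == i &
    [forall x in B, [exists y, fconnect (auto p) r y && fconnect (parent p) x y]]].

(** [x] is pulled back by the power of the automorphism that moves [r] to the root of the tree of
    [x]. *)
Lemma cycle_gen_cover (T : finType) (B : {set T}) (i : nat) (p : pairf T) (r x : T) :
  dforest B p -> cycle_gen B i p r -> x \in B ->
  exists y u, [/\ (u < i)%N, y \in block p r & x = iter u (auto p) y].
Proof.
move=> /dforestP[_ ep _ _] /and4P[rB /eqP pr /eqP ri /forall_inP gen] xB.
have /equivariantP[inj com] := ep.
have /existsP[y /andP[ry /fconnect_iterP[k kE]]] := gen x xB.
have iterinj u : injective (iter u (auto p)) by elim: u => //= u IH z w /inj/IH.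
pose u := findex (auto p) r y.
have [g _ gK] := injF_bij (iterinj u).
exists (g x), u; split; last by rewrite gK.
  by rewrite -ri findex_max.
rewrite inE; apply/fconnect_iterP; exists k; apply: (iterinj u).
have -> z : iter u (auto p) (iter k (parent p) z) = iter k (parent p) (iter u (auto p) z).
  by elim: k {kE} => //= k <-; rewrite iter_auto_parent.
by rewrite gK kE iter_findex.
Qed.

(** The copies are told apart by their roots [iter u (auto p) r], which are distinct for [u < i]. *)
Lemma cycle_gen_uniq (T : finType) (B : {set T}) (i : nat) (p : pairf T) (r x y : T)
    (u v : nat) :
  dforest B p -> cycle_gen B i p r -> x \in block p r -> y \in block p r ->
  (u < i)%N -> (v < i)%N -> iter u (auto p) x = iter v (auto p) y -> u = v /\ x = y.
Proof.
move=> /dforestP[_ ep _ _] /and4P[rB /eqP pr /eqP ri _]; rewrite !inE.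
have /equivariantP[inj com] := ep => cx cy ui vi E.
have iterinj w : injective (iter w (auto p)) by elim: w => //= w IH z z' /inj/IH.
have reach w z : fconnect (parent p) z r ->
    fconnect (parent p) (iter w (auto p) z) (iter w (auto p) r).
  case/fconnect_iterP => k kE; apply/fconnect_iterP; exists k; rewrite -kE.
  by elim: k {kE} => //= k ->; rewrite iter_auto_parent.
have fix_ w : parent p (iter w (auto p) r) = iter w (auto p) r.
  by rewrite -iter_auto_parent // pr.
have := reach v y cy; rewrite -E => cv.
have := fixed_reach_uniq (fix_ u) (fix_ v) (reach u x cx) cv => rE.
have fidx w : (w < i)%N -> findex (auto p) r (iter w (auto p) r) = w.
  by move=> wi; rewrite findex_iter ?ri.
have uv : u = v by rewrite -(fidx u ui) -(fidx v vi) rE.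
by split=> //; apply: (iterinj v); rewrite -{1}uv.
Qed.

Lemma block_subset (T : finType) (B : {set T}) (p : pairf T) (r : T) :
  supported B p -> r \in B -> block p r \subset B.
Proof.
move=> /supportedP sp rB; apply/subsetP => x; rewrite inE => cx.
have [//|xB] := boolP (x \in B).
have px : parent p x = x by rewrite /parent sp.
by rewrite -(fconnect_fixed px cx) rB in xB *.
Qed.

Lemma iter_auto_in (T : finType) (B : {set T}) (p : pairf T) (u : nat) (x : T) :
  dforest B p -> x \in B -> iter u (auto p) x \in B.
Proof.
move=> /dforestP[/supportedP sp /equivariantP[inj _] ap _] xB; elim: u => //= u IH.
have [//|aB] := boolP (auto p (iter u (auto p) x) \in B).
have : auto p (auto p (iter u (auto p) x)) = auto p (iter u (auto p) x).
  by rewrite {1}/auto sp.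
by move/inj => E; have := ap _ IH; rewrite E eqxx.
Qed.

Lemma cycle_gen_card (T : finType) (B : {set T}) (i : nat) (p : pairf T) (r : T) :
  dforest B p -> cycle_gen B i p r -> #|B| = (#|block p r| * i)%N.
Proof.
move=> fp gr; have /dforestP[sp _ _ _] := fp; have /and4P[rB _ _ _] := gr.
rewrite -[i in RHS]card_ord -[#|'I_i|]cardsT -cardsX.
have inj : {in setX (block p r) [set: 'I_i] &,
    injective (fun yu : T * 'I_i => iter yu.2 (auto p) yu.1)}.
  move=> [y u] [z v] /setXP[yb _] /setXP[zb _] /= E.
  have [uv ->] := cycle_gen_uniq fp gr yb zb (ltn_ord u) (ltn_ord v) E.
  by congr pair; apply: val_inj.
rewrite -(card_in_imset inj); apply: eq_card => x; apply/idP/imsetP.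
  move=> xB; have [y [u [ui yb ->]]] := cycle_gen_cover fp gr xB.
  by exists (y, Ordinal ui); rewrite // !inE in yb *; rewrite yb.
move=> [[y u] /setXP[yb _] ->]; apply: iter_auto_in fp _.
exact: subsetP (block_subset sp rB) _ yb.
Qed.

Lemma cyclic_model_exists (T : finType) (B : {set T}) (i j : nat) (p : pairf T)
    (r : T) (c : {ffun 'I_j -> T}) :
  dforest B p -> cycle_gen B i p r -> injective c -> (forall a, c a \in block p r) ->
  #|block p r| = j ->
  exists2 y : ({ffun 'I_j -> 'I_j} * {perm 'I_j}) * {ffun 'I_j * 'I_i -> T},
    y \in setX (marked_trees j predT)
      [set b : {ffun 'I_j * 'I_i -> T} in ffun_on (mem B) | injectiveb b] &
    cyclic_model p c y.1 y.2.
Proof.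
move=> fp gr injc cb bj; have /dforestP[sp ep _ _] := fp.
have /and4P[rB /eqP pr /eqP ri _] := gr; have /equivariantP[inj com] := ep.
have bE : block p r = c @: 'I_j.
  apply/esym/eqP; rewrite eqEcard card_imset // card_ord bj leqnn andbT.
  by apply/subsetP => _ /imsetP[a _ ->].
have csurj x : x \in block p r -> exists a, c a = x.
  by rewrite bE => /imsetP[a _ ->]; exists a.
have iterinj w : injective (iter w (auto p)) by elim: w => //= w IH z z' /inj/IH.
have ir : iter i (auto p) r = r by rewrite -ri iter_order.
have /fin_all_exists[f fE] : forall a, exists a', c a' = parent p (c a).
  move=> a; apply: csurj; have := cb a; rewrite !inE fconnect_eqVf.
  by case/orP => [/eqP -> | //]; rewrite pr connect0.
have reachi k z : iter k (parent p) z = r -> iter k (parent p) (iter i (auto p) z) = r.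
  move=> kE; rewrite -[RHS]ir -kE; elim: k {kE} => //= k ->.
  by rewrite iter_auto_parent.
have /fin_all_exists[s sE] : forall a, exists a', c a' = iter i (auto p) (c a).
  move=> a; apply: csurj; have := cb a; rewrite !inE => /fconnect_iterP[k kE].
  by apply/fconnect_iterP; exists k; apply: reachi.
have sinj : injective s.
  by move=> a a' E; apply: injc; apply: (iterinj i); rewrite -!sE E.
pose b := [ffun au : 'I_j * 'I_i => iter au.2 (auto p) (c au.1)].
exists (([ffun a => f a], perm sinj), b); last first.
  by split=> [a u|a|a] /=; rewrite ?ffunE ?permE.
rewrite in_setX /=; apply/andP; split.
  rewrite in_set /=; apply/and3P; split.
  - have [a0 a0E] : exists a, c a = r by apply: csurj; rewrite inE connect0.
    apply/rooted_treesP; exists a0; first by apply: injc; rewrite ffunE fE a0E pr.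
    move=> a; have := cb a; rewrite inE => /fconnect_iterP[k kE].
    apply/fconnect_iterP; exists k; apply: injc; rewrite a0E -kE.
    by elim: k {kE} => //= k IH; rewrite ffunE fE IH.
  - apply/tree_autP => a; apply: injc.
    by rewrite !permE !ffunE sE fE iter_auto_parent // -sE -fE.
  - by apply/forall_inP.
rewrite in_set; apply/andP; split.
  apply/ffun_onP => -[a u]; rewrite ffunE; apply: iter_auto_in fp _.
  exact: subsetP (block_subset sp rB) _ (cb a).
apply/injectiveP => -[a u] [a' u']; rewrite !ffunE /= => E.
have [uu /injc ->] := cycle_gen_uniq fp gr (cb a) (cb a') (ltn_ord u) (ltn_ord u') E.
by congr pair; apply: val_inj.
Qed.

(** Double counting of cycles [p] with an enumeration [c] of one copy. Each cycle has at least j!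
    enumerations. A pair is determined by its model, a tree of size [j] with an automorphism and a
    bijection [b] onto [B], and the number of models is j! times [polya_count j] times the factorial
    of [#|B|]. *)
Lemma card_cycle_gen_le (T : finType) (B : {set T}) (i j : nat) :
  (0 < i)%N -> #|B| = (j * i)%N ->
  (#|[set p : pairf T | dforest B p & [exists r, cycle_gen B i p r]]| <=
   #|B|`! * polya_count j)%N.
Proof.
move=> i0 Bij; set Y := [set p | _].
pose cs p := [set c : {ffun 'I_j -> T} |
  [exists r, [&& cycle_gen B i p r, injectiveb c & [forall a, c a \in block p r]]]].
pose X := [set pc : pairf T * {ffun 'I_j -> T} | pc.1 \in Y & pc.2 \in cs pc.1].
pose Z := setX (marked_trees j predT)
  [set b : {ffun 'I_j * 'I_i -> T} in ffun_on (mem B) | injectiveb b].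
have blkj p r : dforest B p -> cycle_gen B i p r -> #|block p r| = j.
  move=> fp /(cycle_gen_card fp)/eqP; rewrite Bij eqn_pmul2r // => /eqP; done.
have XZ : (#|X| <= #|Z|)%N.
  apply: (@leq_card_rel _ _ (mem X) (mem Z) (fun pc y =>
    cyclic_model pc.1 pc.2 y.1 y.2 /\ (forall x, x \in B -> exists au, x = y.2 au))).
    move=> [p c]; rewrite in_set /= !in_set => /andP[/andP[fp _] /existsP[r /and3P[gr injc cb]]].
    have cbP : forall a, c a \in block p r by apply/forallP.
    have [y yZ my] := cyclic_model_exists fp gr (injectiveP _ injc) cbP (blkj _ _ fp gr).
    exists y => //; split=> // x xB; have [m1 _ _] := my.
    have [z [u [ui zb ->]]] := cycle_gen_cover fp gr xB.
    have zE : z \in c @: 'I_j.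
      suff <- : block p r = c @: 'I_j by [].
      apply/esym/eqP; rewrite eqEcard card_imset; last exact/injectiveP.
      rewrite card_ord (blkj _ _ fp gr) leqnn andbT.
      by apply/subsetP => _ /imsetP[a _ ->].
    by case/imsetP: zE => a _ ->; exists (a, Ordinal ui); rewrite m1.
  move=> [p c] [p' c'] [fs b]; rewrite !in_set /=.
  move=> /andP[/andP[/and4P[sp ep _ _] _] _] /andP[/andP[/and4P[sp' ep' _ _] _] _].
  move=> [m cov] [m' _]; exact: cyclic_model_inj i0 cov sp sp' ep ep' m m'.
have cZ : #|Z| = (j`! * polya_count j * #|B|`!)%N.
  rewrite cardsX card_all_marked; congr (_ * _)%N.
  by rewrite card_inj_ffuns_on card_prod !card_ord -Bij ffactnn.
have cX : (#|Y| * j`! <= #|X|)%N.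
  have -> : #|X| = (\sum_(p in Y) #|cs p|)%N.
    rewrite -sum1_card (eq_bigl (fun pc : pairf T * {ffun 'I_j -> T} =>
      (pc.1 \in Y) && (pc.2 \in cs pc.1))); last by move=> pc; rewrite [LHS]in_set.
    rewrite -(pair_big_dep (mem Y) (fun p c => c \in cs p) (fun _ _ => 1%N)) /=.
    by apply: eq_bigr => p _; rewrite sum1_card.
  rewrite -sum_nat_const; apply: leq_sum => p; rewrite in_set => /andP[fp /existsP[r gr]].
  have -> : j`! = #|[set c : {ffun 'I_j -> T} in ffun_on (mem (block p r)) | injectiveb c]|.
    by rewrite card_inj_ffuns_on (blkj _ _ fp gr) card_ord ffactnn.
  apply: subset_leq_card; apply/subsetP => c; rewrite !in_set => /andP[/ffun_onP cb injc].
  by apply/existsP; exists r; rewrite gr injc; apply/forallP.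
rewrite -(leq_pmul2r (fact_gt0 j)); apply: leq_trans cX _; apply: leq_trans XZ _.
by rewrite cZ mulnAC [(j`! * _)%N]mulnC mulnAC.
Qed.

Lemma card_bigcup_le (I T : finType) (P : pred I) (Y : I -> {set T}) :
  (#|\bigcup_(i | P i) Y i| <= \sum_(i | P i) #|Y i|)%N.
Proof.
elim/big_rec2: _ => [|i n A _ IH]; first by rewrite cards0.
apply: leq_trans (leq_card_setU _ _) _; exact: leq_add.
Qed.

(** The length of the cycle is the length of the orbit of a root: it divides [#|B|], and it exceeds
    1 because the automorphism moves every node. *)
Lemma card_dcycle_le (T : finType) (B : {set T}) :
  (#|[set p : pairf T | dcycle B p]| <= #|B|`! *
   \sum_(i < #|B|.+1 | (1 < i)%N && (i %| #|B|)%N) polya_count (#|B| %/ i))%N.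
Proof.
pose Y i := [set p : pairf T | dforest B p & [exists r, cycle_gen B i p r]].
apply: (@leq_trans #|\bigcup_(i < #|B|.+1 | (1 < i)%N && (i %| #|B|)%N) Y i|); last first.
  apply: leq_trans (card_bigcup_le _ _) _; rewrite big_distrr /=.
  apply: leq_sum => i /andP[i1 iB]; apply: card_cycle_gen_le; first exact: ltnW.
  by rewrite divnK.
apply: subset_leq_card; apply/subsetP => p; rewrite in_set.
case/andP => fp /exists_inP[r rB /andP[pr gen]].
have gr : cycle_gen B (fingraph.order (auto p) r) p r by rewrite /cycle_gen rB pr eqxx.
have /dforestP[_ /equivariantP[inj _] ap _] := fp.
have cB := cycle_gen_card fp gr.
have iB : (fingraph.order (auto p) r < #|B|.+1)%N.
  by rewrite ltnS cB leq_pmull //; apply/card_gt0P; exists r; rewrite inE.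
apply/bigcupP; exists (Ordinal iB) => /=; last first.
  by rewrite in_set fp; apply/existsP; exists r.
rewrite cB dvdn_mull // andbT ltn_neqAle fingraph.order_gt0 andbT.
apply: contraTneq (ap r rB) => o1.
by rewrite negbK -[X in X == _]/(iter 1 (auto p) r) o1 iter_order.
Qed.

(** * Lower bound from pairs of exchanged trees *)

Lemma swap_model_exists (T : finType) (B : {set T}) (j : nat)
    (fs : {ffun 'I_j -> 'I_j} * {perm 'I_j}) (b : {ffun 'I_j * 'I_2 -> T}) :
  fs \in marked_trees j predT -> injective b -> (forall au, b au \in B) ->
  (forall x, x \in B -> exists au, x = b au) ->
  exists2 p, dforest B p & cyclic_model p (fun a => b (a, ord0)) fs b.
Proof.
case: fs => f s; rewrite in_set /= => /and3P[/rooted_treesP[r fr cr] /tree_autP com _].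
(* The automorphism carries the first copy identically to the second and returns through [s], so
   that its square induces [s] on the first copy. *)
move=> inj bB Bb; pose p : pairf T := [ffun x => match [pick au | b au == x] with
  | Some (a, u) => (b (f a, u), if u == ord0 then b (a, ord_max) else b (s a, ord0))
  | None => (x, x) end].
have pE a u : p (b (a, u)) =
    (b (f a, u), if u == ord0 then b (a, ord_max) else b (s a, ord0)).
  rewrite ffunE; case: pickP => [[a' u'] /eqP/inj[-> ->] //|].
  by move/(_ (a, u)); rewrite eqxx.
have parE a u : parent p (b (a, u)) = b (f a, u) by rewrite /parent pE.
have aut0 a : auto p (b (a, ord0)) = b (a, ord_max) by rewrite /auto pE eqxx.
have aut1 a : auto p (b (a, ord_max)) = b (s a, ord0) by rewrite /auto pE.
have supp x : x \notin B -> p x = (x, x).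
  move=> xB; rewrite ffunE; case: pickP => // au /eqP bx.
  by rewrite -bx bB in xB.
have u01 (u : 'I_2) : u = ord0 \/ u = ord_max.
  by case: u => -[|[|//]] lu; [left | right]; apply: val_inj.
have autB x : x \in B -> auto p x \in B.
  by move=> /Bb[[a u] ->]; case: (u01 u) => ->; rewrite ?aut0 ?aut1.
exists p; last first.
  split=> [a u|a|a] /=; rewrite ?aut0 ?aut1 ?parE //.
  by case: (u01 u) => -> /=; rewrite ?aut0.
apply/dforestP; split.
- exact/supportedP.
- apply/equivariantP; split.
    move=> x y; have [xB|xB] := boolP (x \in B); have [yB|yB] := boolP (y \in B); first last.
    + by rewrite /auto !supp.
    + by move=> E; have := autB y yB; rewrite -E /auto supp // (negbTE xB).
    + by move=> E; have := autB x xB; rewrite E /auto supp // (negbTE yB).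
    have [[a u] ->] := Bb x xB; have [[a' u'] ->] := Bb y yB.
    case: (u01 u) => ->; case: (u01 u') => ->; rewrite ?aut0 ?aut1 => /inj // -[].
    + by move=> ->.
    + by move/perm_inj => ->.
  move=> x; have [/Bb[[a u] ->]|xB] := boolP (x \in B); last by rewrite /auto /parent !supp ?supp.
  by case: (u01 u) => ->; rewrite !parE ?aut0 ?aut1 parE // com.
- move=> x /Bb[[a u] ->]; case: (u01 u) => ->; rewrite ?aut0 ?aut1;
    by apply/negP => /eqP/inj.
- move=> x /Bb[[a u] ->]; exists (b (r, u)); split; rewrite ?bB ?parE ?fr //.
  have /fconnect_iterP[k kE] := cr a; apply/fconnect_iterP; exists k.
  by rewrite -kE; elim: k {kE} => //= k ->; rewrite parE.
Qed.

(** Compared with a reference model [b0], an enumeration picks one of the two copies and permutes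
    its nodes. It cannot mix the copies, since parents stay within a copy and all nodes lead to one
    root. *)
Lemma swap_model_count (T : finType) (B : {set T}) (j : nat) (p : pairf T) :
  #|B| = (2 * j)%N ->
  (#|[set c : {ffun 'I_j -> T} | [exists y : ({ffun 'I_j -> 'I_j} * {perm 'I_j}) *
      {ffun 'I_j * 'I_2 -> T}, [&& y.1 \in marked_trees j predT, injectiveb y.2,
      [forall au, y.2 au \in B] & [forall a, (c a == y.2 (a, ord0)) &&
        (c (y.1.1 a) == parent p (c a))] &&
        [forall a, forall u, y.2 (y.1.1 a, u) == parent p (y.2 (a, u))]]]]| <= 2 * j`!)%N.
Proof.
move=> Bj; set cs := [set c | _].
have [->|[c0]] := set_0Vmem cs; first by rewrite cards0.
rewrite in_set => /existsP[[[f0 s0] b0] /= /and4P[fs0 /injectiveP inj0 /forallP bB0]].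
case/andP => _ /forallP par0.
have Bb x : x \in B -> exists au, x = b0 au.
  have <- : b0 @: predT = B.
    apply/eqP; rewrite eqEcard card_imset // Bj card_prod !card_ord mulnC leqnn andbT.
    by apply/subsetP => _ /imsetP[au _ ->].
  by case/imsetP => au _ ->; exists au.
pose F (ut : 'I_2 * {perm 'I_j}) : {ffun 'I_j -> T} := [ffun a => b0 (ut.2 a, ut.1)].
have -> : (2 * j`!)%N = #|[set: 'I_2 * {perm 'I_j}]|.
  by rewrite cardsT card_prod card_ord -card_Sn; congr (_ * _)%N; apply: eq_card => s; rewrite inE.
apply: leq_trans (leq_imset_card F _); apply: subset_leq_card; apply/subsetP => c.
rewrite in_set => /existsP[[[f s] b] /= /and4P[fs /injectiveP inj /forallP bB]].
case/andP => /forallP cE /forallP par.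
have cb a : c a = b (a, ord0) by have /andP[/eqP] := cE a.
have cf a : c (f a) = parent p (c a) by have /andP[_ /eqP] := cE a.
have injc : injective c by move=> a a'; rewrite !cb => /inj[].
move: fs; rewrite in_set => /and3P[/rooted_treesP[/= r fr cr] _ _].
have /fin_all_exists[q qE] : forall a, exists au, c a = b0 au by move=> a; apply: Bb; rewrite cb.
have qf a : (q (f a)).2 = (q a).2.
  have := cf a; rewrite !qE; case: (q a) => a' u; rewrite -(eqP (forallP (par0 a') u)).
  by move/inj0 => ->.
have qr a : (q a).2 = (q r).2.
  have /fconnect_iterP[k <-] := cr a.
  by elim: k => //= k ->; rewrite qf.
have qinj : injective (fun a => (q a).1).
  move=> a a' E; apply: injc; rewrite !qE; congr (b0 _).
  by move: E (qr a) (qr a'); case: (q a) (q a') => x u [x' u'] /= -> -> ->.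
apply/imsetP; exists ((q r).2, perm qinj); first by rewrite inE.
apply/ffunP => a; rewrite ffunE permE /= qE -(qr a).
by case: (q a).
Qed.

(** Double counting in the other direction: a model yields a forest with an enumeration, from which
    it can be recovered, and a forest has at most 2 j! enumerations. *)
Lemma card_dforest_ge (T : finType) (B : {set T}) (j : nat) :
  #|B| = (2 * j)%N ->
  ((2 * j)`! * polya_count j <= #|[set p : pairf T | dforest B p]| * 2)%N.
Proof.
move=> Bj.
pose cs p := [set c : {ffun 'I_j -> T} | [exists y : ({ffun 'I_j -> 'I_j} * {perm 'I_j}) *
      {ffun 'I_j * 'I_2 -> T}, [&& y.1 \in marked_trees j predT, injectiveb y.2,
      [forall au, y.2 au \in B] & [forall a, (c a == y.2 (a, ord0)) &&
        (c (y.1.1 a) == parent p (c a))] &&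
        [forall a, forall u, y.2 (y.1.1 a, u) == parent p (y.2 (a, u))]]]].
pose X := [set pc : pairf T * {ffun 'I_j -> T} | dforest B pc.1 & pc.2 \in cs pc.1].
pose Z := setX (marked_trees j predT)
  [set b : {ffun 'I_j * 'I_2 -> T} in ffun_on (mem B) | injectiveb b].
have cZ : #|Z| = (j`! * polya_count j * (2 * j)`!)%N.
  rewrite cardsX card_all_marked; congr (_ * _)%N.
  by rewrite card_inj_ffuns_on card_prod !card_ord mulnC Bj ffactnn.
have cX : (#|X| <= #|[set p : pairf T | dforest B p]| * (2 * j`!))%N.
  have -> : #|X| = (\sum_(p in [set p : pairf T | dforest B p]) #|cs p|)%N.
    rewrite -sum1_card (eq_bigl (fun pc : pairf T * {ffun 'I_j -> T} =>
      (pc.1 \in [set p : pairf T | dforest B p]) && (pc.2 \in cs pc.1))); last first.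
      by move=> pc; rewrite [LHS]in_set; congr (_ && _); rewrite [RHS]in_set.
    rewrite -(pair_big_dep (mem [set p : pairf T | dforest B p])
      (fun p c => c \in cs p) (fun _ _ => 1%N)) /=.
    by apply: eq_bigr => p _; rewrite sum1_card.
  rewrite -sum_nat_const; apply: leq_sum => p _; exact: swap_model_count.
have ZX : (#|Z| <= #|X|)%N.
  apply: (@leq_card_rel _ _ (mem Z) (mem X) (fun y pc =>
     injective pc.2 /\ cyclic_model pc.1 pc.2 y.1 y.2)).
    move=> [fs b]; move=> /setXP[/= fsT].
    rewrite in_set => /andP[/ffun_onP bB /injectiveP inj].
    have Bb x : x \in B -> exists au, x = b au.
      have <- : b @: predT = B.
        apply/eqP; rewrite eqEcard card_imset // Bj card_prod !card_ord mulnC leqnn andbT.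
        by apply/subsetP => _ /imsetP[au _ ->]; apply: bB.
      by case/imsetP => au _ ->; exists au.
    have [p fp [m1 m2 m3]] := swap_model_exists fsT inj bB Bb.
    exists (p, [ffun a => b (a, ord0)]); last first.
      split; first by move=> a a'; rewrite !ffunE => /inj[].
      by split=> [a u|a|a] /=; rewrite !ffunE; [exact: m1 | exact: m2 | exact: m3].
    rewrite inE /= fp in_set; apply/existsP; exists (fs, b).
    apply/and4P; split=> //=; first exact/injectiveP; first exact/forallP.
    apply/andP; split; apply/forallP => a; first by rewrite !ffunE eqxx m3 /=.
    have /dforestP[_ ep _ _] := fp.
    by apply/forallP => u; rewrite (m1 (fs.1 a) u) (m1 a u) m3 iter_auto_parent.
  move=> [fs b] [fs' b'] [p c] _ _ /= [injc m] [_ m'].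
  exact (cyclic_model_fun injc m m').
have : (j`! * ((2 * j)`! * polya_count j) <= j`! * (#|[set p | dforest B p]| * 2))%N.
  apply: (@leq_trans #|Z|); first by rewrite cZ -mulnA [(polya_count j * _)%N]mulnC.
  apply: leq_trans ZX _; apply: leq_trans cX _.
  by rewrite mulnA [leqRHS]mulnC.
by rewrite leq_pmul2l // fact_gt0.
Qed.

Lemma dtree_count_ge (j : nat) :
  ((2 * j).+1`! * polya_count j <= dtree_count (2 * j).+1 * 2)%N.
Proof.
rewrite dtree_count_dforest big_distrl /= factS -mulnA -[X in (X * _ <= _)%N]card_ord.
rewrite -sum_nat_const; apply: leq_sum => r _; apply: card_dforest_ge.
by rewrite cardsC1 card_ord.
Qed.

(* The term [i] accounts for [i] isomorphic trees of size [l %/ i] permuted cyclically;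
   the exact count has an additional factor [1 / i]. *)
Definition cycle_bound (l : nat) : nat :=
  (l`! * \sum_(i < l.+1 | (1 < i)%N && (i %| l)%N) polya_count (l %/ i))%N.

(** The [k.+1] choices of the root turn k! into (k+1)!. What remains is a coefficient of the
    exponential of the generating function of cycles. *)
Lemma dtree_count_le (R : numFieldType) (k N : nat) : (k <= N)%N ->
  (dtree_count k.+1)%:R / k.+1`!%:R <=
  \sum_(b < k.+1) (egf N (fun l => (cycle_bound l)%:R : R) ^+ b)`_k / b`!%:R.
Proof.
move=> kN; have fact_neq0 n : (n`!%:R : R) != 0 by rewrite pnatr_eq0 -lt0n fact_gt0.
have fact_pos n : 0 < (n`!%:R : R) by rewrite ltr0n fact_gt0.
rewrite ler_pdivrMr // dtree_count_dforest natr_sum.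
apply: (@le_trans _ _ (\sum_(r < k.+1) k`!%:R *
  (\sum_(b < k.+1) (egf N (fun l => (cycle_bound l)%:R : R) ^+ b)`_k / b`!%:R))); last first.
  by rewrite sumr_const card_ord -[leLHS]mulr_natl mulrA -natrM -factS mulrC.
apply: ler_sum => r _; have cr : #|[set~ r]| = k by rewrite cardsC1 card_ord.
have := card_dforest_le [set~ r]; rewrite cr -(ler_nat R) => /le_trans; apply.
rewrite natr_sum mulr_sumr; apply: ler_sum => b _; rewrite natr_sum.
have := @block_sumE R _ (fun l => (cycle_bound l)%:R) b N [set~ r].
rewrite cr /block_sum => /(_ kN) E.
have -> : k`!%:R * ((egf N (fun l => (cycle_bound l)%:R : R) ^+ b)`_k / b`!%:R) =
  k`!%:R / b`!%:R * (egf N (fun l => (cycle_bound l)%:R : R) ^+ b)`_k.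
  by rewrite mulrA mulrAC.
rewrite -E; apply: ler_sum => P _; rewrite natr_prod.
apply: ler_prod => B _; rewrite ler0n ler_nat; exact: card_dcycle_le.
Qed.

From mathcomp Require Import all_classical all_reals all_analysis.
Import numFieldNormedType.Exports.

(** * Coefficients of the tree function *)

Definition trunc (R : numFieldType) (q : nat -> R) (N : nat) : {poly R} :=
  \poly_(l < N.+1) q l.

Lemma coef_trunc (R : numFieldType) (q : nat -> R) (N l : nat) :
  (trunc q N)`_l = if (l <= N)%N then q l else 0.
Proof. by rewrite coef_poly ltnS. Qed.

Lemma trunc_ge0 (R : numFieldType) (q : nat -> R) (N l : nat) :
  (forall i, 0 <= q i) -> 0 <= (trunc q N)`_l.
Proof. by move=> q0; rewrite coef_trunc; case: ifP. Qed.

Lemma coef_exp_eq (R : numFieldType) (p p' : {poly R}) (n m : nat) :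
  (forall i, (i <= n)%N -> p`_i = p'`_i) ->
  forall i, (i <= n)%N -> (p ^+ m)`_i = (p' ^+ m)`_i.
Proof.
move=> pp'; elim: m => [|m IH] i iN; first by rewrite !expr0.
rewrite !exprS !coefM; apply: eq_bigr => j _; rewrite pp' ?IH //.
  by rewrite (leq_trans (leq_subr _ _)).
by rewrite (leq_trans _ iN) // -ltnS.
Qed.

Lemma coef_exp_ge0 (R : numFieldType) (p : {poly R}) (n m : nat) :
  (forall i, 0 <= p`_i) -> 0 <= (p ^+ m)`_n.
Proof.
move=> p0; elim: m n => [|m IH] n; first by rewrite expr0 coef1; case: eqP.
by rewrite exprS coefM; apply: sumr_ge0 => j _; rewrite mulr_ge0.
Qed.

Lemma coef_mul_ge0 (R : numFieldType) (p p' : {poly R}) (n : nat) :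
  (forall i, 0 <= p`_i) -> (forall i, 0 <= p'`_i) -> 0 <= (p * p')`_n.
Proof. by move=> p0 p0'; rewrite coefM; apply: sumr_ge0 => j _; rewrite mulr_ge0. Qed.

Lemma coef_exp_le (R : numFieldType) (p p' : {poly R}) (n m : nat) :
  (forall i, 0 <= p`_i <= p'`_i) -> (p ^+ m)`_n <= (p' ^+ m)`_n.
Proof.
move=> pp'; have p0 i : 0 <= p`_i by have /andP[] := pp' i.
elim: m n => [|m IH] n; first by rewrite !expr0.
rewrite !exprS !coefM; apply: ler_sum => j _; apply: ler_pM => //.
  exact: coef_exp_ge0.
by have /andP[] := pp' j.
Qed.

Lemma coef_exp_small (R : numFieldType) (p : {poly R}) (n m : nat) :
  p`_0 = 0 -> (n < m)%N -> (p ^+ m)`_n = 0.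
Proof.
move=> p0; elim: m n => // m IH n nm; rewrite exprS coefM.
rewrite big1 // => -[[|j] jn] _ /=; first by rewrite p0 mul0r.
rewrite IH ?mulr0 //; rewrite ltnS in jn; rewrite ltnS in nm.
by apply: leq_trans nm; rewrite ltn_subrL (leq_trans _ jn).
Qed.

Lemma sum_coef_le_horner (R : realType) (p : {poly R}) (K : nat) (x : R) :
  (forall i, 0 <= p`_i) -> 0 <= x -> \sum_(n < K) p`_n * x ^+ n <= p.[x].
Proof.
move=> p0 x0; rewrite (@horner_coef_wide _ (maxn K (size p)) p); last exact: leq_maxr.
rewrite -!(big_mkord xpredT (fun n => p`_n * x ^+ n)).
rewrite [leRHS](big_cat_nat (leq0n _) (leq_maxl K (size p))) /= lerDl.
by apply: sumr_ge0 => i _; rewrite mulr_ge0 ?exprn_ge0.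
Qed.

Lemma coef_le_horner (R : realType) (p : {poly R}) (n : nat) (x : R) :
  (forall i, 0 <= p`_i) -> 0 <= x -> p`_n * x ^+ n <= p.[x].
Proof.
move=> p0 x0; apply: le_trans (sum_coef_le_horner n.+1 p0 x0).
by rewrite big_ord_recr /= lerDr; apply: sumr_ge0 => i _; rewrite mulr_ge0 ?exprn_ge0.
Qed.

(** At [m = 0] the expression [m ^ m.-1] would be 1, so the value 0 is imposed. *)
Definition tau (R : numFieldType) (m : nat) : R :=
  if m == 0%N then 0 else (m ^ m.-1)%:R / m`!%:R.

(* The coefficient of [z ^ n] in [sum_m tau_m Q(z) ^ m], where [Q = sum_l q_l z ^ l]. *)
Definition tree_coef (R : numFieldType) (q : nat -> R) (n : nat) : R :=
  \sum_(m < n.+1) tau R m * (trunc q n ^+ m)`_n.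

Lemma tau_ge0 (R : numFieldType) (m : nat) : 0 <= tau R m.
Proof. by rewrite /tau; case: ifP => // _; rewrite divr_ge0. Qed.

Lemma tree_coefE (R : numFieldType) (q : nat -> R) (n N : nat) :
  q 0%N = 0 -> (n <= N)%N ->
  tree_coef q n = \sum_(m < N.+1) tau R m * (trunc q N ^+ m)`_n.
Proof.
move=> q0 nN; rewrite /tree_coef.
rewrite -!(big_mkord xpredT (fun m => tau R m * (trunc q _ ^+ m)`_n)).
rewrite [RHS](@big_cat_nat _ _ _ n.+1) //= [X in _ = _ + X]big1_seq ?addr0; last first.
  move=> m /andP[_]; rewrite mem_index_iota => /andP[nm _].
  by rewrite coef_exp_small ?mulr0 // coef_trunc.
rewrite !big_nat; apply: eq_bigr => m _; congr (_ * _).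
apply: (coef_exp_eq (n := n)) => // i iN.
by rewrite !coef_trunc iN (leq_trans iN).
Qed.

Lemma tree_coef_ge0 (R : numFieldType) (q : nat -> R) (n : nat) :
  (forall i, 0 <= q i) -> 0 <= tree_coef q n.
Proof.
move=> q0; apply: sumr_ge0 => m _; rewrite mulr_ge0 ?tau_ge0 //.
by apply: coef_exp_ge0 => i; apply: trunc_ge0.
Qed.

(* [stirling m / m] is the weight of a C-tree of size [m] at the singularity, see
   [tau_stirling]. *)
Definition stirling (R : realType) (m : nat) : R :=
  (m ^ m)%:R / (m`!%:R * expR 1 ^+ m).

Lemma stirling_gt0 (R : realType) (m : nat) : (0 < m)%N -> 0 < stirling R m.
Proof.
by move=> m0; rewrite divr_gt0 // ?mulr_gt0 ?exprn_gt0 ?expR_gt0 ?ltr0n ?fact_gt0 ?expn_gt0 ?m0.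
Qed.

Lemma tau_stirling (R : realType) (m : nat) : (0 < m)%N ->
  tau R m = stirling R m / m%:R * expR 1 ^+ m.
Proof.
move=> m0; rewrite /tau /stirling eqn0Ngt m0 /=.
have e0 : expR 1 ^+ m != 0 :> R by rewrite lt0r_neq0 // exprn_gt0 ?expR_gt0.
have f0 : m`!%:R != 0 :> R by rewrite pnatr_eq0 -lt0n fact_gt0.
have mn0 : m%:R != 0 :> R by rewrite pnatr_eq0 -lt0n.
have -> : ((m ^ m)%:R : R) = m%:R * (m ^ m.-1)%:R by rewrite -natrM -expnS prednK.
by field; rewrite e0 f0 mn0.
Qed.

Lemma stirlingS (R : realType) (m : nat) : (0 < m)%N ->
  stirling R m.+1 = stirling R m * ((1 + m%:R^-1) ^+ m / expR 1).
Proof.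
move=> m0; rewrite /stirling.
have e0 : expR 1 ^+ m != 0 :> R by rewrite lt0r_neq0 // exprn_gt0 ?expR_gt0.
have e1 : expR 1 != 0 :> R by rewrite lt0r_neq0 // expR_gt0.
have f0 : m`!%:R != 0 :> R by rewrite pnatr_eq0 -lt0n fact_gt0.
have mn0 : m%:R != 0 :> R by rewrite pnatr_eq0 -lt0n.
have mn1 : m.+1%:R != 0 :> R by rewrite pnatr_eq0.
have -> : 1 + m%:R^-1 = m.+1%:R / m%:R :> R by rewrite -natr1; field.
rewrite factS natrM expnS natrM !natrX exprS expr_div_n.
have mm0 : m%:R ^+ m != 0 :> R by rewrite expf_neq0.
by field; rewrite e0 e1 f0 ?nat1r ?natr1 mn1 mm0.
Qed.

(** The decrease by a multiple of [stirling R m / m] makes the sum of these quantities telescope.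
    With [x = 1/m <= 1], the constant 9 comes from [1 + x <= exp (x - x^2 / 8)] and
    [(1 - x / 9) * (1 + x / 8) >= 1]. *)
Lemma stirling_decr (R : realType) (m : nat) : (0 < m)%N ->
  stirling R m.+1 <= stirling R m * (1 - (9 * m%:R)^-1).
Proof.
move=> m0; rewrite stirlingS // ler_wpM2l //; first exact/ltW/stirling_gt0.
set x : R := m%:R^-1; have x0 : 0 < x by rewrite invr_gt0 ltr0n.
have x1 : x <= 1 by rewrite invf_le1 ?ltr0n // ler1n.
have y1 : 1 + x <= expR (x - x ^+ 2 / 8).
  (* The tangent bound at half the exponent, squared, supplies the quadratic term that compensates
     [x^2 / 8]. *)
  have h := expR_ge1Dx ((x - x ^+ 2 / 8) / 2).
  have -> : x - x ^+ 2 / 8 = (x - x ^+ 2 / 8) / 2 + (x - x ^+ 2 / 8) / 2 by field.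
  rewrite expRD; apply: (@le_trans _ _ ((1 + (x - x ^+ 2 / 8) / 2) * (1 + (x - x ^+ 2 / 8) / 2))).
    nra.
  by apply: ler_pM => //; nra.
have : (1 + x) ^+ m <= expR (1 - x / 8).
  have -> : 1 - x / 8 = m%:R * (x - x ^+ 2 / 8).
    have mn0 : m%:R != 0 :> R by rewrite pnatr_eq0 -lt0n.
    by rewrite /x; field.
  rewrite expRM_natl; apply: lerXn2r; rewrite ?nnegrE ?expR_ge0 //; lra.
rewrite ler_pdivrMr ?expR_gt0 // => /le_trans; apply.
rewrite expRD mulrC ler_wpM2r ?expR_ge0 //.
rewrite expRN -div1r ler_pdivrMr ?expR_gt0 //.
have -> : (9 * m%:R)^-1 = x / 9 by rewrite invfM mulrC.
have := expR_ge1Dx (x / 8) => h.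
apply: (@le_trans _ _ ((1 - x / 9) * (1 + x / 8))); first nra.
by rewrite ler_wpM2l //; lra.
Qed.

(** Equivalent to [(1 + 1/m)^(m+1) >= e]. Together with the decrease of [stirling] it gives
    [1 / (e m) <= stirling R m <= 1 / e], in place of the true order [m^(-1/2)]. *)
Lemma mul_stirling_incr (R : realType) (m : nat) : (0 < m)%N ->
  m%:R * stirling R m <= m.+1%:R * stirling R m.+1.
Proof.
move=> m0; rewrite stirlingS // [leRHS]mulrCA [leLHS]mulrC.
rewrite ler_wpM2l //; first exact/ltW/stirling_gt0.
have mp : 0 < m%:R :> R by rewrite ltr0n.
have m1p : 0 < m.+1%:R :> R by rewrite ltr0n.
pose a : R := m%:R / m.+1%:R; have a0 : 0 < a by rewrite divr_gt0.
have aE : a = 1 - m.+1%:R^-1.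
  rewrite /a -[X in X / _](addrK 1) natr1 mulrBl mulfV ?gt_eqF //.
  by rewrite mul1r.
have -> : 1 + m%:R^-1 = a^-1 :> R.
  by rewrite /a invf_div -natr1 mulrDl mulfV ?gt_eqF // mul1r.
have hb : a ^+ m.+1 * expR 1 <= 1.
  rewrite -ler_pdivlMr ?expR_gt0 // div1r.
  have -> : (expR 1)^-1 = expR (- m.+1%:R^-1) ^+ m.+1 :> R.
    by rewrite -expRM_natl mulrN mulfV ?pnatr_eq0 // expRN.
  apply: lerXn2r; rewrite ?nnegrE ?(ltW a0) ?expR_ge0 //.
  by rewrite aE; apply: expR_ge1Dx.
have -> : m%:R = m.+1%:R * a :> R by rewrite /a mulrC divfK ?gt_eqF.
rewrite ler_wpM2l ?(ltW m1p) // ler_pdivlMr ?expR_gt0 // exprVn -div1r.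
by rewrite ler_pdivlMr ?exprn_gt0 // mulrAC -exprS.
Qed.

Lemma mul_stirling_le (R : realType) (m n : nat) : (0 < m)%N -> (m <= n)%N ->
  m%:R * stirling R m <= n%:R * stirling R n.
Proof.
move=> m0; elim: n => [|n IH]; first by rewrite leqn0 => /eqP m00; rewrite m00 in m0.
rewrite leq_eqVlt => /predU1P[->//|mn]; apply: le_trans (IH mn) _.
by apply: mul_stirling_incr; exact: (leq_trans m0 mn).
Qed.

Lemma stirling_le (R : realType) (m n : nat) : (0 < m)%N -> (m <= n)%N ->
  stirling R n <= stirling R m.
Proof.
move=> m0; elim: n => [|n IH]; first by rewrite leqn0 => /eqP m00; rewrite m00 in m0.
rewrite leq_eqVlt => /predU1P[->//|mn]; apply: le_trans (IH mn).
have n0 : (0 < n)%N := leq_trans m0 mn.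
apply: le_trans (stirling_decr _ n0) _.
rewrite ler_piMr ?(ltW (stirling_gt0 _ _)) // gerBl invr_ge0.
Qed.

Lemma stirling1 (R : realType) : stirling R 1 = (expR 1)^-1.
Proof. by rewrite /stirling expr1 exp1n (_ : 1`!%:R = 1 :> R) // mul1r div1r. Qed.

(** Telescoping with the constant of [stirling_decr]; the total decrease is at most
    [stirling R 1 = 1 / e]. *)
Lemma sum_stirling_le (R : realType) (N : nat) :
  \sum_(1 <= m < N.+1) stirling R m / m%:R <= 9.
Proof.
apply: (@le_trans _ _ (9 * (stirling R 1 - stirling R N.+1))).
  elim: N => [|N IH]; first by rewrite big_geq // subrr mulr0.
  rewrite big_nat_recr //= -/(_ + _).
  apply: (@le_trans _ _ (9 * (stirling R 1 - stirling R N.+1) +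
     9 * (stirling R N.+1 - stirling R N.+2))); last by rewrite -mulrDr subrKA.
  apply: lerD IH _; have := stirling_decr R (ltn0Sn N).
  have n0 : 0 < N.+1%:R :> R by rewrite ltr0n.
  rewrite invfM mulrBr mulr1 mulrCA.
  set u := stirling R N.+1 / _; move: u (stirling R N.+1) (stirling R N.+2) => u v w h.
  lra.
have := stirling_gt0 R (ltn0Sn N); rewrite stirling1 => h.
have : (expR 1)^-1 <= 1 :> R by rewrite invf_le1 ?expR_gt0 // -expR0 ler_expR.
lra.
Qed.

Lemma tau_powM_le (R : realType) (N : nat) (y : R) : 0 <= y -> expR 1 * y <= 1 ->
  \sum_(m < N.+1) tau R m * y ^+ m <= 9.
Proof.
move=> y0 y1; apply: le_trans (sum_stirling_le R N).
rewrite -(big_mkord xpredT (fun m => tau R m * y ^+ m)) big_nat_recl //.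
rewrite {1}/tau eqxx mul0r add0r [leRHS]big_add1 !big_nat.
apply: ler_sum => m _; rewrite tau_stirling // -[leLHS]mulrA -exprMn.
rewrite ler_piMr ?exprn_ile1 ?mulr_ge0 ?expR_ge0 //.
Qed.

Lemma trunc_horner (R : realType) (q : nat -> R) (N : nat) (x : R) :
  (trunc q N).[x] = \sum_(l < N.+1) q l * x ^+ l.
Proof. exact: horner_poly. Qed.

Lemma trunc_horner_ge0 (R : realType) (q : nat -> R) (N : nat) (x : R) :
  (forall i, 0 <= q i) -> 0 <= x -> 0 <= (trunc q N).[x].
Proof.
by move=> q0 x0; rewrite trunc_horner; apply: sumr_ge0 => l _; rewrite mulr_ge0 ?exprn_ge0.
Qed.

(** Interchanging the sums leaves the tree function at [Q(x)], which is bounded up to the argument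
    [1 / e]. *)
Lemma sum_tree_coef_le (R : realType) (q : nat -> R) (N : nat) (x : R) :
  (forall i, 0 <= q i) -> q 0%N = 0 -> 0 <= x -> expR 1 * (trunc q N).[x] <= 1 ->
  \sum_(n < N.+1) tree_coef q n * x ^+ n <= 9.
Proof.
move=> q0 q00 x0 hx; apply: le_trans (tau_powM_le N (trunc_horner_ge0 N q0 x0) hx).
rewrite (eq_bigr (fun n : 'I_N.+1 =>
   \sum_(m < N.+1) tau R m * ((trunc q N ^+ m)`_n * x ^+ n))); last first.
  move=> n _; rewrite (@tree_coefE _ q n N) // -1?ltnS // mulr_suml.
  by apply: eq_bigr => m _; rewrite mulrA.
rewrite exchange_big; apply: ler_sum => m _ /=; rewrite -mulr_sumr.
rewrite ler_wpM2l ?tau_ge0 // -horner_exp; apply: sum_coef_le_horner => // i.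
by apply: coef_exp_ge0 => j; apply: trunc_ge0.
Qed.

Lemma tree_coef_le (R : realType) (q : nat -> R) (n : nat) (x : R) :
  (forall i, 0 <= q i) -> q 0%N = 0 -> 0 <= x -> expR 1 * (trunc q n).[x] <= 1 ->
  tree_coef q n * x ^+ n <= 9.
Proof.
move=> q0 q00 x0 hx; apply: le_trans (sum_tree_coef_le q0 q00 x0 hx).
rewrite big_ord_recr /= lerDr; apply: sumr_ge0 => m _.
by rewrite mulr_ge0 ?tree_coef_ge0 ?exprn_ge0.
Qed.

Lemma bernoulli_le (R : realType) (d : R) (k : nat) : 0 <= d -> 1 + k%:R * d <= (1 + d) ^+ k.
Proof.
move=> d0; elim: k => [|k IH]; first by rewrite mul0r addr0.
rewrite exprS; apply: (@le_trans _ _ ((1 + d) * (1 + k%:R * d))).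
  rewrite -natr1; have : 0 <= k%:R * d * d by rewrite !mulr_ge0.
  move: (k%:R : R) => K; nra.
by rewrite ler_wpM2l // addr_ge0.
Qed.

Lemma pow_le_quadratic (R : realType) (c C : R) :
  (forall m, (0 < m)%N -> c ^+ m <= C * m%:R ^+ 2) -> c <= 1.
Proof.
move=> h; rewrite leNgt; apply/negP => c1.
pose d := c - 1; have d0 : 0 < d by rewrite subr_gt0.
have cE : c = 1 + d by rewrite /d addrC subrK.
have C0 : 0 <= C.
  by have := h 1%N isT; rewrite expr1 expr1n mulr1; apply: le_trans; lra.
(* [k * d^3 > 9 * C] gives [c^(3k) >= (k * d)^3 > C * (3 * k)^2]. *)
pose k := (Num.bound (9 * C / d ^+ 3)).+1.
have hk : 9 * C / d ^+ 3 < k%:R.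
  apply: lt_le_trans (archi_boundP _) _; first by rewrite divr_ge0 ?mulr_ge0 ?exprn_ge0 // ltW.
  by rewrite ler_nat /k.
have := h (3 * k)%N isT; apply/negP; rewrite -ltNge.
have k0 : 0 < k%:R :> R by rewrite ltr0n.
have hb : k%:R * d <= c ^+ k.
  by rewrite cE; apply: le_trans (bernoulli_le k (ltW d0)); rewrite lerDr.
apply: (@lt_le_trans _ _ ((k%:R * d) ^+ 3)).
  move: hk; rewrite ltr_pdivrMr ?exprn_gt0 // natrM => hk.
  have -> : C * (3 * k%:R) ^+ 2 = 9 * C * k%:R ^+ 2 by ring.
  have -> : (k%:R * d) ^+ 3 = k%:R * d ^+ 3 * k%:R ^+ 2 by ring.
  by rewrite ltr_pM2r // exprn_gt0.
rewrite mulnC exprM; apply: lerXn2r; rewrite ?nnegrE //.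
  by rewrite mulr_ge0 // ltW.
by rewrite exprn_ge0 // cE addr_ge0 // ltW.
Qed.

(** The converse of [sum_tree_coef_le]: each single [m] gives [tau_m Q^m <= M], and
    [tau_m >= e^(m-1) / m^2], so the powers of [e Q] grow at most quadratically. *)
Lemma tree_coef_bounded (R : realType) (q : nat -> R) (x M : R) :
  (forall i, 0 <= q i) -> q 0%N = 0 -> 0 <= x ->
  (forall K, \sum_(n < K) tree_coef q n * x ^+ n <= M) ->
  forall N, expR 1 * (trunc q N).[x] <= 1.
Proof.
move=> q0 q00 x0 hM N; have e0 : 0 < expR 1 :> R by apply: expR_gt0.
have h m : (0 < m)%N -> tau R m * (trunc q N).[x] ^+ m <= M.
  (* [K] is large enough to cover all coefficients of the power. *)
  move=> m0; pose p := trunc q N ^+ m; pose K := maxn m (maxn (size p) N).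
  apply: le_trans (hM K.+1).
  rewrite -horner_exp -/p (@horner_coef_wide _ K.+1 p); last first.
    by rewrite /K !leqW // !leq_max leqnn orbT.
  rewrite mulr_sumr; apply: ler_sum => n _; rewrite mulrA ler_wpM2r ?exprn_ge0 //.
  rewrite (@tree_coefE _ q n K) // -1?ltnS //.
  have mK : (m < K.+1)%N by rewrite ltnS /K leq_max leqnn.
  rewrite (bigD1 (Ordinal mK)) //=.
  apply: (@le_trans _ _ (tau R m * (trunc q K ^+ m)`_n)); last first.
    rewrite lerDl; apply: sumr_ge0 => i _; rewrite mulr_ge0 ?tau_ge0 //.
    by apply: coef_exp_ge0 => j; apply: trunc_ge0.
  rewrite ler_wpM2l ?tau_ge0 //; apply: coef_exp_le => i; rewrite !coef_trunc.
  case: (leqP i N) => iN; last by rewrite lexx /=; case: ifP.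
  by rewrite (leq_trans iN) ?q0 ?lexx // /K !leq_max leqnn !orbT.
apply: (pow_le_quadratic (C := M * expR 1)) => m m0.
have hm : stirling R m / m%:R * (expR 1 * (trunc q N).[x]) ^+ m <= M.
  by rewrite exprMn mulrA -tau_stirling //; apply: h.
have m0' : 0 < m%:R :> R by rewrite ltr0n.
have s1 : (expR 1)^-1 <= m%:R * stirling R m.
  by have := @mul_stirling_le R 1 m isT m0; rewrite mul1r stirling1.
set c := (expR 1 * _) ^+ m in hm *.
have c0 : 0 <= c.
  by rewrite exprn_ge0 // mulr_ge0 ?expR_ge0 ?trunc_horner_ge0.
have : (expR 1)^-1 * c <= m%:R * stirling R m * c by rewrite ler_wpM2r.
have -> : m%:R * stirling R m * c = m%:R ^+ 2 * (stirling R m / m%:R * c).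
  by field; rewrite gt_eqF.
move=> h1; have h2 : m%:R ^+ 2 * (stirling R m / m%:R * c) <= m%:R ^+ 2 * M.
  by rewrite ler_wpM2l // exprn_ge0 // ltW.
have := le_trans h1 h2; rewrite ler_pdivrMl //.
by rewrite mulrCA mulrC [expR 1 * M]mulrC.
Qed.

(** * The radius of convergence *)

Definition tcoef (R : realType) (n : nat) : R := (polya_count n)%:R.

(* The coefficients of [z D(z)], where [D] is the generating function of D-forests. *)
Definition qcoef (R : realType) (l : nat) : R :=
  if l == 0%N then 0 else (dtree_count l)%:R / l`!%:R.

Lemma qcoef_ge0 (R : realType) (l : nat) : 0 <= qcoef R l.
Proof. by rewrite /qcoef; case: ifP => // _; rewrite divr_ge0. Qed.

Lemma polya_count0 : polya_count 0 = 0%N.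
Proof.
apply: eq_card0 => f; apply/negbTE/negP => /polya_rooted/rooted_treesP[[r]].
by [].
Qed.

Lemma tree_coef_marked (R : realType) (n : nat) (S : pred nat) : (0 < n)%N ->
  #|marked_trees n S|%:R / n`!%:R =
  tree_coef (fun l => if S l.-1 then qcoef R l else 0) n.
Proof.
move=> n0; rewrite marked_trees_egf // /tree_coef; apply: eq_bigr => m _.
have -> : egf n (fun l => if S l.-1 then (dtree_count l)%:R else 0 : R) =
    trunc (fun l => if S l.-1 then qcoef R l else 0) n.
  apply/polyP => l; rewrite !coef_poly; case: ifP => // _; rewrite /qcoef.
  by case: (l == 0%N); case: (S l.-1) => //; rewrite mul0r.
case: m => -[|m] mn //=; rewrite /tau /=.
(* For [m = 0] the weights differ, 1 against 0, but a coefficient of positive index of the constant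
   1 vanishes. *)
by rewrite expr0 coef1 gtn_eqF // mulr0 mul0r.
Qed.

Lemma tcoefE (R : realType) (n : nat) : tcoef R n = tree_coef (qcoef R) n.
Proof.
case: n => [|n].
  by rewrite /tcoef polya_count0 /tree_coef big_ord_recl big_ord0 /tau /= mul0r addr0.
rewrite -[RHS](@tree_coef_marked R n.+1 predT) // card_all_marked natrM mulrAC mulfV ?mul1r //.
Qed.

(** The left side is a truncation of the sum of [T(x^i)] over [i >= 2]. For [j >= 1] one has
    [i * j >= (i - 2) + 2 * j], which leaves [T(x^2)] times a geometric series. *)
Lemma cycle_bound_horner_le (R : realType) (N : nat) (x : R) : 0 <= x -> x < 1 ->
  (egf N (fun l => (cycle_bound l)%:R : R)).[x] <=
  (\sum_(j < N.+1) tcoef R j * (x ^+ 2) ^+ j) / (1 - x).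
Proof.
move=> x0 x1; rewrite horner_poly.
have fact_neq0 k : (k`!%:R : R) != 0 by rewrite pnatr_eq0 -lt0n fact_gt0.
pose F i j : R := tcoef R j * x ^+ (i * j).
have F0 i j : 0 <= F i j by rewrite mulr_ge0 ?exprn_ge0 // /tcoef ler0n.
apply: (@le_trans _ _ (\sum_(l < N.+1) \sum_(i < N.+1 | (1 < i)%N)
    \sum_(j < N.+1 | (i * j == l)%N) F i j)).
  apply: ler_sum => -[l /= lN] _; case: (eqVneq l 0%N) => [_|l0].
    by rewrite mul0r; apply: sumr_ge0 => i _; apply: sumr_ge0.
  rewrite /cycle_bound natrM [_ * _ / _]mulrAC mulfV // mul1r natr_sum mulr_suml.
  rewrite (big_ord_widen_cond N.+1 (fun i => (1 < i)%N && (i %| l)%N)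
    (fun i => (polya_count (l %/ i))%:R * x ^+ l)) //.
  rewrite [leLHS](eq_bigl (fun i : 'I_N.+1 => (1 < i)%N && ((i %| l)%N && (i < l.+1)%N))); last first.
    by move=> i; rewrite andbA.
  rewrite [leLHS]big_mkcondr; apply: ler_sum => i i1; case: ifP; last by rewrite sumr_ge0.
  case/andP => il _; have jN : (l %/ i < N.+1)%N by rewrite (leq_ltn_trans (leq_div _ _)).
  rewrite (bigD1 (Ordinal jN)) /=; last by rewrite mulnC divnK.
  rewrite {1}/F [(i * (l %/ i))%N]mulnC divnK // lerDl.
  by apply: sumr_ge0.
rewrite exchange_big /=.
apply: (@le_trans _ _ (\sum_(i < N.+1 | (1 < i)%N) x ^+ (i - 2) *
    (\sum_(j < N.+1) tcoef R j * (x ^+ 2) ^+ j))).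
  apply: ler_sum => i i1.
  rewrite (exchange_big_dep predT) //= mulr_sumr; apply: ler_sum => j _.
  have -> : x ^+ (i - 2) * (tcoef R j * (x ^+ 2) ^+ j) = tcoef R j * x ^+ (i - 2 + 2 * j).
    by rewrite exprD exprM mulrCA.
  apply: (@le_trans _ _ (F i j)).
    case: (ltnP (i * j) N.+1) => ijN; last first.
      rewrite big_pred0 // => l; apply/negbTE; apply: contraTneq ijN => ->.
      by rewrite -ltnNge.
    by rewrite (big_pred1 (Ordinal ijN)) // => l; rewrite -val_eqE eq_sym.
  rewrite /F; case: (posnP j) => [->|j0]; first by rewrite /tcoef polya_count0 !mul0r.
  rewrite ler_wpM2l ?ler0n // ler_wiXn2l ?(ltW x1) //; nia.
rewrite -mulr_suml mulrC ler_wpM2l //.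
  by apply: sumr_ge0 => j _; rewrite mulr_ge0 ?exprn_ge0 // /tcoef ler0n.
rewrite -div1r ler_pdivlMr ?subr_gt0 //.
apply: (@le_trans _ _ ((\sum_(i < N) x ^+ i) * (1 - x))); last first.
  by rewrite mulrC -opprB mulNr -subrX1 opprB gerBl exprn_ge0.
rewrite ler_wpM2r ?subr_ge0 ?(ltW x1) //.
case: N {F F0} => [|N]; first by rewrite big_mkcond big_ord1 big_ord0.
rewrite [leRHS]big_ord_recr big_mkcond !big_ord_recl /= !add0r.
rewrite -[leLHS]addr0 lerD ?exprn_ge0 //; apply: ler_sum => i _.
by rewrite /bump /= !add1n subn2.
Qed.

Lemma exp_partial_le (R : realType) (x : R) (N : nat) : 0 <= x ->
  \sum_(b < N) x ^+ b / b`!%:R <= expR x.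
Proof.
move=> x0; have := nondecreasing_cvgn_le _ (is_cvg_series_exp_coeff x) N.
rewrite /series /= big_mkord; apply.
by apply: nondecreasing_series => n _ _; apply: exp_coeff_ge0.
Qed.

(** A truncated form of [Q(x) <= x exp(sum_(i >= 2) T(x^i))]; in the exact formula for [Q] the
    summands are divided by [i]. *)
Lemma qcoef_horner_le (R : realType) (N : nat) (x : R) : 0 <= x ->
  (trunc (qcoef R) N.+1).[x] <=
  x * expR ((egf N (fun l => (cycle_bound l)%:R : R)).[x]).
Proof.
move=> x0; set p := egf N _.
have p0 i : 0 <= p`_i.
  by rewrite coef_poly; case: ifP => // _; case: ifP => // _; rewrite divr_ge0.
rewrite trunc_horner big_ord_recl /= {1}/qcoef eqxx mul0r add0r.
apply: (@le_trans _ _ (x * \sum_(k < N.+1) \sum_(b < N.+1) (p ^+ b)`_k / b`!%:R * x ^+ k)).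
  rewrite mulr_sumr; apply: ler_sum => k _; rewrite /bump /= add1n exprS mulrCA.
  rewrite ler_wpM2l // -mulr_suml ler_wpM2r ?exprn_ge0 //.
  rewrite /qcoef /=; apply: le_trans (dtree_count_le R (N := N) _) _; first by rewrite -ltnS.
  rewrite (big_ord_widen_cond N.+1 xpredT (fun b => (p ^+ b)`_k / b`!%:R)) //.
  rewrite big_mkcondr; apply: ler_sum => b _; case: ifP => // _.
  by rewrite divr_ge0 // coef_exp_ge0.
rewrite ler_wpM2l // exchange_big /=.
have px0 : 0 <= p.[x].
  rewrite (horner_coef p); apply: sumr_ge0 => i _; by rewrite mulr_ge0 ?exprn_ge0.
apply: le_trans (exp_partial_le N.+1 px0); apply: ler_sum => b _.
rewrite -horner_exp; apply: (@le_trans _ _ ((\sum_(k < N.+1) (p ^+ b)`_k * x ^+ k) / b`!%:R)).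
  by rewrite mulr_suml; apply: ler_sum => k _; rewrite mulrAC.
by rewrite ler_wpM2r ?invr_ge0 //; apply: sum_coef_le_horner => // i; apply: coef_exp_ge0.
Qed.

(** [e Q(x) <= 1], expressed through polynomials only. By [sum_tree_coef_le] and [tree_coef_bounded]
    this amounts to bounded partial sums of [T(x)]. *)
Definition admissible (R : realType) (x : R) : Prop :=
  0 <= x /\ forall N, expR 1 * (trunc (qcoef R) N).[x] <= 1.

Lemma sum_tcoef_le (R : realType) (x : R) (N : nat) : 0 <= x ->
  expR 1 * (trunc (qcoef R) N).[x] <= 1 -> \sum_(n < N.+1) tcoef R n * x ^+ n <= 9.
Proof.
move=> x0 hx; rewrite (eq_bigr (fun n : 'I_N.+1 => tree_coef (qcoef R) n * x ^+ n)); last first.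
  by move=> n _; rewrite tcoefE.
by apply: sum_tree_coef_le => // i; apply: qcoef_ge0.
Qed.

Lemma tcoef_ge0 (R : realType) (n : nat) : 0 <= tcoef R n.
Proof. by rewrite /tcoef. Qed.

(** [Q(x)] is controlled by [T(x^2)], and [T(y)] is at most 9 as soon as [e Q(y) <= 1]. The gain of
    one degree allows an induction on [N] with [y = x]; the squaring extends a bound at [y] to the
    square root of [y]. *)
Lemma qcoef_horner_step (R : realType) (N : nat) (x y : R) : 0 <= x -> x < 1 ->
  x ^+ 2 <= y -> expR 1 * (trunc (qcoef R) N).[y] <= 1 ->
  (trunc (qcoef R) N.+1).[x] <= x * expR (9 / (1 - x)).
Proof.
move=> x0 x1 xy hy; apply: le_trans (qcoef_horner_le N x0) _.
rewrite ler_wpM2l // ler_expR; apply: le_trans (cycle_bound_horner_le N x0 x1) _.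
rewrite ler_wpM2r ?invr_ge0 ?subr_ge0 ?(ltW x1) //.
have y0 : 0 <= y by apply: le_trans xy; rewrite exprn_ge0.
apply: le_trans (sum_tcoef_le y0 hy); apply: ler_sum => j _.
by rewrite ler_wpM2l ?tcoef_ge0 // lerXn2r // nnegrE exprn_ge0.
Qed.

Lemma expR1_ge2 (R : realType) : 2 <= expR 1 :> R.
Proof. by have := expR_ge1Dx (1 : R); apply: le_trans; lra. Qed.

Lemma admissible_small (R : realType) : exists2 x : R, 0 < x & admissible x.
Proof.
have e0 : 0 < expR 1 :> R := expR_gt0 1.
(* Chosen such that [e * x * exp 18 = 1]; the 18 bounds [9 / (1 - x)] for [x <= 1 / 2]. *)
pose x : R := (expR 1 * expR 18)^-1.
have x0 : 0 < x by rewrite invr_gt0 mulr_gt0 ?expR_gt0.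
have x2 : x <= 1 / 2.
  rewrite div1r lef_pV2 ?posrE ?mulr_gt0 ?expR_gt0 //.
  have := expR1_ge2 R; have : 1 <= expR 18 :> R by rewrite -expR0 ler_expR.
  move: (expR 18 : R) (expR 1 : R) => u v; nra.
exists x => //; split; first exact: ltW.
elim=> [|N IH]; first by rewrite trunc_horner big_ord1 /qcoef /= mul0r mulr0.
have x1 : x < 1 by lra.
have xx : x ^+ 2 <= x by rewrite expr2 ler_piMr ?(ltW x0) // ltW.
have := qcoef_horner_step (ltW x0) x1 xx IH.
rewrite -(ler_pM2l e0) => /le_trans; apply.
have ex : expR 1 * x = expR (- 18) by rewrite /x invfM mulrA mulfV ?gt_eqF // mul1r -expRN.
rewrite mulrA ex -expRD -[leRHS]expR0 ler_expR addrC subr_le0.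
rewrite ler_pdivrMr ?subr_gt0 //; lra.
Qed.

(** * Convexity of the truncated generating functions *)

Lemma pow_chord (R : realType) (a y b : R) (l : nat) : 0 <= a -> a <= y -> y <= b ->
  (y ^+ l - a ^+ l) * (b - a) <= (y - a) * (b ^+ l - a ^+ l).
Proof.
move=> a0 ay yb; elim: l => [|l IH]; first by rewrite !expr0 !subrr mul0r mulr0.
have ab := le_trans ay yb; have y0 := le_trans a0 ay; have b0 := le_trans a0 ab.
have bl : a ^+ l <= b ^+ l by rewrite lerXn2r.
have al : 0 <= a ^+ l by rewrite exprn_ge0.
rewrite !exprS.
have -> : (y * y ^+ l - a * a ^+ l) * (b - a) =
  y * ((y ^+ l - a ^+ l) * (b - a)) + a ^+ l * (y - a) * (b - a) by ring.
have -> : (y - a) * (b * b ^+ l - a * a ^+ l) =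
  b * ((y - a) * (b ^+ l - a ^+ l)) + a ^+ l * (y - a) * (b - a) by ring.
rewrite lerD2r; apply: (@le_trans _ _ (y * ((y - a) * (b ^+ l - a ^+ l)))).
  by rewrite ler_wpM2l.
by rewrite ler_wpM2r // mulr_ge0 // subr_ge0.
Qed.

(** Dropping the value at [a] from the slope of the chord leaves a slope that is uniform in [N]
    whenever the values at [b] are. *)
Lemma trunc_chord (R : realType) (q : nat -> R) (N : nat) (a y b : R) :
  (forall i, 0 <= q i) -> 0 <= a -> a <= y -> y <= b -> a < b ->
  (trunc q N).[y] <= (trunc q N).[a] + (trunc q N).[b] / (b - a) * (y - a).
Proof.
move=> q0 a0 ay yb ab; have d0 : 0 < b - a by rewrite subr_gt0.
rewrite -lerBlDl mulrAC ler_pdivlMr // !trunc_horner -sumrB !mulr_suml.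
apply: ler_sum => l _; rewrite -mulrBr -!mulrA ler_wpM2l //.
apply: le_trans (pow_chord l a0 ay yb) _; rewrite mulrC ler_wpM2r ?subr_ge0 //.
by rewrite gerBl exprn_ge0.
Qed.

Lemma dtree_count1 : (0 < dtree_count 1)%N.
Proof.
apply/card_gt0P; exists [ffun x => (x, x)]; rewrite inE; apply/dtreeP; split.
- by apply/supportedP => x; rewrite ffunE.
- by apply/equivariantP; split=> [x y|x]; rewrite /auto /parent !ffunE.
- exists ord0; split=> [||x _|x _].
  + by rewrite inE.
  + by rewrite /parent ffunE.
  + by rewrite (ord1 x) connect0.
  + by rewrite (ord1 x) /auto ffunE.
Qed.

Lemma qcoef1_ge1 (R : realType) : 1 <= qcoef R 1.
Proof. by rewrite /qcoef /= divr1 ler1n dtree_count1. Qed.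

Lemma admissible_le (R : realType) (x : R) : admissible x -> x <= (expR 1)^-1.
Proof.
case=> x0 /(_ 1%N); rewrite trunc_horner big_ord_recl big_ord1 /= /bump /= expr1.
rewrite {1}/qcoef /= mul0r add0r => h.
rewrite -[leRHS]mul1r ler_pdivlMr ?expR_gt0 // mulrC; apply: le_trans h.
rewrite ler_wpM2l ?expR_ge0 //; have := qcoef1_ge1 R.
by rewrite addn0 => h; rewrite ler_peMl.
Qed.

Lemma admissible_cvg (R : realType) (x : R) : admissible x -> cvgn (pseries (tcoef R) x).
Proof.
case=> x0 hx; apply: nondecreasing_is_cvgn.
  by apply: nondecreasing_series => n _ _; rewrite mulr_ge0 ?tcoef_ge0 ?exprn_ge0.
exists 9 => _ [n _ <-]; rewrite /pseries /series /= big_mkord.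
apply: le_trans (sum_tcoef_le x0 (hx n)); rewrite big_ord_recr /= lerDl.
by rewrite mulr_ge0 ?tcoef_ge0 ?exprn_ge0.
Qed.

Lemma cvg_admissible (R : realType) (x y : R) :
  cvgn (pseries (tcoef R) x) -> 0 <= y -> y < `|x| -> admissible y.
Proof.
move=> cx y0 yx; split=> //.
have cy : cvgn (pseries (tcoef R) y) by apply: is_cvg_pseries_inside cx _; rewrite ger0_norm.
apply: (tree_coef_bounded (M := limn (pseries (tcoef R) y))) => // [i|K].
  exact: qcoef_ge0.
rewrite (eq_bigr (fun n : 'I_K => tcoef R n * y ^+ n)); last by move=> n _; rewrite tcoefE.
have nd : nondecreasing_seq (pseries (tcoef R) y).
  by apply: nondecreasing_series => n _ _; rewrite mulr_ge0 ?tcoef_ge0 ?exprn_ge0.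
by have := nondecreasing_cvgn_le nd cy K; rewrite /pseries /series /= big_mkord.
Qed.

(** The set of moduli is nonempty and bounded, so its supremum in the extended reals is finite and
    [fine] loses nothing. *)
Lemma polya_radiusE (R : realType) :
  (polya_radius R = sup [set `|x| | x in [set x : R | cvgn (pseries (tcoef R) x)]] /\
  has_sup [set `|x| | x in [set x : R | cvgn (pseries (tcoef R) x)]])%classic.
Proof.
set A := ([set `|x| | x in _])%classic.
have [x0 x0p ax0] := admissible_small R.
have Ax0 : A x0 by exists x0; [exact: admissible_cvg | rewrite ger0_norm // ltW].
have ubA : ubound A (expR 1)^-1.
  move=> _ [x cx <-]; rewrite leNgt; apply/negP => ex.
  (* A point strictly between [1 / e] and the modulus of [x] would be admissible, against
     [admissible_le]. *)
  pose y := ((expR 1)^-1 + `|x|) / 2.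
  have e0 : 0 < (expR 1)^-1 :> R by rewrite invr_gt0 expR_gt0.
  have yx : y < `|x| by rewrite /y; lra.
  have y0 : 0 <= y by rewrite /y; lra.
  have := admissible_le (cvg_admissible cx y0 yx); rewrite /y; lra.
have hA : has_sup A by split; [exists x0 | exists (expR 1)^-1].
split=> //; rewrite /polya_radius /convergence_radius.
have -> : ([set (`|x|)%:E | x in [set x : R | cvgn (pseries (tcoef R) x)]] =
    [set z%:E | z in A])%classic by rewrite /A image_comp.
by rewrite ereal_sup_EFin //; [exists (expR 1)^-1 | exists x0].
Qed.

Lemma bernoulli_sub_le (R : realType) (d : R) (N : nat) : 0 <= d -> d <= 1 ->
  1 - N%:R * d <= (1 - d) ^+ N.
Proof.
move=> d0 d1; elim: N => [|N IH]; first by rewrite mul0r subr0.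
rewrite exprS; apply: (@le_trans _ _ ((1 - d) * (1 - N%:R * d))).
  rewrite -natr1; have : 0 <= N%:R * d * d by rewrite !mulr_ge0.
  move: (N%:R : R) => K; nra.
by rewrite ler_wpM2l // subr_ge0.
Qed.

(** Points below [rho] are admissible by convergence. The condition passes to [rho] itself because
    for each [N] it concerns a polynomial; beyond [rho] it fails because admissible points are
    points of convergence. *)
Lemma polya_radius_spec (R : realType) (rho := polya_radius R) :
  [/\ 0 < rho, rho < 1, admissible rho & forall y, rho < y -> ~ admissible y].
Proof.
have [rE hA] := polya_radiusE R; rewrite -/rho in rE.
set A := ([set `|x| | x in _])%classic in rE hA.
have leA a : A a -> a <= rho by rewrite rE => Aa; apply: sup_upper_bound hA _ Aa.
have [x0 x0p ax0] := admissible_small R.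
have admA x : admissible x -> x <= rho.
  by move=> ax; apply: leA; exists x; [exact: admissible_cvg | rewrite ger0_norm //; case: ax].
have r0 : 0 < rho by apply: lt_le_trans x0p (admA _ ax0).
have lt_adm y : 0 <= y -> y < rho -> admissible y.
  move=> y0 yr; have ry : 0 < rho - y by rewrite subr_gt0.
  have [_ [x cx <-]] := sup_adherent ry hA; rewrite -rE subKr => yx.
  exact: cvg_admissible cx y0 yx.
have ar : admissible rho.
  split=> [|N]; first exact: ltW.
  rewrite leNgt; apply/negP; set c := expR 1 * _ => c1.
  (* With this [d], [(1 - N * d) * c = 1 + c * d > 1], while moving from [rho] to [(1 - d) * rho]
     costs each term at most the factor [1 - N * d]. *)
  pose d := (1 - c^-1) / N.+1%:R.
  have c0 : 0 < c by lra.
  have n1 : 0 < N.+1%:R :> R by rewrite ltr0n.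
  have cV : 0 < c^-1 < 1 by rewrite invr_gt0 c0 invf_lt1.
  have d0 : 0 < d by rewrite divr_gt0 // subr_gt0; case/andP: cV.
  have d1 : d <= 1.
    rewrite ler_pdivrMr // mul1r; apply: (@le_trans _ _ 1); last by rewrite ler1n.
    by rewrite gerBl ltW //; case/andP: cV.
  have y0 : 0 <= (1 - d) * rho by rewrite mulr_ge0 ?subr_ge0 // ltW.
  have yr : (1 - d) * rho < rho by rewrite gtr_pMl // gtrBl.
  have [_ /(_ N)] := lt_adm _ y0 yr; apply/negP; rewrite -ltNge.
  apply: (@lt_le_trans _ _ ((1 - N%:R * d) * c)).
    rewrite -ltr_pdivrMr // div1r.
    have -> : 1 - N%:R * d = c^-1 + d by rewrite /d -natr1; field; rewrite natr1 !gt_eqF.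
    by rewrite ltrDl.
  rewrite /c mulrCA ler_wpM2l ?expR_ge0 // !trunc_horner mulr_sumr; apply: ler_sum => l _.
  rewrite mulrCA ler_wpM2l ?qcoef_ge0 // exprMn ler_wpM2r ?exprn_ge0 ?(ltW r0) //.
  apply: le_trans (bernoulli_sub_le N (ltW d0) d1) _.
  by rewrite ler_wiXn2l ?subr_ge0 ?gerBl ?(ltW d0) // -ltnS.
split=> //; last by move=> y ry /admA; rewrite leNgt ry.
apply: le_lt_trans (admissible_le ar) _; rewrite invf_lt1 ?expR_gt0 //.
by have := expR1_ge2 R; lra.
Qed.

Definition sqrt_radius (R : realType) : R := Num.sqrt (polya_radius R).

Lemma sqrt_radius_spec (R : realType) (z := sqrt_radius R) :
  [/\ 0 < z, z < 1, z ^+ 2 = polya_radius R & polya_radius R < z].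
Proof.
have [r0 r1 _ _] := polya_radius_spec R.
have z0 : 0 < z by rewrite sqrtr_gt0.
have zE : z ^+ 2 = polya_radius R by rewrite sqr_sqrtr // ltW.
have z1 : z < 1 by rewrite -(@ltr_pXn2r _ 2) ?nnegrE ?ltW // zE expr1n.
by split=> //; rewrite -zE expr2 gtr_pMr.
Qed.

(** The bound of [qcoef_horner_step] at the square root of [rho], without its factor [x < 1]. *)
Definition sqrt_bound (R : realType) : R := expR (9 / (1 - sqrt_radius R)).

Lemma sqrt_bound_ge1 (R : realType) : 1 <= sqrt_bound R.
Proof.
have [z0 z1 _ _] := sqrt_radius_spec R.
by rewrite -expR0 ler_expR divr_ge0 // subr_ge0 ltW.
Qed.

(* The D-forest generating function still converges at the square root of the radius. *)
Lemma qcoef_sqrt_le (R : realType) (N : nat) :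
  (trunc (qcoef R) N).[sqrt_radius R] <= sqrt_bound R.
Proof.
have [z0 z1 zE _] := sqrt_radius_spec R; have [_ _ [_ ar] _] := polya_radius_spec R.
case: N => [|N].
  rewrite trunc_horner big_ord1 /qcoef /= mul0r.
  exact: le_trans ler01 (sqrt_bound_ge1 R).
have := qcoef_horner_step (ltW z0) z1 (y := polya_radius R) (N := N).
rewrite zE lexx ar => /(_ isT isT)/le_trans; apply.
by rewrite ler_piMl ?expR_ge0 // ltW.
Qed.

Definition chord_slope (R : realType) : R :=
  sqrt_bound R / (sqrt_radius R - polya_radius R).

Lemma chord_slope_gt0 (R : realType) : 0 < chord_slope R.
Proof.
have [_ _ _ rz] := sqrt_radius_spec R.
by rewrite divr_gt0 ?subr_gt0 // expR_gt0.
Qed.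

Lemma qcoef_chord (R : realType) (N : nat) (y : R) :
  polya_radius R <= y -> y <= sqrt_radius R ->
  (trunc (qcoef R) N).[y] <=
  (trunc (qcoef R) N).[polya_radius R] + chord_slope R * (y - polya_radius R).
Proof.
move=> ry yz; have [_ _ _ rz] := sqrt_radius_spec R; have [r0 _ _ _] := polya_radius_spec R.
apply: le_trans (trunc_chord N (qcoef_ge0 R) (ltW r0) ry yz rz) _.
rewrite lerD2l ler_wpM2r ?subr_ge0 // ler_wpM2r ?qcoef_sqrt_le //.
by rewrite invr_ge0 subr_ge0 ltW.
Qed.

(** * Renewal estimates *)

Definition step_mass (R : realType) (l : nat) : R :=
  expR 1 * (qcoef R l * polya_radius R ^+ l).

Definition step_cdf (R : realType) (n : nat) : R := \sum_(l < n.+1) step_mass R l.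

Lemma step_cdfE (R : realType) (n : nat) :
  step_cdf R n = expR 1 * (trunc (qcoef R) n).[polya_radius R].
Proof. by rewrite trunc_horner mulr_sumr. Qed.

Lemma step_mass_ge0 (R : realType) (l : nat) : 0 <= step_mass R l.
Proof.
have [r0 _ _ _] := polya_radius_spec R.
by rewrite !mulr_ge0 ?expR_ge0 ?qcoef_ge0 ?exprn_ge0 // ltW.
Qed.

Lemma step_cdf_le1 (R : realType) (n : nat) : step_cdf R n <= 1.
Proof. by have [_ _ [_ ar] _] := polya_radius_spec R; rewrite step_cdfE. Qed.

(* Criticality: the step masses form a probability distribution. *)
Lemma step_cdf_sup (R : realType) (d : R) : 0 < d -> exists N, 1 - d < step_cdf R N.
Proof.
move=> d0; have [r0 _ _ nadm] := polya_radius_spec R.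
have [z0 z1 _ rz] := sqrt_radius_spec R; have L0 := chord_slope_gt0 R.
have e0 : 0 < expR 1 :> R := expR_gt0 1.
apply: contrapT => /forallNP h.
have {}h N : step_cdf R N <= 1 - d by rewrite leNgt; apply/negP/h.
(* If the mass never exceeded [1 - d], then [e Q <= 1] would persist up to [rho + t]: the first
   bound keeps this point within the range of the chord, the second keeps the increase of [e Q]
   below [d]. *)
pose t : R := Num.min (sqrt_radius R - polya_radius R) (d / (expR 1 * chord_slope R)).
have t0 : 0 < t by rewrite lt_min subr_gt0 rz divr_gt0 // (mulr_gt0 e0 L0).
have tz : t <= sqrt_radius R - polya_radius R by rewrite ge_min lexx.
have td : expR 1 * (chord_slope R * t) <= d.
  have : t <= d / (expR 1 * chord_slope R) by rewrite ge_min lexx orbT.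
  by rewrite ler_pdivlMr ?(mulr_gt0 e0 L0) // mulrC -mulrA.
suff : admissible (polya_radius R + t) by apply: nadm; rewrite ltrDl.
split=> [|N]; first by rewrite addr_ge0 // ltW.
have := @qcoef_chord R N (polya_radius R + t).
rewrite lerDl (ltW t0) -lerBrDl tz addrAC subrr add0r => /(_ isT isT) hN.
have := h N; rewrite step_cdfE => hS.
apply: (@le_trans _ _ (expR 1 * ((trunc (qcoef R) N).[polya_radius R] + chord_slope R * t))).
  by rewrite ler_wpM2l // ltW.
rewrite mulrDr; lra.
Qed.

(** As the total mass is 1, this is the mass beyond [j]; there [rho^l = z^(2l) <= z^j * z^l] with
    [z] the square root of [rho], and [Q(z)] is bounded. *)
Lemma step_tail_le (R : realType) (j : nat) :
  1 - step_cdf R j <= expR 1 * sqrt_bound R * sqrt_radius R ^+ j.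
Proof.
have [z0 z1 zE rz] := sqrt_radius_spec R; have [r0 _ _ _] := polya_radius_spec R.
have e0 : 0 < expR 1 :> R := expR_gt0 1.
rewrite leNgt; apply/negP => h.
set b := _ * _ ^+ j in h.
have [N] := @step_cdf_sup R (1 - step_cdf R j - b) ltac:(by rewrite subr_gt0).
apply/negP; rewrite -leNgt opprB addrCA !opprB addrA; apply: (@le_trans _ _ (step_cdf R j + b)); last first.
  by lra.
apply: (@le_trans _ _ (step_cdf R j + sqrt_radius R ^+ j * (expR 1 * (trunc (qcoef R) N).[sqrt_radius R]))); last first.
  rewrite lerD2l /b mulrC ler_wpM2r ?exprn_ge0 ?(ltW z0) // ler_wpM2l ?qcoef_sqrt_le //.
have step_nn : nondecreasing_seq (step_cdf R).
  apply/nondecreasing_seqP => n; rewrite [leRHS]/step_cdf big_ord_recr /= lerDl.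
  exact: step_mass_ge0.
have tail0 M : 0 <= sqrt_radius R ^+ j * (expR 1 * (trunc (qcoef R) M).[sqrt_radius R]).
  by rewrite !mulr_ge0 ?exprn_ge0 ?expR_ge0 ?trunc_horner_ge0 ?(ltW z0) // => i; apply: qcoef_ge0.
elim: N => [|N IH].
  by apply: (@le_trans _ _ (step_cdf R j)); [exact: step_nn | rewrite lerDl].
case: (leqP N.+1 j) => Nj.
  by apply: (@le_trans _ _ (step_cdf R j)); [exact: step_nn | rewrite lerDl].
have -> : step_cdf R N.+1 = step_cdf R N + step_mass R N.+1 by rewrite /step_cdf big_ord_recr.
have -> x : (trunc (qcoef R) N.+1).[x] = (trunc (qcoef R) N).[x] + qcoef R N.+1 * x ^+ N.+1.
  by rewrite !trunc_horner big_ord_recr.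
rewrite !mulrDr addrA lerD // /step_mass mulrCA -zE -exprM mulrCA.
rewrite [leRHS]mulrCA ler_wpM2l ?qcoef_ge0 //.
rewrite mul2n -addnn exprD mulrCA ler_wpM2r ?mulr_ge0 ?exprn_ge0 ?expR_ge0 ?(ltW z0) //.
by rewrite ler_wiXn2l ?(ltW z0) ?(ltW z1) // ltnW.
Qed.

(* The probability that [n] is a renewal epoch for steps of law [step_mass]. *)
Definition renewal (R : realType) (n : nat) : R :=
  \sum_(m < n.+1) expR 1 ^+ m * (trunc (qcoef R) n ^+ m)`_n * polya_radius R ^+ n.

Lemma qcoef0 (R : realType) : qcoef R 0 = 0.
Proof. by rewrite /qcoef. Qed.

Lemma step_mass0 (R : realType) : step_mass R 0 = 0.
Proof. by rewrite /step_mass qcoef0 mul0r mulr0. Qed.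

Lemma renewalE (R : realType) (n N M : nat) : (n <= N)%N -> (n < M)%N ->
  renewal R n =
  \sum_(m < M) expR 1 ^+ m * (trunc (qcoef R) N ^+ m)`_n * polya_radius R ^+ n.
Proof.
move=> nN nM; rewrite /renewal.
rewrite -!(big_mkord xpredT (fun m => expR 1 ^+ m * (trunc (qcoef R) _ ^+ m)`_n * polya_radius R ^+ n)).
rewrite [RHS](@big_cat_nat _ _ _ n.+1) //= [X in _ = _ + X]big1_seq ?addr0; last first.
  move=> m /andP[_]; rewrite mem_index_iota => /andP[nm _].
  by rewrite coef_exp_small ?mulr0 ?mul0r // coef_trunc qcoef0.
rewrite !big_nat; apply: eq_bigr => m _; congr (_ * _ * _).
apply: (coef_exp_eq (n := n)) => // i iN.
by rewrite !coef_trunc iN (leq_trans iN).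
Qed.

Lemma renewal_ge0 (R : realType) (n : nat) : 0 <= renewal R n.
Proof.
have [r0 _ _ _] := polya_radius_spec R.
apply: sumr_ge0 => m _; rewrite !mulr_ge0 ?exprn_ge0 ?expR_ge0 ?(ltW r0) //.
by apply: coef_exp_ge0 => i; apply: trunc_ge0; apply: qcoef_ge0.
Qed.

Lemma renewal0 (R : realType) : renewal R 0 = 1.
Proof. by rewrite /renewal big_ord1 !expr0 coef1 !mulr1. Qed.

Lemma renewalS (R : realType) (n : nat) :
  renewal R n.+1 = \sum_(k < n.+1) renewal R k * step_mass R (n.+1 - k).
Proof.
have -> : \sum_(k < n.+1) renewal R k * step_mass R (n.+1 - k) =
    \sum_(l < n.+2) step_mass R l * renewal R (n.+1 - l).
  rewrite [RHS](reindex_inj rev_ord_inj) [RHS]big_ord_recr /= subSS subnn.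
  rewrite step_mass0 mul0r addr0.
  by apply: eq_bigr => -[k kn] _ /=; rewrite !subSS subKn 1?mulrC // ltnW.
rewrite /renewal big_ord_recl expr0 coef1 mulr0 mul0r add0r.
transitivity (\sum_(m < n.+1) \sum_(l < n.+2) step_mass R l *
    (expR 1 ^+ m * (trunc (qcoef R) n.+1 ^+ m)`_(n.+1 - l) * polya_radius R ^+ (n.+1 - l))).
  apply: eq_bigr => m _; rewrite lift0 [expR 1 ^+ _]exprS [trunc _ _ ^+ _]exprS coefM.
  rewrite mulr_sumr mulr_suml; apply: eq_bigr => -[l /= ln] _.
  rewrite coef_trunc -ltnS ln /step_mass.
  have -> : polya_radius R ^+ n.+1 = polya_radius R ^+ l * polya_radius R ^+ (n.+1 - l).
    by rewrite -exprD subnKC // -ltnS.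
  by ring.
rewrite exchange_big; apply: eq_bigr => -[l /= ln] _; rewrite -mulr_sumr.
case: l ln => [|l] ln; first by rewrite step_mass0 !mul0r.
rewrite -(@renewalE R (n.+1 - l.+1) n.+1 n.+1) ?leq_subr // subSS.
by rewrite ltnS leq_subr.
Qed.

(* Decompose according to the last renewal epoch before [n]. *)
Lemma renewal_last (R : realType) (n : nat) :
  \sum_(k < n.+1) renewal R k * (1 - step_cdf R (n - k)) = 1.
Proof.
have cdf0 : step_cdf R 0 = 0.
  by rewrite /step_cdf big_ord1 step_mass0.
elim: n => [|n IH]; first by rewrite big_ord1 renewal0 cdf0 subr0 mulr1.
rewrite big_ord_recr /= subnn cdf0 subr0 mulr1 renewalS -big_split -[RHS]IH.
apply: eq_bigr => -[k /= kn] _; rewrite ltnS in kn; rewrite subSn //.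
by rewrite [in step_cdf R _.+1]/step_cdf big_ord_recr /= -/(step_cdf R (n - k)); ring.
Qed.

Lemma renewal_le1 (R : realType) (n : nat) : renewal R n <= 1.
Proof.
rewrite -(renewal_last R n) big_ord_recr /= subnn /step_cdf big_ord1.
rewrite step_mass0 subr0 mulr1 lerDr.
by apply: sumr_ge0 => k _; rewrite mulr_ge0 ?renewal_ge0 // subr_ge0 step_cdf_le1.
Qed.

Lemma step_mass1_gt0 (R : realType) : 0 < step_mass R 1.
Proof.
have [r0 _ _ _] := polya_radius_spec R.
have q0 : 0 < qcoef R 1 := lt_le_trans ltr01 (qcoef1_ge1 R).
by rewrite /step_mass expr1 (mulr_gt0 (expR_gt0 1) (mulr_gt0 q0 r0)).
Qed.

Lemma step_mass1_le1 (R : realType) : step_mass R 1 <= 1.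
Proof.
apply: le_trans (step_cdf_le1 R 1); rewrite /step_cdf big_ord_recr /= lerDr.
by apply: sumr_ge0 => l _; apply: step_mass_ge0.
Qed.

Lemma renewal_shift (R : realType) (n j : nat) :
  renewal R n * step_mass R 1 ^+ j <= renewal R (n + j).
Proof.
elim: j => [|j IH]; first by rewrite addn0 expr0 mulr1.
rewrite exprSr mulrA addnS renewalS big_ord_recr /= subSnn.
apply: (@le_trans _ _ (renewal R (n + j) * step_mass R 1)).
  by rewrite ler_wpM2r // step_mass_ge0.
by rewrite lerDr; apply: sumr_ge0 => k _; rewrite mulr_ge0 ?renewal_ge0 ?step_mass_ge0.
Qed.

Lemma exp_small (R : realType) (x d : R) : 0 < x -> x < 1 -> 0 < d ->
  exists K, x ^+ K <= d.
Proof.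
move=> x0 x1 d0; pose h := x^-1 - 1.
have h0 : 0 < h by rewrite subr_gt0 invf_gt1.
exists (Num.bound (d^-1 / h)); set K := Num.bound _.
have hK : d^-1 / h < K%:R by apply: archi_boundP; rewrite divr_ge0 ?invr_ge0 ?ltW.
rewrite -[x]invrK exprVn -[d]invrK lef_pV2 ?posrE ?exprn_gt0 ?invr_gt0 //.
have -> : x^-1 = 1 + h by rewrite /h; ring.
apply: le_trans (bernoulli_le K (ltW h0)).
by move: hK; rewrite ltr_pdivrMr // => /ltW/le_trans; apply; rewrite lerDr.
Qed.

Lemma geometric_sum_le (R : realType) (x : R) (N : nat) : 0 <= x -> x < 1 ->
  \sum_(0 <= i < N) x ^+ i <= (1 - x)^-1.
Proof.
move=> x0 x1; rewrite big_mkord -div1r ler_pdivlMr ?subr_gt0 //.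
by rewrite mulrC -opprB mulNr -subrX1 opprB gerBl exprn_ge0.
Qed.

(** By [renewal_last] and the exponential tail, the last epochs before [n] at distance less than [K]
    carry weight at least 1/2. From such an epoch, unit steps lead to [n] at a bounded cost. *)
Lemma renewal_lower (R : realType) : exists2 c : R, 0 < c & forall n, c <= renewal R n.
Proof.
have [z0 z1 _ _] := sqrt_radius_spec R.
pose b : R := expR 1 * sqrt_bound R.
have b0 : 0 < b by rewrite mulr_gt0 ?expR_gt0.
(* [K] makes the geometric tail [b * z^K / (1 - z)] at most 1/2. *)
have [K zK] : exists K, sqrt_radius R ^+ K <= (1 - sqrt_radius R) / (2 * b).
  apply: exp_small => //; apply: divr_gt0; [by rewrite subr_gt0 | exact: mulr_gt0].
pose p := step_mass R 1.
have p0 : 0 < p := step_mass1_gt0 R; have p1 : p <= 1 := step_mass1_le1 R.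
have pK : 0 < p ^+ K by rewrite exprn_gt0.
have K1 : 0 < K.+1%:R :> R by rewrite ltr0n.
exists (p ^+ K / (2 * K.+1%:R)) => [|n]; first by rewrite divr_gt0 // mulr_gt0.
case: (ltnP n K) => nK.
  apply: (@le_trans _ _ (p ^+ K)).
    rewrite ler_pdivrMr ?mulr_gt0 // ler_peMr ?(ltW pK) //.
    have : 1 <= K.+1%:R :> R by rewrite ler1n.
    lra.
  have := renewal_shift R 0 n; rewrite add0n renewal0 mul1r; apply: le_trans.
  by rewrite ler_wiXn2l ?(ltW p0) // ltnW.
have := renewal_last R n.
rewrite (reindex_inj rev_ord_inj) /=.
rewrite -(big_mkord xpredT (fun j => renewal R (n.+1 - j.+1) * (1 - step_cdf R (n - (n.+1 - j.+1))))).
rewrite (@big_cat_nat _ _ _ K) //=; last exact: leqW.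
move=> E.
have h1 : \sum_(0 <= j < K) renewal R (n.+1 - j.+1) * (1 - step_cdf R (n - (n.+1 - j.+1))) <=
    K%:R * (renewal R n / p ^+ K).
  apply: (@le_trans _ _ (\sum_(0 <= j < K) renewal R n / p ^+ K)); last first.
    by rewrite sumr_const_nat subn0 -[leLHS]mulr_natl.
  rewrite !big_nat; apply: ler_sum => j /= jK.
  rewrite subSS subKn; last by rewrite (leq_trans _ nK) // ltnW.
  apply: (@le_trans _ _ (renewal R (n - j))).
    rewrite ler_piMr ?renewal_ge0 // gerBl; apply: sumr_ge0 => l _; exact: step_mass_ge0.
  rewrite ler_pdivlMr //; have := renewal_shift R (n - j) j.
  rewrite subnK; last by rewrite (leq_trans _ nK) // ltnW.
  apply: le_trans; rewrite ler_wpM2l ?renewal_ge0 // ler_wiXn2l ?(ltW p0) //.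
  exact: ltnW.
have h2 : \sum_(K <= j < n.+1) renewal R (n.+1 - j.+1) * (1 - step_cdf R (n - (n.+1 - j.+1))) <=
    1 / 2.
  apply: (@le_trans _ _ (\sum_(K <= j < n.+1) b * sqrt_radius R ^+ j)).
    rewrite !big_nat; apply: ler_sum => j /andP[Kj jn].
    rewrite subSS subKn // -[leRHS]mul1r; apply: ler_pM.
    - exact: renewal_ge0.
    - by rewrite subr_ge0 step_cdf_le1.
    - exact: renewal_le1.
    - exact: step_tail_le.
  rewrite -mulr_sumr -[K]add0n big_addn.
  rewrite (eq_bigr (fun i => sqrt_radius R ^+ i * sqrt_radius R ^+ K)); last first.
    by move=> i _; rewrite exprD.
  rewrite -mulr_suml.
  apply: (@le_trans _ _ (b * ((1 - sqrt_radius R)^-1 * ((1 - sqrt_radius R) / (2 * b))))).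
    rewrite ler_wpM2l ?(ltW b0) //; apply: ler_pM => //.
    - by apply: sumr_ge0 => i _; rewrite exprn_ge0 // ltW.
    - by rewrite exprn_ge0 // ltW.
    - exact: geometric_sum_le (ltW z0) z1.
  rewrite mulKf ?subr_eq0 ?gt_eqF //.
  have -> : b * (2 * b)^-1 = 1 / 2 by field; rewrite gt_eqF.
  by [].
have v0 := renewal_ge0 R n.
have h3 : 1 / 2 <= K.+1%:R * (renewal R n / p ^+ K).
  have : K%:R * (renewal R n / p ^+ K) <= K.+1%:R * (renewal R n / p ^+ K).
    by rewrite ler_wpM2r ?ler_nat // divr_ge0 // ltW.
  lra.
rewrite ler_pdivrMr ?mulr_gt0 //.
move: h3; rewrite mulrA ler_pdivlMr // => h3.
move: h3; rewrite mulrC; lra.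
Qed.

(** The left-out weight [stirling R m / m] of the term [m] decreases in [m]; replacing it by its
    value at [n] leaves the renewal sum. *)
Lemma tcoef_lower (R : realType) : exists2 c : R, 0 < c &
  forall n, (0 < n)%N -> c * (stirling R n / n%:R) <= tcoef R n * polya_radius R ^+ n.
Proof.
have [c c0 hc] := renewal_lower R; have [r0 _ _ _] := polya_radius_spec R.
exists c => // n n0; have n0' : 0 < n%:R :> R by rewrite ltr0n.
have w0 : 0 <= stirling R n / n%:R by rewrite divr_ge0 // ltW // stirling_gt0.
apply: (@le_trans _ _ (renewal R n * (stirling R n / n%:R))).
  by rewrite ler_wpM2r.
rewrite tcoefE /tree_coef /renewal !mulr_suml; apply: ler_sum => -[[|m] /= mn] _.
  by rewrite expr0 coef1 gtn_eqF // !(mulr0, mul0r).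
rewrite ltnS in mn; rewrite tau_stirling //.
set q := (trunc (qcoef R) n ^+ m.+1)`_n; rewrite [leRHS](_ : _ = expR 1 ^+ m.+1 * q * polya_radius R ^+ n *
  (stirling R m.+1 / m.+1%:R)); last by ring.
rewrite ler_wpM2l //.
  rewrite !mulr_ge0 ?exprn_ge0 ?expR_ge0 ?(ltW r0) //.
  by apply: coef_exp_ge0 => i; apply: trunc_ge0; apply: qcoef_ge0.
have m0 : 0 < m.+1%:R :> R by rewrite ltr0n.
apply: ler_pM; rewrite ?invr_ge0 ?(ltW n0') //; first exact/ltW/stirling_gt0.
  exact: stirling_le.
by rewrite lef_pV2 ?posrE // ler_nat.
Qed.

(** Keeps the shifted point of [avoid_size_le] below the square root of [rho], where the chord bound
    is valid. *)
Lemma removed_mass_le (R : realType) (k : nat) :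
  qcoef R k.+1 * polya_radius R ^+ k.+1 / chord_slope R <= sqrt_radius R - polya_radius R.
Proof.
have [r0 _ _ _] := polya_radius_spec R; have [z0 z1 zE rz] := sqrt_radius_spec R.
rewrite ler_pdivrMr ?chord_slope_gt0 // /chord_slope [leRHS]mulrC divfK; last first.
  by rewrite subr_eq0 gt_eqF.
apply: (@le_trans _ _ (qcoef R k.+1 * sqrt_radius R ^+ k.+1)).
  by rewrite ler_wpM2l ?qcoef_ge0 // lerXn2r ?nnegrE ?ltW.
apply: le_trans (qcoef_sqrt_le R k.+1); rewrite trunc_horner big_ord_recr /= lerDr.
by apply: sumr_ge0 => l _; rewrite mulr_ge0 ?qcoef_ge0 ?exprn_ge0 // ltW.
Qed.

(* Removing the D-forests of size [k] leaves room to move slightly beyond the radius. *)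
Lemma avoid_size_le (R : realType) (n k : nat) : (k < n)%N ->
  #|marked_trees n (fun l => l != k)|%:R / n`!%:R *
   (polya_radius R + qcoef R k.+1 * polya_radius R ^+ k.+1 / chord_slope R) ^+ n <= 9.
Proof.
move=> kn; have [r0 _ [_ ar] _] := polya_radius_spec R.
have [z0 z1 zE rz] := sqrt_radius_spec R; have L0 := chord_slope_gt0 R.
set a := qcoef R k.+1 * _; set y := polya_radius R + _.
have a0 : 0 <= a by rewrite mulr_ge0 ?qcoef_ge0 ?exprn_ge0 // ltW.
have ry : polya_radius R <= y by rewrite lerDl divr_ge0 // ltW.
have y0 : 0 <= y by apply: le_trans ry; apply: ltW.
have yz : y <= sqrt_radius R by rewrite /y -lerBrDl removed_mass_le.
pose q l := if l.-1 != k then qcoef R l else 0.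
have q0 l : 0 <= q l by rewrite /q; case: ifP => // _; apply: qcoef_ge0.
rewrite (@tree_coef_marked R n (fun l => l != k)) ?(leq_ltn_trans _ kn) //.
apply: tree_coef_le => //; first by rewrite /q; case: ifP.
apply: le_trans (ar n); rewrite ler_wpM2l ?expR_ge0 //.
have qE : (trunc q n).[y] = (trunc (qcoef R) n).[y] - qcoef R k.+1 * y ^+ k.+1.
  rewrite !trunc_horner (bigD1 (Ordinal (kn : (k.+1 < n.+1)%N))) //=.
  rewrite {1}/q /= eqxx mul0r add0r [in RHS](bigD1 (Ordinal (kn : (k.+1 < n.+1)%N))) //=.
  rewrite addrAC subrr add0r; apply: eq_bigr => -[[|l] ln] /=.
    by move=> _; rewrite /q qcoef0; case: ifP.
  by rewrite -val_eqE /= eqSS => lk; rewrite /q /= lk.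
have -> : trunc (fun l => if l.-1 != k then qcoef R l else 0) n = trunc q n by [].
(* Along the chord [Q] rises by at most [a], the removed term at [rho], and at [y] the removed term
   is at least [a]. *)
rewrite qE lerBlDr; apply: le_trans (qcoef_chord n ry yz) _.
rewrite lerD2l /y addrAC subrr add0r mulrC divfK ?gt_eqF //.
by rewrite /a ler_wpM2l ?qcoef_ge0 // lerXn2r ?nnegrE // ltW.
Qed.

(** A coefficientwise mean value inequality: one of the [m] factors is taken from [a - b], and the
    others are enlarged to [a]. *)
Lemma coef_exp_diff_le (R : realType) (a b : {poly R}) (m n : nat) :
  (forall i, 0 <= b`_i <= a`_i) ->
  (a ^+ m)`_n - (b ^+ m)`_n <= m%:R * ((a - b) * a ^+ m.-1)`_n.
Proof.
move=> ba; have b0 i : 0 <= b`_i by have /andP[] := ba i.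
have a0 i : 0 <= a`_i by have /andP[] := ba i; apply: le_trans.
have d0 i : 0 <= (a - b)`_i by rewrite coefB subr_ge0; have /andP[] := ba i.
elim: m n => [|m IH] n; first by rewrite !expr0 subrr mul0r.
rewrite -coefB.
have -> : a ^+ m.+1 - b ^+ m.+1 = (a - b) * a ^+ m + b * (a ^+ m - b ^+ m).
  by rewrite !exprS; ring.
rewrite coefD [leRHS](_ : _ = m%:R * ((a - b) * a ^+ m)`_n + ((a - b) * a ^+ m)`_n); last first.
  by rewrite -natr1 [LHS]mulrDl mul1r.
rewrite addrC lerD2r /=.
case: m IH => [|m] IH; first by rewrite !expr0 subrr mulr0 coef0 mul0r.
apply: (@le_trans _ _ (a * (m.+1%:R *: ((a - b) * a ^+ m)))`_n).
  rewrite !coefM; apply: ler_sum => i _; apply: ler_pM => //.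
  - rewrite coefB subr_ge0; apply: coef_exp_le => j; exact: ba.
  - by have /andP[] := ba i.
  - by rewrite coefB coefZ; apply: IH.
by rewrite -scalerAr coefZ exprS; have -> : a * ((a - b) * a ^+ m) = (a - b) * (a * a ^+ m) by ring.
Qed.

Lemma tau_le (R : realType) (m : nat) : tau R m <= expR 1 ^+ m.
Proof.
have [->|m0] := posnP m; first by rewrite /tau eqxx expr0.
have m1 : 1 <= m%:R :> R by rewrite ler1n.
rewrite tau_stirling // ler_piMl ?exprn_ge0 ?expR_ge0 // ler_pdivrMr ?ltr0n // mul1r.
apply: le_trans m1; apply: (le_trans (stirling_le R (ltn0Sn 0) m0)); rewrite stirling1.
by rewrite invf_le1 ?expR_gt0 // -expR0 ler_expR.
Qed.

(** One marked large step is followed by a renewal epoch at the remaining distance. The latter has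
    probability at most 1, so only the mass of the large steps remains. *)
Lemma renewal_tail_le (R : realType) (n M : nat) (p := trunc (qcoef R) n)
    (p' := trunc (fun l => if (l.-1 <= M)%N then qcoef R l else 0) n) :
  \sum_(m < n) expR 1 ^+ m.+1 * ((p - p') * p ^+ m)`_n * polya_radius R ^+ n <=
  expR 1 * sqrt_bound R * sqrt_radius R ^+ M.+1.
Proof.
have [r0 _ _ _] := polya_radius_spec R; have [z0 z1 zE _] := sqrt_radius_spec R.
have gE l : (p - p')`_l = if (l <= n)%N && (M < l.-1)%N then qcoef R l else 0.
  rewrite coefB !coef_trunc; case: ifP => _ /=; last by rewrite subrr.
  by rewrite ltnNge; case: ifP; rewrite ?subrr ?subr0.
have g0 l : 0 <= (p - p')`_l by rewrite gE; case: ifP => // _; apply: qcoef_ge0.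
apply: (@le_trans _ _ (\sum_(l < n.+1) expR 1 * ((p - p')`_l * polya_radius R ^+ l))).
  rewrite (eq_bigr (fun m : 'I_n => \sum_(l < n.+1)
    expR 1 * ((p - p')`_l * polya_radius R ^+ l) *
     (expR 1 ^+ m * (p ^+ m)`_(n - l) * polya_radius R ^+ (n - l)))); last first.
    move=> m _; rewrite coefM mulr_sumr mulr_suml; apply: eq_bigr => -[l /= ln] _.
    have -> : polya_radius R ^+ n = polya_radius R ^+ l * polya_radius R ^+ (n - l).
      by rewrite -exprD subnKC // -ltnS.
    by rewrite exprS; ring.
  rewrite exchange_big; apply: ler_sum => -[l /= ln] _; rewrite -mulr_sumr.
  rewrite ler_piMr //; first by rewrite !mulr_ge0 ?expR_ge0 ?exprn_ge0 // ltW.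
  case: l ln => [|l] ln.
    apply: le_trans (renewal_le1 R n); rewrite subn0 /renewal [leRHS]big_ord_recr /= lerDl.
    rewrite !mulr_ge0 ?exprn_ge0 ?expR_ge0 ?(ltW r0) //.
    by apply: coef_exp_ge0 => i; apply: trunc_ge0; apply: qcoef_ge0.
  rewrite -(@renewalE R (n - l.+1) n n) ?leq_subr ?renewal_le1 //.
  by rewrite ltn_subrL /= -ltnS (leq_ltn_trans _ ln).
rewrite -mulr_sumr -mulrA ler_wpM2l ?expR_ge0 //.
apply: (@le_trans _ _ ((trunc (qcoef R) n).[sqrt_radius R] * sqrt_radius R ^+ M.+1)).
  rewrite trunc_horner mulr_suml; apply: ler_sum => -[l /= ln] _.
  rewrite gE -ltnS ln /=; case: ifP => Ml.
    rewrite -mulrA ler_wpM2l ?qcoef_ge0 // -zE -exprM mul2n -addnn exprD.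
    rewrite ler_wpM2l ?exprn_ge0 ?(ltW z0) // ler_wiXn2l ?(ltW z0) ?(ltW z1) //.
    by rewrite (leq_trans Ml) // leq_pred.
  by rewrite mul0r !mulr_ge0 ?qcoef_ge0 ?exprn_ge0 // ltW.
by rewrite ler_wpM2r ?qcoef_sqrt_le // exprn_ge0 // ltW.
Qed.

(** [y] is the fourth root of [rho]. C-trees with at least [n / D] nodes are compared with the
    renewal sum containing a marked step; smaller ones are bounded through [Q] at the square root of
    [rho]. The factor [stirling R n] is kept to cancel against [tcoef_lower]. *)
Lemma large_size_le (R : realType) (D : nat) (y : R) :
  0 < y -> y <= 1 -> y ^+ 2 = sqrt_radius R -> y ^+ D * (expR 1 * sqrt_bound R) <= 1 ->
  forall n M, (0 < n)%N ->
  (tcoef R n - #|marked_trees n (fun l => (l <= M)%N)|%:R / n`!%:R) * polya_radius R ^+ n <=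
  D%:R * stirling R n * (expR 1 * sqrt_bound R * sqrt_radius R ^+ M.+1) + n%:R * y ^+ n.
Proof.
move=> y0 y1 yz yD n M n0; have [r0 _ _ _] := polya_radius_spec R.
have [z0 z1 zE _] := sqrt_radius_spec R; have e0 : 0 < expR 1 :> R := expR_gt0 1.
rewrite (@tree_coef_marked R n (fun l => (l <= M)%N)) // tcoefE /tree_coef.
set p := trunc (qcoef R) n; set p' := trunc _ n.
have p0 i : 0 <= p`_i by apply: trunc_ge0; apply: qcoef_ge0.
have pp' i : 0 <= p'`_i <= p`_i.
  rewrite !coef_trunc; case: ifP => _; last by rewrite lexx.
  by case: ifP => _; rewrite ?qcoef_ge0 lexx.
have d0 i : 0 <= (p - p')`_i by rewrite coefB subr_ge0; have /andP[] := pp' i.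
have s0 : 0 < stirling R n := stirling_gt0 R n0.
have dp0 m i : 0 <= ((p - p') * p ^+ m)`_i.
  by apply: coef_mul_ge0 => // j; apply: coef_exp_ge0.
rewrite -sumrB mulr_suml big_ord_recl {1 2}/tau /= !mul0r subrr mul0r add0r.
apply: (@le_trans _ _ (\sum_(m < n) (D%:R * stirling R n *
   (expR 1 ^+ m.+1 * ((p - p') * p ^+ m)`_n * polya_radius R ^+ n) + y ^+ n))); last first.
  rewrite big_split -mulr_sumr sumr_const card_ord -[y ^+ n *+ n]mulr_natl.
  by rewrite lerD2r ler_wpM2l ?mulr_ge0 ?(ltW s0) //; apply: renewal_tail_le.
apply: ler_sum => -[m /= mn] _; rewrite /bump leq0n add1n -mulrBr.
have rn0 : 0 <= polya_radius R ^+ n by rewrite exprn_ge0 // ltW.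
case: (leqP n (m.+1 * D)) => mD.
  rewrite -[leLHS]addr0 lerD ?exprn_ge0 ?(ltW y0) //.
  have m0 : 0 < m.+1%:R :> R by rewrite ltr0n.
  (* The factor from marking cancels the denominator in [tau]. With [k = m.+1],
     [k * stirling R k <= n * stirling R n] and [n <= k * D] do the rest. *)
  have key : tau R m.+1 * m.+1%:R <= D%:R * stirling R n * expR 1 ^+ m.+1.
    rewrite tau_stirling // mulrAC ler_wpM2r ?exprn_ge0 ?(ltW e0) //.
    rewrite divfK ?gt_eqF // -(ler_pM2l m0).
    apply: le_trans (mul_stirling_le R (ltn0Sn m) mn) _.
    have -> : m.+1%:R * (D%:R * stirling R n) = (m.+1 * D)%:R * stirling R n.
      by rewrite natrM; ring.
    by rewrite ler_wpM2r ?(ltW s0) // ler_nat.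
  apply: (@le_trans _ _ (tau R m.+1 * (m.+1%:R * ((p - p') * p ^+ m)`_n) * polya_radius R ^+ n)).
    by rewrite ler_wpM2r // ler_wpM2l ?tau_ge0 //; apply: (coef_exp_diff_le m.+1).
  set X := ((p - p') * p ^+ m)`_n.
  have -> : tau R m.+1 * (m.+1%:R * X) * polya_radius R ^+ n =
    tau R m.+1 * m.+1%:R * (X * polya_radius R ^+ n) by ring.
  have -> : D%:R * stirling R n * (expR 1 ^+ m.+1 * X * polya_radius R ^+ n) =
    D%:R * stirling R n * expR 1 ^+ m.+1 * (X * polya_radius R ^+ n) by ring.
  by apply: ler_wpM2r key; apply: mulr_ge0 => //; apply: dp0.
rewrite -[leLHS]add0r lerD //.
  have Ds : 0 <= D%:R * stirling R n by apply: mulr_ge0 => //; apply: ltW.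
  by apply: mulr_ge0 Ds _; rewrite !mulr_ge0 ?exprn_ge0 ?(ltW e0) ?dp0 ?(ltW r0).
apply: (@le_trans _ _ (expR 1 ^+ m.+1 * (p ^+ m.+1)`_n * polya_radius R ^+ n)).
  rewrite ler_wpM2r //; apply: ler_pM; rewrite ?tau_ge0 ?tau_le //.
    by rewrite subr_ge0; apply: coef_exp_le.
  by rewrite gerBl coef_exp_ge0 // => i; have /andP[] := pp' i.
have h1 : (p ^+ m.+1)`_n * sqrt_radius R ^+ n <= sqrt_bound R ^+ m.+1.
  apply: (@le_trans _ _ ((p ^+ m.+1).[sqrt_radius R])).
    apply: coef_le_horner; last exact: ltW.
    by move=> i; apply: coef_exp_ge0.
  rewrite horner_exp lerXn2r ?nnegrE ?qcoef_sqrt_le ?expR_ge0 //.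
  by apply: trunc_horner_ge0; [exact: qcoef_ge0 | exact: ltW].
have yDm : (y ^+ D * (expR 1 * sqrt_bound R)) ^+ m.+1 <= 1.
  by rewrite exprn_ile1 // mulr_ge0 ?exprn_ge0 ?mulr_ge0 ?expR_ge0 // ltW.
(* Of [rho^n = z^n * z^n], one factor is spent on [h1]. Of [z^n = y^n * y^n], one factor absorbs the
   powers of [e * sqrt_bound R]. *)
rewrite -zE -exprM mul2n -addnn exprD mulrA -(mulrA (_ ^+ m.+1)).
apply: (@le_trans _ _ (expR 1 ^+ m.+1 * sqrt_bound R ^+ m.+1 * sqrt_radius R ^+ n)).
  by rewrite ler_wpM2r ?exprn_ge0 ?(ltW z0) // ler_wpM2l ?exprn_ge0 ?(ltW e0).
rewrite -exprMn -yz -exprM mul2n -addnn exprD mulrA -[leRHS]mul1r.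
rewrite ler_wpM2r ?exprn_ge0 ?(ltW y0) //; apply: le_trans yDm.
rewrite [leRHS]exprMn [leRHS]mulrC ler_wpM2l //.
  by rewrite exprn_ge0 // mulr_ge0 ?expR_ge0.
by rewrite -exprM mulnC ler_wiXn2l ?(ltW y0) // ltnW.
Qed.

(** * Concentration of the maximum *)

Lemma exprn_expR (R : realType) (a : R) (n : nat) : 0 < a -> a ^+ n = expR (n%:R * ln a).
Proof. by move=> a0; rewrite expRM_natl lnK. Qed.

Lemma expR_ge_sqr (R : realType) (x : R) : 0 <= x -> x ^+ 2 / 2 <= expR x.
Proof.
move=> x0; have := expR_ge1Dxn 1 x0; apply: le_trans.
by rewrite (_ : 2`!%:R = 2 :> R) // lerDr.
Qed.

Lemma ln_nat_ge1 (R : realType) (n : nat) : 1 <= ln (n%:R : R) -> (0 < n)%N.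
Proof. by case: n => // /le_trans/(_ (ln_le0 ler01)); rewrite ler10. Qed.

Lemma ln_sqrt_radius (R : realType) : ln (sqrt_radius R) = ln (polya_radius R) / 2.
Proof.
have [z0 _ <- _] := sqrt_radius_spec R.
by rewrite lnXn // -[ln _ *+ 2]mulr_natr mulfK.
Qed.

Lemma powR_subr (R : realType) (x s : R) : 0 < x -> x `^ (- s) * x = x `^ (1 - s).
Proof.
move=> x0; rewrite -[X in _ * X](powRr1 (ltW x0)) -powRD 1?addrC //.
by apply/implyP => _; rewrite gt_eqF.
Qed.

Lemma stirling_ge (R : realType) (n : nat) : (0 < n)%N -> (expR 1)^-1 <= n%:R * stirling R n.
Proof. by move=> n0; have := mul_stirling_le R (ltn0Sn 0) n0; rewrite mul1r stirling1. Qed.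

(** The cube arises because [n * y^n] in [large_size_le] is divided by [t_n rho^n], which is bounded
    below by a multiple of [n^(-2)]. *)
Lemma cube_exp_le (R : realType) (y : R) : 0 < y -> y < 1 -> exists X : R, forall n,
  1 <= ln (n%:R : R) -> X <= ln (n%:R : R) -> n%:R ^+ 3 * y ^+ n <= expR (- ln (n%:R : R)).
Proof.
move=> y0 y1; have l0 : ln y < 0 by rewrite ln_lt0 // y0.
(* [n >= (ln n)^2 / 2] yields [4 * ln n <= n * (- ln y)] from this point on. *)
exists (8 / - ln y) => n x1 xX; have n0 := ln_nat_ge1 x1.
have nE : n%:R = expR (ln (n%:R : R)) by rewrite lnK // posrE ltr0n.
have n0' : 0 < n%:R :> R by rewrite ltr0n.
rewrite (exprn_expR 3 n0') (exprn_expR n y0) -expRD ler_expR.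
have := @expR_ge_sqr R (ln n%:R) (le_trans ler01 x1); rewrite -nE.
move: xX; rewrite ler_pdivrMr ?oppr_gt0 // => xX h.
have {h} : ln n%:R ^+ 2 / 2 * - ln y <= n%:R * - ln y by rewrite ler_wpM2r // oppr_ge0 ltW.
have : ln n%:R * 8 <= ln n%:R * (ln n%:R * - ln y) by rewrite ler_wpM2l // (le_trans ler01 x1).
move=> h1 h2; nra.
Qed.

Lemma upper_tail (R : realType) (s : R) : exists C X : R, 0 <= C /\ forall n,
  1 <= ln (n%:R : R) -> X <= ln (n%:R : R) ->
  1 - decomp_prob R (@forest_event n (fun l => (l <= Num.truncn
     ((1 + ln n%:R `^ (- s)) * (- 2 * ln n%:R / ln (polya_radius R))))%N)) <=
  C * (expR (- ln n%:R `^ (1 - s)) + expR (- ln n%:R)).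
Proof.
have [r0 r1 _ _] := polya_radius_spec R; have [z0 z1 zE _] := sqrt_radius_spec R.
have e0 : 0 < expR 1 :> R := expR_gt0 1.
have lr0 : ln (polya_radius R) < 0 by rewrite ln_lt0 // r0.
have [c c0 hc] := tcoef_lower R.
pose y := Num.sqrt (sqrt_radius R).
have y0 : 0 < y by rewrite sqrtr_gt0.
have yE : y ^+ 2 = sqrt_radius R by rewrite sqr_sqrtr // ltW.
have y1 : y < 1 by rewrite -(@ltr_pXn2r _ 2) ?nnegrE ?ltW // yE expr1n.
pose b := expR 1 * sqrt_bound R; have b0 : 0 < b by rewrite mulr_gt0 ?expR_gt0.
have [D yD] : exists D, y ^+ D <= b^-1 by apply: exp_small; rewrite ?invr_gt0.
have {}yD : y ^+ D * b <= 1 by rewrite -ler_pdivlMr // div1r.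
have [X hX] := cube_exp_le y0 y1.
have C0 : 0 <= (D%:R * b + expR 1) / c.
  by rewrite divr_ge0 ?(ltW c0) // addr_ge0 ?(ltW e0) // mulr_ge0 // ltW.
exists ((D%:R * b + expR 1) / c), X; split; first exact: C0.
move=> n; set x := ln n%:R; set m := - 2 * x / _ => x1 xX.
have n0 := ln_nat_ge1 x1; have n0' : 0 < n%:R :> R by rewrite ltr0n.
have x0 : 0 < x := lt_le_trans ltr01 x1.
have nE : n%:R = expR x by rewrite lnK.
set M := Num.truncn _.
have m0 : 0 <= (1 + x `^ (- s)) * m.
  have -> : m = 2 * x / - ln (polya_radius R) by rewrite /m invrN mulrN !mulNr.
  have p1 : 0 <= 1 + x `^ (- s) by rewrite addr_ge0 ?powR_ge0.
  by apply: mulr_ge0 p1 _; rewrite divr_ge0 ?mulr_ge0 ?oppr_ge0 // ltW.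
have /andP[_ hM] := truncn_itv m0; rewrite -/M in hM.
(* [M.+1] exceeds the threshold, at which the left side would be exactly [exp (- x^(1-s))]. *)
have E1 : n%:R * sqrt_radius R ^+ M.+1 <= expR (- x `^ (1 - s)).
  rewrite exprn_expR // {1}nE -expRD ler_expR ln_sqrt_radius -powR_subr //.
  have : M.+1%:R * (ln (polya_radius R) / 2) <=
      (1 + x `^ (- s)) * m * (ln (polya_radius R) / 2).
    by rewrite ler_wnM2r ?(ltW hM) // pmulr_lle0 // ltW.
  have -> : (1 + x `^ (- s)) * m * (ln (polya_radius R) / 2) = - x - x `^ (- s) * x.
    by rewrite /m; field; rewrite lt_eqF.
  lra.
have E2 := hX n x1 xX; rewrite -/x in E2.
have s0 := stirling_gt0 R n0; have sn := stirling_ge R n0.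
have ht := hc n n0.
have w0 : 0 < stirling R n / n%:R by apply: divr_gt0.
have rn0 : 0 < polya_radius R ^+ n by rewrite exprn_gt0.
have t0 : 0 < tcoef R n.
  rewrite -(pmulr_lgt0 _ rn0); apply: lt_le_trans ht; exact: mulr_gt0.
rewrite decomp_probE -/(tcoef R n) -{1}(@mulfV _ (tcoef R n)) ?gt_eqF // -mulrBl.
rewrite ler_pdivrMr // -(ler_pM2r rn0).
apply: le_trans (large_size_le y0 (ltW y1) yE yD M n0) _; rewrite -/b.
set F := _ + expR (- x); have F0 : 0 <= F by rewrite addr_ge0 ?expR_ge0.
rewrite -[leRHS]mulrA.
(* In the lower bound for [t_n rho^n], [stirling R n] cancels that of the main term and leaves just
   the factor [n] of [E1]. *)
apply: (@le_trans _ _ ((D%:R * b + expR 1) / c * F * (c * (stirling R n / n%:R)))); last first.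
  by apply: ler_wpM2l ht; apply: mulr_ge0.
have -> : (D%:R * b + expR 1) / c * F * (c * (stirling R n / n%:R)) =
  D%:R * b * F * (stirling R n / n%:R) + expR 1 * F * (stirling R n / n%:R).
  by field; rewrite !gt_eqF.
have nn0 : n%:R != 0 :> R by rewrite gt_eqF.
have alg1 (d S q Z k : R) : k != 0 -> d * S * (q * Z) = d * q * (k * Z) * (S / k).
  by move=> k0; field.
have alg2 (q f S k : R) : k != 0 -> q * f * (S / k) * k ^+ 2 = f * (q * (k * S)).
  by move=> k0; field.
apply: lerD.
  have -> : D%:R * stirling R n * (b * sqrt_radius R ^+ M.+1) =
    D%:R * b * (n%:R * sqrt_radius R ^+ M.+1) * (stirling R n / n%:R).
    by apply: alg1.
  apply: ler_wpM2r; first exact: ltW.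
  apply: ler_wpM2l; first by rewrite mulr_ge0 // ltW.
  by apply: le_trans E1 _; rewrite lerDl expR_ge0.
have -> : n%:R * y ^+ n = (n%:R ^+ 3 * y ^+ n) / n%:R ^+ 2.
  have alg3 (k Z : R) : k != 0 -> k * Z = k ^+ 3 * Z / k ^+ 2 by move=> k0; field.
  by apply: alg3.
have n2 : 0 < n%:R ^+ 2 :> R by rewrite exprn_gt0.
rewrite ler_pdivrMr //.
have -> : expR 1 * F * (stirling R n / n%:R) * n%:R ^+ 2 = F * (expR 1 * (n%:R * stirling R n)).
  by apply: alg2.
apply: le_trans E2 _; rewrite -[leLHS]mulr1; apply: ler_pM => //.
  by rewrite lerDr expR_ge0.
by rewrite mulrC -ler_pdivrMr // div1r.
Qed.

Lemma qcoef_ge_tcoef (R : realType) (j : nat) : tcoef R j / 2 <= qcoef R (2 * j).+1.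
Proof.
rewrite /qcoef /= ler_pdivlMr ?ltr0n ?fact_gt0 // mulrAC ler_pdivrMr //.
by rewrite /tcoef -!natrM ler_nat mulnC dtree_count_ge.
Qed.

(* Two copies of one tree of size [j], exchanged by the automorphism, already give
   a D-forest of size [2 j]. *)
Lemma qcoef_even_lower (R : realType) : exists2 c : R, 0 < c & forall j, (0 < j)%N ->
  c / j%:R ^+ 2 * polya_radius R ^+ j <= qcoef R (2 * j).+1 * polya_radius R ^+ (2 * j).+1.
Proof.
have [r0 r1 _ _] := polya_radius_spec R; have e0 : 0 < expR 1 :> R := expR_gt0 1.
have [c c0 hc] := tcoef_lower R; set rho := polya_radius R in r0 r1 hc *.
exists (c * rho / (2 * expR 1)) => [|j j0]; first by rewrite divr_gt0 ?mulr_gt0.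
have j0' : 0 < j%:R :> R by rewrite ltr0n.
have jn0 : j%:R != 0 :> R by rewrite gt_eqF.
have sj := stirling_ge R j0; have tj := hc j j0.
have rj : 0 <= rho ^+ j by rewrite exprn_ge0 // ltW.
have h1 : c * ((expR 1)^-1 / j%:R ^+ 2) <= tcoef R j * rho ^+ j.
  apply: le_trans tj; apply: ler_wpM2l; first exact: ltW.
  rewrite ler_pdivrMr ?exprn_gt0 //; apply: le_trans sj _.
  have alg (S k : R) : k != 0 -> k * S = S / k * k ^+ 2 by move=> k0; field.
  by rewrite (alg (stirling R j) _ jn0).
apply: (@le_trans _ _ (tcoef R j / 2 * rho ^+ (2 * j).+1)); last first.
  by rewrite ler_wpM2r ?exprn_ge0 ?qcoef_ge_tcoef // ltW.
have -> : tcoef R j / 2 * rho ^+ (2 * j).+1 = (tcoef R j * rho ^+ j) * (rho / 2 * rho ^+ j).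
  by rewrite exprS mul2n -addnn exprD; field.
have -> : c * rho / (2 * expR 1) / j%:R ^+ 2 * rho ^+ j =
    c * ((expR 1)^-1 / j%:R ^+ 2) * (rho / 2 * rho ^+ j).
  by field; rewrite jn0 gt_eqF.
by rewrite ler_wpM2r // mulr_ge0 // divr_ge0 // ltW.
Qed.

(** [r / (r + m) = 1 - m / (r + m) <= exp (- m / z)]: a shift of the evaluation point becomes an
    exponential gain. *)
Lemma shift_ratio_le (R : realType) (r m z : R) (n : nat) :
  0 < r -> 0 <= m -> r + m <= z -> r ^+ n <= (r + m) ^+ n * expR (- (n%:R * (m / z))).
Proof.
move=> r0 m0 rmz; have rm0 : 0 < r + m by rewrite ltr_pwDl.
have z0 : 0 < z := lt_le_trans rm0 rmz.
rewrite -mulrN expRM_natl -exprMn; apply: lerXn2r; rewrite ?nnegrE ?(ltW r0) //.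
  by rewrite mulr_ge0 ?expR_ge0 // ltW.
apply: (@le_trans _ _ ((r + m) * (1 - m / z))); last first.
  by rewrite ler_wpM2l ?(ltW rm0) //; apply: expR_ge1Dx.
have : m / z * (r + m) <= m by rewrite -mulrA ler_piMr // mulrC ler_pdivrMr // mul1r.
rewrite mulrBr mulr1 [(r + m) * _]mulrC; lra.
Qed.

(** Of the four powers of [x], two pay for the square of the half size [j], of order [x]; the other
    two beat the multiple of [x] required in the exponent. *)
Lemma expR_powR_lower (R : realType) (a : R) : 0 < a -> exists2 c : R, 0 < c &
  forall x, 1 <= x -> c * x ^+ 4 <= expR (x `^ a).
Proof.
move=> a0; pose r := (Num.bound (4 / a)).+1.
have hr : 4 <= a * r%:R.
  rewrite mulrC -ler_pdivrMr //; apply: le_trans (ltW (archi_boundP _)) _.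
    by rewrite divr_ge0 // ltW.
  by rewrite ler_nat /r.
exists (r`!%:R)^-1 => [|x x1]; first by rewrite invr_gt0 ltr0n fact_gt0.
have x0 : 0 <= x by lra.
have := expR_ge1Dxn r.-1 (powR_ge0 x a); rewrite -/r => h.
apply: le_trans h; rewrite /r /= -/r mulrC; apply: (@le_trans _ _ ((x `^ a) ^+ r / r`!%:R)); last first.
  by rewrite lerDr.
rewrite ler_wpM2r ?invr_ge0 // -powR_mulrn ?powR_ge0 // -powRrM -powR_mulrn //.
exact: ler_powR.
Qed.

(** The avoided size is the least even number above the lower threshold: even, so that pairs of
    equal trees produce it, and above, so that a D-forest of this size settles the lower bound for
    the maximum. *)
Lemma lower_tail (R : realType) (s : R) : 0 < s -> s < 1 -> exists C X : R, 0 <= C /\ forall n,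
  1 <= ln (n%:R : R) -> X <= ln (n%:R : R) ->
  decomp_prob R (@forest_event n (fun l => l != (2 * (Num.truncn
     ((1 - ln n%:R `^ (- s)) * (- 2 * ln n%:R / ln (polya_radius R)) / 2)).+1)%N)) <=
  C * expR (- ln n%:R).
Proof.
move=> s0 s1; have [r0 r1 _ _] := polya_radius_spec R; have [z0 z1 zE rz] := sqrt_radius_spec R.
have e0 : 0 < expR 1 :> R := expR_gt0 1; have L0 := chord_slope_gt0 R.
have lr0 : ln (polya_radius R) < 0 by rewrite ln_lt0 // r0.
have [c c0 hc] := tcoef_lower R; have [c1 c10 hc1] := qcoef_even_lower R.
have [c2 c20 hc2] : exists2 c : R, 0 < c & forall x, 1 <= x -> c * x ^+ 4 <= expR (x `^ (1 - s)).
  by apply: expR_powR_lower; rewrite subr_gt0.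
pose lam := - ln (polya_radius R); have lam0 : 0 < lam by rewrite oppr_gt0.
pose K := lam^-1 + 1; have K0 : 0 < K by rewrite addr_gt0 ?invr_gt0.
set rho := polya_radius R in r0 r1 lr0 hc hc1 zE rz lam lam0 K K0 *.
set L := chord_slope R in L0.
(* The constant in [n * m >= c3 * x^2], where [m] is the shift beyond [rho]. *)
pose c3 := c1 * rho * c2 / (L * K ^+ 2).
have c30 : 0 < c3.
  have LK : 0 < L * K ^+ 2 by apply: mulr_gt0 => //; rewrite exprn_gt0.
  by apply: divr_gt0 LK; rewrite !mulr_gt0.
have C0 : 0 <= 9 * expR 1 / c by rewrite divr_ge0 ?mulr_ge0 // ltW.
(* [x > 4 * K] gives [2 * j <= 2 * K * x < x^2 / 2 <= n]; [x >= 3 / c3] raises the exponent to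
   [3 * x]. *)
exists (9 * expR 1 / c), (Num.max (4 * K + 1) (3 / c3)); split; first exact: C0.
move=> n; set x := ln n%:R; set a := _ / 2; set j := (Num.truncn a).+1 => x1.
rewrite ge_max => /andP[xK xc].
have n0 := ln_nat_ge1 x1; have n0' : 0 < n%:R :> R by rewrite ltr0n.
have x0 : 0 < x := lt_le_trans ltr01 x1.
have nE : n%:R = expR x by rewrite lnK.
have ep0 : 0 <= x `^ (- s) by apply: powR_ge0.
have ep1 : x `^ (- s) <= 1.
  by rewrite -(powRr0 x); apply: ler_powR => //; rewrite oppr_le0 ltW.
have aE : a = (1 - x `^ (- s)) * x / lam.
  by rewrite /a /lam; field; rewrite ?oppr_eq0 ?lt_eqF.
have a0 : 0 <= a by rewrite aE divr_ge0 ?mulr_ge0 ?subr_ge0 ?(ltW x0) // ltW.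
have ja : j%:R <= a + 1.
  by rewrite /j -natr1 lerD2r; have /andP[] := truncn_itv a0.
have jK : j%:R <= K * x.
  apply: le_trans ja _; rewrite /K mulrDl mul1r lerD // aE mulrC.
  rewrite ler_wpM2l ?invr_ge0 ?(ltW lam0) // ler_piMl ?(ltW x0) // gerBl.
  exact: ep0.
have hn := @expR_ge_sqr R x (ltW x0); rewrite -nE in hn.
have kn : (2 * j < n)%N.
  rewrite -(ltr_nat R) natrM; apply: le_lt_trans (_ : 2 * (K * x) < _).
    by rewrite ler_wpM2l.
  apply: lt_le_trans hn; rewrite expr2; nra.
(* Without rounding, [n * rho^a] is [exp (x^(1-s))]; since [j <= a + 1], rounding costs at most one
   factor [rho]. *)
have nrj : rho * expR (x `^ (1 - s)) <= n%:R * rho ^+ j.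
  rewrite exprn_expR // {1}nE -(lnK (_ : rho \is Num.pos)) // expRK -!expRD ler_expR.
  rewrite -powR_subr //.
  have : (a + 1) * ln rho <= j%:R * ln rho by rewrite ler_wnM2r // ltW.
  have -> : (a + 1) * ln rho = - x + x `^ (- s) * x + ln rho.
    by rewrite aE /lam; field; rewrite ?oppr_eq0 ?lt_eqF.
  lra.
pose q := qcoef R (2 * j).+1 * rho ^+ (2 * j).+1.
have q0 : 0 <= q by rewrite mulr_ge0 ?qcoef_ge0 ?exprn_ge0 // ltW.
have j0 : 0 < j%:R :> R by rewrite ltr0n.
have nq : c1 * rho * c2 / K ^+ 2 * x ^+ 2 <= n%:R * q.
  apply: (@le_trans _ _ (c1 / j%:R ^+ 2 * (n%:R * rho ^+ j))); last first.
    rewrite mulrCA [leRHS]mulrC [leRHS]mulrC ler_wpM2l //; exact: hc1.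
  apply: (@le_trans _ _ (c1 / (K * x) ^+ 2 * (rho * (c2 * x ^+ 4)))).
    rewrite [leRHS](_ : _ = c1 * rho * c2 / K ^+ 2 * x ^+ 2) //.
    by field; rewrite !gt_eqF.
  apply: ler_pM.
  - by rewrite divr_ge0 ?exprn_ge0 ?mulr_ge0 // ltW.
  - by rewrite !mulr_ge0 ?exprn_ge0 // ltW.
  - rewrite ler_wpM2l ?(ltW c10) // lef_pV2 ?posrE ?exprn_gt0 ?mulr_gt0 //.
    by apply: lerXn2r; rewrite ?nnegrE ?mulr_ge0 // ltW.
  - apply: le_trans nrj; rewrite ler_wpM2l ?(ltW r0) //; exact: hc2.
pose m := q / L; have m0 : 0 <= m by rewrite divr_ge0 // ltW.
have rmz : rho + m <= sqrt_radius R by rewrite -lerBrDl; apply: removed_mass_le.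
(* Three powers of [n] are gained: two compensate [t_n rho^n >= c / (e * n^2)], and the third is the
   final [expR (- x)]. *)
have nm : 3 * x <= n%:R * (m / sqrt_radius R).
  apply: (@le_trans _ _ (n%:R * m)); last first.
    rewrite ler_wpM2l // ler_pdivlMr // ler_piMr // ltW //.
  rewrite /m mulrA ler_pdivlMr //; apply: le_trans nq.
  have -> : c1 * rho * c2 / K ^+ 2 * x ^+ 2 = c3 * x * x * L.
    by rewrite /c3; field; rewrite !gt_eqF.
  rewrite ler_wpM2r ?(ltW L0) // ler_wpM2r ?(ltW x0) //.
  by rewrite mulrC -ler_pdivrMr.
have hP := @avoid_size_le R n (2 * j) kn.
have hr := shift_ratio_le n r0 m0 rmz.
have s0' := stirling_gt0 R n0; have sn := stirling_ge R n0; have ht := hc n n0.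
have w0 : 0 < stirling R n / n%:R by apply: divr_gt0.
have rn0 : 0 < rho ^+ n by rewrite exprn_gt0.
have t0 : 0 < tcoef R n.
  rewrite -(pmulr_lgt0 _ rn0); apply: lt_le_trans ht; exact: mulr_gt0.
rewrite decomp_probE -/(tcoef R n) ler_pdivrMr // -(ler_pM2r rn0).
rewrite -/rho -/q -/L -/m in hP.
set P := _ / _ in hP *.
have P0 : 0 <= P by rewrite divr_ge0.
apply: (@le_trans _ _ (9 * expR (- (3 * x)))).
  apply: (@le_trans _ _ (P * ((rho + m) ^+ n * expR (- (n%:R * (m / sqrt_radius R)))))).
    by rewrite ler_wpM2l.
  rewrite [leLHS]mulrA; apply: ler_pM => //.
  - by rewrite mulr_ge0 // exprn_ge0 // addr_ge0 // ltW.
  - by rewrite ler_expR lerN2.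
apply: (@le_trans _ _ (9 * expR 1 / c * expR (- x) * (c * (stirling R n / n%:R)))); last first.
  rewrite -[leRHS]mulrA; apply: ler_wpM2l ht; rewrite mulr_ge0 ?expR_ge0 //.
have alg (e f S k C : R) : C != 0 -> k != 0 ->
    9 * e / C * f * (C * (S / k)) = 9 * (f * (e * (k * S) / k ^+ 2)).
  by move=> CC k0; field; rewrite CC k0.
rewrite alg ?gt_eqF // ler_wpM2l //.
have -> : - (3 * x) = - x + - (x + x) by ring.
rewrite expRD ler_wpM2l ?expR_ge0 // expRN expRD -nE -expr2 -[leLHS]mul1r.
rewrite ler_wpM2r ?invr_ge0 ?exprn_ge0 // mulrC -ler_pdivrMr // div1r.
exact: sn.
Qed.

Lemma max_D_forest_le (n M : nat) (f : {ffun 'I_n -> 'I_n}) (s : {perm 'I_n}) :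
  forest_event (fun l => (l <= M)%N) f s -> (max_D_forest f s <= M)%N.
Proof. by move=> /forall_inP h; apply/bigmax_leqP. Qed.

Lemma max_D_forest_ge (n k : nat) (f : {ffun 'I_n -> 'I_n}) (s : {perm 'I_n}) :
  ~~ forest_event (fun l => l != k) f s -> (k <= max_D_forest f s)%N.
Proof.
case/forall_inPn => v vC; rewrite negbK => /eqP <-.
exact: (@leq_bigmax_cond _ (mem (C_tree s)) (fun v => #|D_forest f s v|)).
Qed.

Lemma powR_exp_small (R : realType) (a C d : R) : 0 < a -> 0 < d -> 0 < C -> exists X : R,
  forall x, 1 <= x -> X <= x -> C * expR (- x `^ a) <= d.
Proof.
move=> a0 d0 C0; pose u := Num.max 1 (ln (C / d)).
have u0 : 0 < u by rewrite lt_max ltr01.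
exists (u `^ a^-1) => x x1 xX; have x0 : 0 <= x by lra.
have ux : u <= x `^ a.
  have -> : u = (u `^ a^-1) `^ a by rewrite -powRrM mulVf ?gt_eqF // powRr1 // ltW.
  by apply: ge0_ler_powR; rewrite ?nnegrE ?powR_ge0 // ltW.
have : ln (C / d) <= x `^ a by apply: le_trans ux; rewrite le_max lexx orbT.
rewrite -ler_expR lnK ?posrE ?divr_gt0 // ler_pdivrMr // => h.
by rewrite expRN ler_pdivrMr ?expR_gt0 // mulrC.
Qed.

Local Open Scope classical_set_scope.

Theorem theorem3 (R : realType) (s : R) (hs0 : 0 < s) (hs1 : s < 1) :
  (fun n : nat =>
     @decomp_prob n R (fun f sigma =>
       let ln_n := ln (n%:R : R) in
       let m := - 2 * ln_n / ln (polya_radius R) in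
       ((1 - ln_n `^ (- s)) * m <= (max_D_forest f sigma)%:R)
       && ((max_D_forest f sigma)%:R <= (1 + ln_n `^ (- s)) * m)))
  @ \oo --> (1 : R).
Proof.
have [C1 [X1 [C10 h1]]] := upper_tail s; have [C2 [X2 [C20 h2]]] := lower_tail hs0 hs1.
apply/cvgrPdist_le => d d0.
have a0 : 0 < 1 - s by rewrite subr_gt0.
(* For [x >= 1], [expR (- x)] is at most the other exponential, so the upper tail counts twice and
   the lower tail once; the 1 keeps [C] positive. *)
pose C := 2 * C1 + C2 + 1; have C0 : 0 < C by rewrite /C; lra.
have [X3 h3] := powR_exp_small a0 d0 C0.
pose X := Num.max 1 (Num.max X1 (Num.max X2 X3)).
near=> n.
have xX : X <= ln n%:R.
  have hn : expR X <= n%:R by near: n; exact: nbhs_infty_ger.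
  by rewrite -[X]expRK ler_ln ?posrE ?expR_gt0 // (lt_le_trans (expR_gt0 X)).
move: xX; rewrite !ge_max => /and4P[x1 xX1 xX2 xX3].
rewrite ger0_norm ?subr_ge0 ?decomp_prob_le1 //.
set E := (X in decomp_prob R X).
have [r0 r1 _ _] := polya_radius_spec R.
have lr0 : ln (polya_radius R) < 0 by rewrite ln_lt0 // r0.
set x := ln n%:R in x1 xX1 xX2 xX3 *; have x0 : 0 < x := lt_le_trans ltr01 x1.
pose m := - 2 * x / ln (polya_radius R).
have m0 : 0 <= m.
  have -> : m = 2 * x / - ln (polya_radius R) by rewrite /m invrN mulrN !mulNr.
  by rewrite divr_ge0 ?mulr_ge0 ?oppr_ge0 // ltW.
have p0 : 0 <= x `^ (- s) by apply: powR_ge0.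
have p1 : x `^ (- s) <= 1.
  by rewrite -(powRr0 x); apply: ler_powR => //; rewrite oppr_le0 ltW.
have hM : 0 <= (1 + x `^ (- s)) * m by rewrite mulr_ge0 ?addr_ge0.
have hj : 0 <= (1 - x `^ (- s)) * m / 2 by apply: divr_ge0 => //; apply: mulr_ge0 m0; rewrite subr_ge0.
have /andP[M1 _] := truncn_itv hM; have /andP[_ j1] := truncn_itv hj.
have hE := @decomp_prob_sandwich R n E
  (forest_event (fun l => (l <= Num.truncn ((1 + x `^ (- s)) * m))%N))
  (forest_event (fun l => l != (2 * (Num.truncn ((1 - x `^ (- s)) * m / 2)).+1)%N)).
(* If the chosen even size occurs, it lies above the lower end of the window, because its half
   exceeds half of that end. *)
have {hE} /hE : forall f g,
    forest_event (fun l => (l <= Num.truncn ((1 + x `^ (- s)) * m))%N) f g ->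
    ~~ forest_event (fun l => l != (2 * (Num.truncn ((1 - x `^ (- s)) * m / 2)).+1)%N) f g ->
    E f g.
  move=> f g /max_D_forest_le fM /max_D_forest_ge fj; apply/andP; split.
    apply: (@le_trans _ _ (2 * (Num.truncn ((1 - x `^ (- s)) * m / 2)%R).+1)%N%:R).
      by rewrite natrM [leRHS]mulrC -ler_pdivrMr // ltW.
    by rewrite ler_nat.
  by apply: le_trans M1; rewrite ler_nat.
have := h1 n x1 xX1; have := h2 n x1 xX2; have := h3 x x1 xX3.
rewrite -/x -/m => k3 k2 k1 hE.
have ex : expR (- x) <= expR (- x `^ (1 - s)).
  by rewrite ler_expR lerN2 ler1_powR // gerBl ltW.
have e0 := expR_ge0 (- x).
apply: le_trans k3; rewrite /C.
move: (decomp_prob R E) (decomp_prob R _) (decomp_prob R _) (expR _) (expR _) k1 k2 hE ex e0.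
move=> a b c e f; nra.
Unshelve. all: by end_near.
Qed.
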